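(* There is an algorithm that solves TMSDFP in $\min\{n^{m},m^{2n}\}\,\mathrm{Poly}(m,n,L)$ arithmetic operations, where $n$ is the number of input matrices, $m$ is their order, $L$ is the maximal number of bits needed to encode an entry of the input matrices $Q^{(1)},\dots,Q^{(n)}$, and $\mathrm{Poly}$ denotes some polynomial.
   Context: $\mathbb{T}=\mathbb{R}\cup\{-\infty\}$; $\mathbb{T}_\pm$ is the disjoint union of $\mathbb{T}_+=\mathbb{R}$, $\mathbb{T}_-=\{\ominus a:a\in\mathbb{R}\}$ (a formal second copy of $\mathbb{R}$) and $\{-\infty\}$; $|a|=|\ominus a|=a$, $|-\infty|=-\infty$. A matrix over $\mathbb{T}_\pm$ is tropical Metzler if its off-diagonal entries are in $\mathbb{T}_-\cup\{-\infty\}$. For symmetric tropical Metzler matrices $Q^{(1)},\dots,Q^{(n)}\in\mathbb{T}_\pm^{m\times m}$ the associated tropical Metzler spectrahedron is the set of $x\in\mathbb{T}^n$ with $Q_{ii}^+(x)\ge Q_{ii}^-(x)$ for all $i\in[m]$ and $Q_{ii}^+(x)+Q_{jj}^+(x)\ge 2Q_{ij}^-(x)$ for all $i<j$ in $[m]$, where $Q^+_{ij}(x)$ (resp. $Q^-_{ij}(x)$) is the maximum of $|Q_{ij}^{(k)}|+x_k$ over the $k\in[n]$ with $Q_{ij}^{(k)}\in\mathbb{T}_+$ (resp. $\mathbb{T}_-$), $\max\emptyset=-\infty$. It is trivial if it equals $\{(-\infty,\dots,-\infty)\}$. TMSDFP is the decision problem: given symmetric tropical Metzler matrices $Q^{(1)},\dots,Q^{(n)}\in\mathbb{T}_\pm^{m\times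 m}$ (with rational moduli for the entries different from $-\infty$) such that every $Q^{(k)}$ has at least one coefficient in $\mathbb{T}_-$ and for every $i\in[m]$ there is $k\in[n]$ with $Q^{(k)}_{ii}\in\mathbb{T}_+$, is the associated tropical Metzler spectrahedron trivial? *)

(* Defs.v *)
From HB Require Import structures.
From mathcomp Require Import all_boot all_order all_algebra.
From mathcomp Require Import boolp classical_sets reals constructive_ereal.
From mathcomp Require mpoly.
Set Implicit Arguments.
Unset Strict Implicit.
Unset Printing Implicit Defensive.
Import Order.TTheory GRing.Theory Num.Theory.
Local Open Scope ring_scope.

(* Signed tropical numbers: [TPos a] is the element a of T_+, [TNeg a] is the
   element (-)a of T_-, [TNinf] is -oo.  [strop R] is T_{+-}; the elements of
   T_{+-} that are -oo or have a rational modulus are represented in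
   [strop rat]. *)
Inductive strop (K : Type) : Type := TPos of K | TNeg of K | TNinf.
Arguments TNinf {K}.

Definition strop_map (K K' : Type) (f : K -> K') (a : strop K) : strop K' :=
  match a with
  | TPos x => TPos (f x)
  | TNeg x => TNeg (f x)
  | TNinf => TNinf
  end.

Definition is_pos (K : Type) (a : strop K) : bool :=
  if a is TPos _ then true else false.

Definition is_neg (K : Type) (a : strop K) : bool :=
  if a is TNeg _ then true else false.

Definition tabs (R : realType) (a : strop R) : \bar R :=
  match a with
  | TPos x => x%:E
  | TNeg x => x%:E
  | TNinf => -oo%E
  end.

Definition tropical_metzler (K : Type) (m : nat) (A : 'M[strop K]_m) : Prop :=
  forall i j : 'I_m, i != j -> ~~ is_pos (A i j).

Section Spectrahedron.
Variables (R : realType) (m n : nat) (Q : 'I_n -> 'M[strop R]_m).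

Definition Qplus (i j : 'I_m) (x : 'I_n -> \bar R) : \bar R :=
  (\big[maxe/-oo]_(k < n | is_pos (Q k i j)) (tabs (Q k i j) + x k))%E.

Definition Qminus (i j : 'I_m) (x : 'I_n -> \bar R) : \bar R :=
  (\big[maxe/-oo]_(k < n | is_neg (Q k i j)) (tabs (Q k i j) + x k))%E.

(* A point of T^n is an [x : 'I_n -> \bar R] that avoids +oo. *)
Definition spectrahedron : set ('I_n -> \bar R) :=
  [set x | [/\ forall k, (x k < +oo)%E,
      forall i, (Qminus i i x <= Qplus i i x)%E
    & forall i j : 'I_m, (i < j)%N ->
        (2%:E * Qminus i j x <= Qplus i i x + Qplus j j x)%E]]%classic.

Definition trivial_spectrahedron : Prop :=
  spectrahedron = [set (fun _ : 'I_n => -oo%E)]%classic.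

End Spectrahedron.

Definition to_real (R : realType) (m n : nat) (Q : 'I_n -> 'M[strop rat]_m) :
    'I_n -> 'M[strop R]_m :=
  fun k => map_mx (strop_map (ratr : rat -> R)) (Q k).

Record tmsdfp_instance (m n : nat) (Q : 'I_n -> 'M[strop rat]_m) : Prop := {
  inst_sym : forall k, (Q k)^T = Q k;
  inst_metzler : forall k, tropical_metzler (Q k);
  inst_neg : forall k, exists i j, is_neg (Q k i j);
  inst_diag : forall i, exists k, is_pos (Q k i i)
}.

(* Binary encoding length: a sign bit and ceil(log2(|z|+1)) bits for an
   integer z; numerator and denominator (in lowest terms) for a rational;
   two more bits to tell T_+, T_- and -oo apart. *)
Definition int_bits (z : int) : nat := (up_log 2 `|z|.+1).+1.

Definition rat_bits (q : rat) : nat := (int_bits (numq q) + int_bits (denq q))%N.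

Definition strop_bits (a : strop rat) : nat :=
  match a with
  | TPos q => (rat_bits q).+2
  | TNeg q => (rat_bits q).+2
  | TNinf => 2
  end.

Definition max_bits (m n : nat) (Q : 'I_n -> 'M[strop rat]_m) : nat :=
  \max_(k < n) \max_(i < m) \max_(j < m) strop_bits (Q k i j).

(* Model of computation: structured programs for a random access machine in
   the arithmetic (unit-cost) model.  The memory consists of numbered
   unbounded arrays of naturals (counters and indices) and of rationals.  The
   operations on rationals are the field operations and comparison (x / 0 = 0
   as in [rat]); neither rounding nor bit extraction nor conversion from
   rationals to naturals is available.  A program is a fixed finite syntax
   tree, independent of the sizes of its inputs. *)
Inductive nexp : Type :=
| NConst of nat
| NGet of nat & nexp              (* array number, index *)
| NAdd of nexp & nexp
| NSub of nexp & nexp             (* truncated *)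
| NMul of nexp & nexp.

Inductive qexp : Type :=
| QConst of rat
| QOfNat of nexp
| QGet of nat & nexp
| QAdd of qexp & qexp
| QSub of qexp & qexp
| QMul of qexp & qexp
| QDiv of qexp & qexp.

Inductive bexp : Type :=
| NLe of nexp & nexp
| QLe of qexp & qexp
| BNot of bexp
| BAnd of bexp & bexp.

Inductive cmd : Type :=
| Skip
| NSet of nat & nexp & nexp       (* array number, index, value *)
| QSet of nat & nexp & qexp
| Seq of cmd & cmd
| If of bexp & cmd & cmd
| While of bexp & cmd.

Record state : Type := State {
  nmem : nat -> nat -> nat;       (* array number, index *)
  qmem : nat -> nat -> rat
}.

Definition upd (T : Type) (f : nat -> nat -> T) (a i : nat) (v : T) :
    nat -> nat -> T :=
  fun b j => if (b == a) && (j == i) then v else f b j.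

Fixpoint neval (s : state) (e : nexp) : nat :=
  match e with
  | NConst c => c
  | NGet a e1 => nmem s a (neval s e1)
  | NAdd e1 e2 => (neval s e1 + neval s e2)%N
  | NSub e1 e2 => (neval s e1 - neval s e2)%N
  | NMul e1 e2 => (neval s e1 * neval s e2)%N
  end.

Fixpoint qeval (s : state) (e : qexp) : rat :=
  match e with
  | QConst c => c
  | QOfNat e1 => (neval s e1)%:R
  | QGet a e1 => qmem s a (neval s e1)
  | QAdd e1 e2 => qeval s e1 + qeval s e2
  | QSub e1 e2 => qeval s e1 - qeval s e2
  | QMul e1 e2 => qeval s e1 * qeval s e2
  | QDiv e1 e2 => qeval s e1 / qeval s e2
  end.

Fixpoint beval (s : state) (e : bexp) : bool :=
  match e with
  | NLe e1 e2 => (neval s e1 <= neval s e2)%N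
  | QLe e1 e2 => qeval s e1 <= qeval s e2
  | BNot e1 => ~~ beval s e1
  | BAnd e1 e2 => beval s e1 && beval s e2
  end.

(* Every elementary operation is charged one unit: arithmetic operations,
   comparisons, Boolean operations, constants and memory accesses. *)
Fixpoint ncost (e : nexp) : nat :=
  match e with
  | NConst _ => 1
  | NGet _ e1 => (ncost e1).+1
  | NAdd e1 e2 | NSub e1 e2 | NMul e1 e2 => (ncost e1 + ncost e2).+1
  end.

Fixpoint qcost (e : qexp) : nat :=
  match e with
  | QConst _ => 1
  | QOfNat e1 | QGet _ e1 => (ncost e1).+1
  | QAdd e1 e2 | QSub e1 e2 | QMul e1 e2 | QDiv e1 e2 =>
      (qcost e1 + qcost e2).+1
  end.

Fixpoint bcost (e : bexp) : nat :=
  match e with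
  | NLe e1 e2 => (ncost e1 + ncost e2).+1
  | QLe e1 e2 => (qcost e1 + qcost e2).+1
  | BNot e1 => (bcost e1).+1
  | BAnd e1 e2 => (bcost e1 + bcost e2).+1
  end.

(* [exec c s t s']: started in s, the program c halts in s' after t elementary
   operations. *)
Inductive exec : cmd -> state -> nat -> state -> Prop :=
| exec_skip s : exec Skip s 1 s
| exec_nset s a e v :
    exec (NSet a e v) s (ncost e + ncost v).+1
      (State (upd (nmem s) a (neval s e) (neval s v)) (qmem s))
| exec_qset s a e v :
    exec (QSet a e v) s (ncost e + qcost v).+1
      (State (nmem s) (upd (qmem s) a (neval s e) (qeval s v)))
| exec_seq c1 c2 s s1 s2 t1 t2 :
    exec c1 s t1 s1 -> exec c2 s1 t2 s2 -> exec (Seq c1 c2) s (t1 + t2)%N s2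
| exec_if b c1 c2 s s' t :
    exec (if beval s b then c1 else c2) s t s' ->
    exec (If b c1 c2) s (bcost b + t).+1 s'
| exec_while_false b c s :
    ~~ beval s b -> exec (While b c) s (bcost b).+1 s
| exec_while_true b c s s1 s2 t1 t2 :
    beval s b -> exec c s t1 s1 -> exec (While b c) s1 t2 s2 ->
    exec (While b c) s (bcost b + t1 + t2).+1 s2.

Lemma exec_det c s t1 s1 t2 s2 :
  exec c s t1 s1 -> exec c s t2 s2 -> t1 = t2 /\ s1 = s2.
Proof.
move=> H; elim: H t2 s2 => {c s t1 s1} [s|s a e v|s a e v
  |c1 c2 s s1 s2 t1 t2 _ IH1 _ IH2|b c1 c2 s s' t _ IH|b c s nb
  |b c s s1 s2 t1 t2 hb _ IH1 _ IH2] t3 s3 H; inversion H; subst;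
  try congruence; try (exfalso; by match goal with
    hT : is_true ?b, hF : is_true (~~ ?b) |- _ => rewrite hT in hF end);
  repeat match goal with
    IH : forall t s, exec ?c ?s0 t s -> _, e : exec ?c ?s0 _ _ |- _ =>
      case: (IH _ _ e) => ? ?; subst; clear e end; by [].
Qed.

(* Input format.  Array 0 of naturals holds n and m; the entry (i, j) of the
   k-th matrix is described at index (k * m + i) * m + j by its kind (array 1
   of naturals: 0 for -oo, 1 for T_+, 2 for T_-) and by the numerator and the
   denominator of its modulus (arrays 0 and 1 of rationals).  The modulus of -oo is stored as 0/1, cells
   beyond the last entry read like an entry -oo, and all other memory is 0. *)
Definition entry_at (m n : nat) (Q : 'I_n -> 'M[strop rat]_m) (p : nat) :
    strop rat :=
  match insub (p %/ (m * m))%N, insub (p %/ m %% m)%N, insub (p %% m)%N with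
  | Some k, Some i, Some j => Q k i j
  | _, _, _ => TNinf
  end.

Lemma entry_atE (m n : nat) (Q : 'I_n -> 'M[strop rat]_m)
    (k : 'I_n) (i j : 'I_m) :
  entry_at Q ((k * m + i) * m + j)%N = Q k i j.
Proof.
have m0 : (0 < m)%N by apply: leq_ltn_trans (ltn_ord i).
rewrite /entry_at divnMA !divnMDl // (divn_small (ltn_ord j)) addn0.
rewrite divnMDl // (divn_small (ltn_ord i)) addn0 !modnMDl.
by rewrite !modn_small ?ltn_ord // !valK.
Qed.

Definition kind (a : strop rat) : nat :=
  match a with TNinf => 0 | TPos _ => 1 | TNeg _ => 2 end.

Definition modulus (a : strop rat) : rat :=
  match a with TNinf => 0 | TPos q => q | TNeg q => q end.

Definition init_state (m n : nat) (Q : 'I_n -> 'M[strop rat]_m) : state :=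
  State
    (fun a p => match a with
       | 0 => nth 0%N [:: n; m] p
       | 1 => kind (entry_at Q p)
       | _ => 0%N end)
    (fun a p => match a with
       | 0 => (numq (modulus (entry_at Q p)))%:~R
       | 1 => (denq (modulus (entry_at Q p)))%:~R
       | _ => 0 end).

Definition output (s : state) : nat := nmem s 0 0.

(* [solves_tmsdfp R c T]: on every instance, c halts within T m n L elementary
   operations and outputs 1 if the spectrahedron is trivial and 0 otherwise. *)
Definition solves_tmsdfp (R : realType) (c : cmd) (T : nat -> nat -> nat -> int) :
    Prop :=
  forall (m n : nat) (Q : 'I_n -> 'M[strop rat]_m), tmsdfp_instance Q ->
    exists t s, [/\ exec c (init_state Q) t s,
      output s = `[< trivial_spectrahedron (to_real R Q) >] :> nat
    & t%:Z <= T m n (max_bits Q)].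

Definition eval3 (P : mpoly.mpoly 3 int) (m n L : nat) : int :=
  mpoly.meval (tnth [tuple m%:Z; n%:Z; L%:Z]) P.

(* Main.v *)
(* With F_k(x) the minimum over the negative entries (i, j) of Q^(k) of
   - |Q^(k)_ij| + (Q^+_ii(x) + Q^+_jj(x)) / 2, the spectrahedron is the set of the
   x with x <= F(x): it describes a stochastic mean payoff game.  Either some
   x <> -oo satisfies x <= F(x) or some real y satisfies F(y) < y, and these
   exclude each other.  This dichotomy passes from two games that differ only in
   the moves allowed at one state to their union, by taking the maximum of two
   x's or the minimum of two y's normalized at that state; so it reduces to
   Markov chains, where states are eliminated one by one.

   Fixing a policy of either player (n^m or m^(2n) of them) leaves the
   feasibility of a system of strict linear inequalities.  For the policies of
   the maximizer, values -oo are avoided by a restart of tiny probability at a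
   fixed state, and weak inequalities by a tiny bonus; Cramer's rule at a vertex
   shows how tiny they can be.

   The linear systems V x > 0 are solved by a perceptron with rescaling, which
   needs no square roots: w moves by B v_i for a violated row v_i, where B is the
   inverse of G = 1 + (scaled rows).  The G-norm of w grows like the square root
   of the number of steps, so a row violated often enough is at most 1/2 on every
   normalized solution and can be doubled, B being updated by the
   Sherman-Morrison formula.  A row that has been doubled too often refutes
   feasibility. *)
Require Import Defs.
From mathcomp Require Import all_boot all_order all_algebra perm.
From mathcomp Require Import ring lra zify.
From mathcomp Require Import boolp reals.
From mathcomp Require constructive_ereal.
From mathcomp Require mpoly.
Set Implicit Arguments.
Unset Strict Implicit.
Unset Printing Implicit Defensive.
Import Order.TTheory GRing.Theory Num.Theory.
Local Open Scope ring_scope.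

(** The linear systems are used with a gap. Any solution of the system of one policy, however small
    its margin, proves that the game is won (or lost), while a won (lost) game yields some policy
    whose system has a solution in the unit ball with margin at least [1 / K], where
    [K = kap Q ^ 13]. So feasibility need not be decided exactly: the solver returns a solution or
    excludes all solutions of that margin, and it stops once a scale exceeds [K]. As scales double
    and [K] has polynomially many bits, this takes polynomially many steps. Restart and bonus are
    powers of [1 / kap]. A lost policy game is lost by [2 / kap ^ 3], which absorbs a bonus
    [1 / kap ^ 3]. A restart of probability [1 / kap ^ 5] shifts values in [[0, kap]] by much less
    than the bonus, yet lifts a value [- kap ^ 6] by [kap], more than any payoff takes away. Only
    the player with fewer policies is enumerated: [n ^ m] for the maximizer, because payoffs split
    into one term per row; [m ^ (2 n)] for the minimizer, who picks an ordered pair of indices for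
    each matrix. *)

Section Games.

(** * Dichotomy of stochastic games *)

Variables (F : realFieldType) (n : nat).

Definition line := (F * {ffun 'I_n -> F})%type.

Definition lval (l : line) (y : 'I_n -> F) : F := l.1 + \sum_i l.2 i * y i.

Definition stochastic (l : line) : Prop :=
  (forall i, 0 <= l.2 i) /\ \sum_i l.2 i = 1.

Definition supported (l : line) (S : {set 'I_n}) : Prop :=
  forall i, l.2 i != 0 -> i \in S.

Lemma lval_le (l : line) (x y : 'I_n -> F) :
  (forall i, 0 <= l.2 i) -> (forall i, l.2 i != 0 -> x i <= y i) ->
  lval l x <= lval l y.
Proof.
move=> l0 xy; rewrite lerD2l; apply: ler_sum => i _.
have [->|li] := eqVneq (l.2 i) 0; first by rewrite !mul0r.
exact: ler_wpM2l (xy _ li).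
Qed.

Lemma lval_shift (l : line) (x : 'I_n -> F) (t : F) :
  stochastic l -> lval l (fun i => x i + t) = lval l x + t.
Proof.
move=> [_ l1]; rewrite /lval -addrA; congr (_ + _).
under eq_bigr do rewrite mulrDr; rewrite big_split /=.
by rewrite -mulr_suml l1 mul1r.
Qed.

Lemma fin_lower_bound (P : pred 'I_n) (f : 'I_n -> F) :
  (forall i, P i -> 0 < f i) -> exists2 e, 0 < e & forall i, P i -> e < f i.
Proof.
move=> f0.
suff [e e0 He] : exists2 e, 0 < e & forall i, i \in enum 'I_n -> P i -> e < f i.
  by exists e => // i; apply: He; rewrite mem_enum.
elim: (enum _) => [|i s [e e0 He]]; first by exists 1.
have [Pi|nPi] := boolP (P i); last first.
  exists e => // j; rewrite inE => /orP[/eqP -> Pj|/He //].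
  by rewrite Pj in nPi.
have fi := f0 _ Pi; exists (Num.min e (f i / 2)).
  by rewrite lt_min e0 divr_gt0.
move=> j; rewrite inE => /orP[/eqP -> _|/He H Pj].
  by rewrite gt_min; apply/orP; right; lra.
by rewrite gt_min H.
Qed.

Lemma fin_upper_bound (f : 'I_n -> F) : exists M, forall i, f i < M.
Proof.
exists (\sum_i `|f i| + 1) => i; rewrite (bigD1 i) //=.
have := ler_norm (f i).
have : 0 <= \sum_(j < n | j != i) `|f j| by apply: sumr_ge0.
lra.
Qed.

(* A row [None] stands for a state of value -oo; the induction eliminates one
   state at a time, and a losing absorbing state turns into one of value
   -oo. *)
Lemma chain_dichotomy (A : {set 'I_n}) (r : 'I_n -> option line) :
  (forall k l, k \in A -> r k = Some l -> stochastic l /\ supported l A) ->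
  (exists y, forall k l, k \in A -> r k = Some l -> lval l y < y k) \/
  (exists (S : {set 'I_n}) x, [/\ S != set0, S \subset A &
     forall k, k \in S -> exists l, [/\ r k = Some l, supported l S
       & x k <= lval l x]]).
Proof.
have [N] := ubnP #|A|; elim: N A r => // N IH A r; rewrite ltnS => AN rA.
have [->|/set0Pn[k kA]] := eqVneq A set0.
  by left; exists (fun=> 0) => k l; rewrite inE.
pose A' := A :\ k.
have A'N : (#|A'| < N)%N by rewrite (leq_trans _ AN) // [X in (_ < X)%N](cardsD1 k) kA.
have lvalD1 l y : lval l y = l.2 k * y k + (l.1 + \sum_(i | i != k) l.2 i * y i).
  by rewrite /lval (bigD1 k) //= addrCA.
(* A state [k] without a row, or absorbing at a loss, has value -oo. It is removed, and every row
   that uses it becomes [None]. *)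
have dead : (forall l, r k = Some l -> l.2 k = 1 /\ l.1 < 0) ->
  (exists y, forall k l, k \in A -> r k = Some l -> lval l y < y k) \/
  (exists (S : {set 'I_n}) x, [/\ S != set0, S \subset A &
     forall k, k \in S -> exists l, [/\ r k = Some l, supported l S
       & x k <= lval l x]]).
  move=> rk.
  pose r' j := if r j is Some l then if l.2 k == 0 then Some l else None else None.
  have r'E j l : r' j = Some l -> r j = Some l /\ l.2 k = 0.
    by rewrite /r'; case: (r j) => // l'; case: eqP => // H [<-].
  case: (IH A' r' A'N).
  - move=> j l; rewrite inE => /andP[_ jA] /r'E[rj lk].
    have [ls lA] := rA _ _ jA rj; split=> // i li; rewrite !inE lA // andbT.
    by apply: contraNneq li => ->; rewrite lk.
  - move=> [y Hy]; left.
    (* With the value [- M] at [k], a row [j] that uses [k] is strict as soon as [M] exceeds [f j].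
       Row [k] itself is strict because its constant is negative. *)
    pose f j := if r j is Some l then
      (l.1 + \sum_(i | i != k) l.2 i * y i - y j) / l.2 k else 0.
    have [M HM] := fin_upper_bound f.
    exists (fun i => if i == k then - M else y i) => j l jA rj.
    rewrite lvalD1 eqxx.
    rewrite (eq_bigr (fun i => l.2 i * y i)); last first.
      by move=> i /negbTE ->.
    have [ls lA] := rA _ _ jA rj.
    have [jk|njk] := eqVneq j k.
      rewrite jk in rj; have [lk l0] := rk _ rj; case: ls => l_ge l1.
      rewrite lk mul1r big1 ?addr0; first by lra.
      move=> i ik; suff -> : l.2 i = 0 by rewrite mul0r.
      apply/eqP; rewrite eq_le l_ge andbT.
      move: l1; rewrite (bigD1 k) //= lk (bigD1 i) //=.
      have : 0 <= \sum_(i0 < n | (i0 != k) && (i0 != i)) l.2 i0 by exact: sumr_ge0.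
      lra.
    have [lk|lk] := eqVneq (l.2 k) 0.
      have := Hy j l; rewrite lvalD1 lk mul0r add0r mul0r add0r; apply.
        by rewrite !inE njk.
      by rewrite /r' rj lk eqxx.
    have lk0 : 0 < l.2 k by rewrite lt_neqAle eq_sym lk ls.1.
    have := HM j; rewrite /f rj ltr_pdivrMr //.
    by rewrite mulrN [M * _]mulrC; lra.
  - move=> [S [x [S0 SA HS]]]; right; exists S, x; split=> //.
      by rewrite (subset_trans SA) ?subsetDl.
    by move=> j /HS[l [/r'E[rj _] ? ?]]; exists l.
case rk: (r k) => [l|]; last by apply: dead; rewrite rk.
have [[l_ge l1] lA] := rA _ _ kA rk.
have lk1 : l.2 k <= 1.
  rewrite -l1 (bigD1 k) //= lerDl; exact: sumr_ge0.
have [lk|lk] := eqVneq (l.2 k) 1.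
  case: (ltP l.1 0) => l0.
    by apply: dead => l'; rewrite rk => -[<-].
  (* An absorbing state without loss wins on its own. *)
  right; exists [set k], (fun=> 0); split.
  - by apply/set0Pn; exists k; rewrite inE.
  - by rewrite sub1set.
  move=> j; rewrite inE => /eqP ->; exists l; split=> //.
    move=> i; rewrite inE; apply: contraNT => ik.
    rewrite eq_le l_ge andbT.
    move: l1; rewrite (bigD1 k) //= lk (bigD1 i) //=.
    have : 0 <= \sum_(i0 < n | (i0 != k) && (i0 != i)) l.2 i0 by exact: sumr_ge0.
    lra.
  by rewrite /lval big1 ?addr0 // => i _; rewrite mulr0.
have {lk1}lk : 0 < 1 - l.2 k by rewrite subr_gt0 lt_neqAle lk.
have lk' : 1 - l.2 k != 0 by rewrite gt_eqF.
(* Row [k] is solved for its own unknown and substituted into the other rows, which keeps them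
   stochastic. *)
pose sub (l' : line) : line := (l'.1 + l'.2 k * (l.1 / (1 - l.2 k)),
  [ffun i => if i == k then 0 else l'.2 i + l'.2 k * (l.2 i / (1 - l.2 k))]).
have subE l' y : lval (sub l') y = l'.1 + \sum_(i | i != k) l'.2 i * y i +
    l'.2 k * ((l.1 + \sum_(i | i != k) l.2 i * y i) / (1 - l.2 k)).
  rewrite lvalD1 /= ffunE eqxx mul0r add0r.
  rewrite (eq_bigr (fun i => l'.2 i * y i + l'.2 k / (1 - l.2 k) * (l.2 i * y i))).
    rewrite big_split /= -mulr_sumr; ring.
  by move=> i ik; rewrite ffunE (negbTE ik); ring.
case: (IH A' (fun j => omap sub (r j)) A'N).
- move=> j l'; rewrite !inE => /andP[jk jA].
  case rj: (r j) => [q|//] [<-]; have [[q0 q1] qA] := rA _ _ jA rj.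
  split; first split.
  + move=> i; rewrite /= ffunE; case: ifP => // _.
    by rewrite addr_ge0 ?mulr_ge0 // invr_ge0 ltW.
  + have -> : \sum_i (sub q).2 i = lval (sub q) (fun=> 1) - (sub q).1.
      rewrite /lval addrC addKr; apply: eq_bigr => i _; by rewrite mulr1.
    rewrite subE /=.
    under eq_bigr do rewrite mulr1; under [X in _ * ((_ + X) / _)]eq_bigr do rewrite mulr1.
    move: q1 l1; rewrite (bigD1 k) //= => q1; rewrite (bigD1 k) //= => l1.
    have -> : \sum_(i < n | i != k) q.2 i = 1 - q.2 k by rewrite -q1; ring.
    have -> : \sum_(i < n | i != k) l.2 i = 1 - l.2 k by rewrite -l1; ring.
    field; exact: lk'.
  + move=> i; rewrite /= ffunE !inE; case: (eqVneq i k) => [_|_]; first by rewrite eqxx.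
    rewrite /=; apply: contraNT => iA.
    have -> : q.2 i = 0 by apply/eqP; apply: contraNT iA; apply: qA.
    have -> : l.2 i = 0 by apply/eqP; apply: contraNT iA; apply: lA.
    by rewrite mul0r mulr0 addr0.
- move=> [y Hy]; left.
  pose v := (l.1 + \sum_(i | i != k) l.2 i * y i) / (1 - l.2 k).
  pose slack j := if r j is Some q then y j - lval (sub q) y else 1.
  (* Raising the value of [k] by [e] above its solved value [v] makes row [k] strict. The other rows
     give [k] a weight at most 1 and so lose at most [e], which is less than their slack. *)
  have [|e e0 He] := @fin_lower_bound [pred j | j \in A'] slack.
    move=> j /= jA; rewrite /slack; case rj: (r j) => [q|//].
    by rewrite subr_gt0; apply: Hy; rewrite ?rj.
  exists (fun i => if i == k then v + e else y i) => j q jA rj.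
  rewrite lvalD1 eqxx (eq_bigr (fun i => q.2 i * y i)); last first.
    by move=> i /negbTE ->.
  have [[q0 q1] qA] := rA _ _ jA rj.
  have qk1 : q.2 k <= 1.
    rewrite -q1 (bigD1 k) //= lerDl; exact: sumr_ge0.
  have [jk|njk] := eqVneq j k.
    move: rj; rewrite jk rk => -[<-].
    have -> : l.1 + \sum_(i < n | i != k) l.2 i * y i = v * (1 - l.2 k).
      by rewrite /v divfK.
    have := mulr_gt0 lk e0; lra.
  have := He j; rewrite !inE njk jA => /(_ isT); rewrite /slack rj subE -/v.
  have : q.2 k * e <= e by rewrite ler_piMl // ltW.
  lra.
- move=> [S [x [S0 SA HS]]]; right.
  pose v := (l.1 + \sum_(i | i != k) l.2 i * x i) / (1 - l.2 k).
  pose x' i := if i == k then v else x i.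
  have kS : k \notin S.
    by apply/negP => /(subsetP SA); rewrite !inE eqxx.
  have rows j : j \in S -> exists q, [/\ r j = Some q,
      forall i, i != k -> q.2 i != 0 -> i \in S,
      q.2 k != 0 -> forall i, i != k -> l.2 i != 0 -> i \in S
    & x' j <= lval q x'].
    move=> jS; have [q' [+ q'S]] := HS j jS.
    have /andP[jk jA] : (j != k) && (j \in A).
      by have := subsetP SA _ jS; rewrite !inE.
    case rj: (r j) => [q|//] [qE] xj; exists q.
    have [[q0 q1] qA] := rA _ _ jA rj.
    have pos i : 0 <= q.2 k * (l.2 i / (1 - l.2 k)).
      by rewrite mulr_ge0 // divr_ge0 // ltW.
    split=> //.
    + move=> i ik qi; apply: q'S; rewrite -qE /= ffunE (negbTE ik).
      by rewrite gt_eqF // ltr_wpDr // lt_neqAle eq_sym qi q0.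
    + move=> qk i ik li; apply: q'S; rewrite -qE /= ffunE (negbTE ik).
      rewrite gt_eqF // ltr_wpDl // mulr_gt0 ?divr_gt0 //.
        by rewrite lt_neqAle eq_sym qk q0.
      by rewrite lt_neqAle eq_sym li l_ge.
    + rewrite lvalD1 /x' eqxx (negbTE jk).
      rewrite (eq_bigr (fun i => q.2 i * x i)); last by move=> i /negbTE ->.
      by move: xj; rewrite -qE subE -/v addrC.
  (* If the other successors of [k] lie in [S], then [k] joins [S] with the value [v]. Otherwise [k]
     keeps the value -oo, and no row of [S] gives it weight, since that would put those successors
     into [S]. *)
  have [lS|nlS] := boolP [forall i, (i != k) && (l.2 i != 0) ==> (i \in S)].
    exists (k |: S), x'; split.
    + by apply/set0Pn; exists k; rewrite !inE eqxx.
    + rewrite subUset sub1set kA (subset_trans SA) ?subsetDl //.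
    move=> j; rewrite !inE => /orP[/eqP ->|/rows[q [rj q1 q2 q3]]].
      exists l; split=> //.
        move=> i li; rewrite !inE; case: eqVneq => //= ik.
        by move/forallP/(_ i): lS; rewrite ik li.
      rewrite lvalD1 /x' eqxx.
      rewrite (eq_bigr (fun i => l.2 i * x i)); last by move=> i /negbTE ->.
      have -> : l.1 + \sum_(i < n | i != k) l.2 i * x i = v * (1 - l.2 k).
        by rewrite /v divfK.
      by rewrite [_ * v]mulrC -mulrDr addrC subrK mulr1.
    exists q; split=> // i qi; rewrite !inE; case: eqVneq => //= ik; exact: q1.
  exists S, x'; split=> //; first by rewrite (subset_trans SA) ?subsetDl.
  move=> j /rows[q [rj q1 q2 q3]]; exists q; split=> // i qi.
  have [ik|ik] := eqVneq i k; last exact: q1.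
  case/negP: nlS; apply/forallP => i'; apply/implyP => /andP[? ?].
  by apply: q2 => //; rewrite -ik.
Qed.

(** An element of the outer list is a move of the minimizer; the lines in it are the replies of the
    maximizer. *)
Definition game := 'I_n -> seq (seq line).

Definition super_strict (g : game) (y : 'I_n -> F) : Prop :=
  forall k, exists2 A, A \in g k & {in A, forall l, lval l y < y k}.

(* [x] is -oo outside [S]. *)
Definition sub_on (g : game) (S : {set 'I_n}) (x : 'I_n -> F) : Prop :=
  forall k, k \in S -> forall A, A \in g k ->
  exists l, [/\ l \in A, supported l S & x k <= lval l x].

Definition winning (g : game) : Prop := exists S x, S != set0 /\ sub_on g S x.

Definition losing (g : game) : Prop := exists y, super_strict g y.

Definition stochastic_game (g : game) : Prop :=
  forall k A, A \in g k -> {in A, forall l, stochastic l}.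

Definition upd_row (g : game) (k : 'I_n) (s : seq (seq line)) : game :=
  fun j => if j == k then s else g j.

Lemma upd_row_sum (h h' : 'I_n -> nat) (k : 'I_n) :
  (forall j, j != k -> h' j = h j) -> (h' k < h k)%N ->
  (\sum_j h' j < \sum_j h j)%N.
Proof.
move=> jk hk; rewrite (bigD1 k) //= [X in (_ < X)%N](bigD1 k) //=.
by rewrite (eq_bigr _ jk) ltn_add2r.
Qed.

(** Lines are monotone, and a line supported in [S] reads only coordinates that the maximum does not
    lower. *)
Lemma max_sub_on (l : line) (S S' : {set 'I_n}) (x x' : 'I_n -> F) (k : 'I_n) :
  stochastic l -> supported l S -> x k <= lval l x ->
  let mx i := if i \in S then if i \in S' then Num.max (x i) (x' i) else x i
              else x' i in
  supported l (S :|: S') /\ x k <= lval l mx.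
Proof.
move=> [l0 _] lS xl mx; split; first by move=> i /lS; rewrite inE => ->.
apply: (le_trans xl); apply: lval_le => // i /lS iS.
rewrite /mx iS; case: ifP => // _; by rewrite le_max lexx.
Qed.

Lemma winning_split (g : game) (k : 'I_n) (s1 s2 : seq (seq line)) :
  stochastic_game g -> g k =i s1 ++ s2 ->
  winning (upd_row g k s1) -> winning (upd_row g k s2) -> winning g.
Proof.
move=> gs gk [S1 [x1 [S10 H1]]] [S2 [x2 [S20 H2]]].
(* A winning set that avoids [k] is not affected by the moves at [k]. *)
have [k1|k1] := boolP (k \in S1); last first.
  exists S1, x1; split=> // j jS A Ag; apply: (H1 j jS A); rewrite /upd_row.
  by case: eqP => // jk; rewrite -jk jS in k1.
have [k2|k2] := boolP (k \in S2); last first.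
  exists S2, x2; split=> // j jS A Ag; apply: (H2 j jS A); rewrite /upd_row.
  by case: eqP => // jk; rewrite -jk jS in k2.
pose z1 i := x1 i + - x1 k; pose z2 i := x2 i + - x2 k.
have shift g' S x t : stochastic_game g' -> sub_on g' S x ->
    sub_on g' S (fun i => x i + t).
  move=> g's H j jS A Ag; have [l [lA lS xl]] := H j jS A Ag.
  by exists l; split=> //; rewrite lval_shift ?lerD2r //; apply: g's Ag _ lA.
have gs1 : stochastic_game (upd_row g k s1).
  move=> j A; rewrite /upd_row; case: eqP => [_|_] Ag; last exact: gs Ag.
  by apply: (gs k); rewrite gk mem_cat Ag.
have gs2 : stochastic_game (upd_row g k s2).
  move=> j A; rewrite /upd_row; case: eqP => [_|_] Ag; last exact: gs Ag.
  by apply: (gs k); rewrite gk mem_cat Ag orbT.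
have {}H1 : sub_on (upd_row g k s1) S1 z1 by exact: shift H1.
have {}H2 : sub_on (upd_row g k s2) S2 z2 by exact: shift H2.
pose z i := if i \in S1 then if i \in S2 then Num.max (z1 i) (z2 i) else z1 i
            else z2 i.
exists (S1 :|: S2), z; split.
  by apply/set0Pn; exists k; rewrite inE k1.
have zC : z =1 fun i => if i \in S2 then if i \in S1 then Num.max (z2 i) (z1 i)
    else z2 i else if i \in S1 then z1 i else z2 i.
  by move=> i; rewrite /z; case: ifP; case: ifP => //; rewrite maxC.
have lift1 j l : stochastic l -> supported l S1 -> z1 j <= lval l z1 ->
    supported l (S1 :|: S2) /\ z1 j <= lval l z.
  exact: max_sub_on.
have lift2 j l : stochastic l -> supported l S2 -> z2 j <= lval l z2 ->
    supported l (S1 :|: S2) /\ z2 j <= lval l z.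
  move=> ls lS H; rewrite setUC.
  have [Hs Hz] := @max_sub_on l S2 S1 z2 z1 j ls lS H; split=> //.
  apply: le_trans Hz _; apply: lval_le; first by case: ls.
  by move=> i /lS iS; rewrite zC iS.
have zk : z k = 0 by rewrite /z k1 k2 /z1 /z2 !subrr maxxx.
move=> j jS A Ag; have [jk|jk] := eqVneq j k.
  subst j; move: Ag; rewrite gk mem_cat => /orP[] As.
    have [|l [lA lS zl]] := H1 k k1 A; first by rewrite /upd_row eqxx.
    have ls : stochastic l by apply: (gs1 k A _ l lA); rewrite /upd_row eqxx.
    exists l; have [? ?] := lift1 k l ls lS zl; split=> //.
    by rewrite zk -(subrr (x1 k)).
  have [|l [lA lS zl]] := H2 k k2 A; first by rewrite /upd_row eqxx.
  have ls : stochastic l by apply: (gs2 k A _ l lA); rewrite /upd_row eqxx.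
  exists l; have [? ?] := lift2 k l ls lS zl; split=> //.
  by rewrite zk -(subrr (x2 k)).
have one : (exists2 l, l \in A & supported l (S1 :|: S2) /\ z j <= lval l z) ->
  exists l, [/\ l \in A, supported l (S1 :|: S2) & z j <= lval l z].
  by move=> [l lA [? ?]]; exists l.
have A1 : j \in S1 -> exists2 l, l \in A & supported l (S1 :|: S2) /\ z1 j <= lval l z.
  move=> j1; have [|l [lA lS zl]] := H1 j j1 A; first by rewrite /upd_row (negbTE jk).
  exists l => //; exact: lift1 (gs _ _ Ag _ lA) _ _.
have A2 : j \in S2 -> exists2 l, l \in A & supported l (S1 :|: S2) /\ z2 j <= lval l z.
  move=> j2; have [|l [lA lS zl]] := H2 j j2 A; first by rewrite /upd_row (negbTE jk).
  exists l => //; exact: lift2 (gs _ _ Ag _ lA) _ _.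
apply: one; rewrite {1}/z; move: jS; rewrite inE.
case: ifP => [/A1 j1|_ /= /A2 //]; case: ifP => [/A2 j2 _|//].
by case: (leP (z1 j) (z2 j)).
Qed.

(** The minimum of the two normalized potentials works because every state offers a single set of
    lines; with several, the two potentials could rely on different sets. This is why the choices of
    the minimizer are split before those of the maximizer. *)
Lemma losing_split (g : game) (k : 'I_n) (A A1 A2 : seq line) :
  stochastic_game g -> (forall j, exists B, g j = [:: B]) ->
  g k = [:: A] -> A =i A1 ++ A2 ->
  losing (upd_row g k [:: A1]) -> losing (upd_row g k [:: A2]) -> losing g.
Proof.
move=> gs g1 gk AE [y1 H1] [y2 H2].
pose z1 i := y1 i + - y1 k; pose z2 i := y2 i + - y2 k.
have z1H l : stochastic l -> lval l z1 = lval l y1 - y1 k by exact: lval_shift.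
have z2H l : stochastic l -> lval l z2 = lval l y2 - y2 k by exact: lval_shift.
exists (fun i => Num.min (z1 i) (z2 i)) => j; have [B gj] := g1 j.
exists B; first by rewrite gj inE.
move=> l lB.
have ls : stochastic l by apply: (gs j B); rewrite // gj inE.
have le1 : lval l (fun i => Num.min (z1 i) (z2 i)) <= lval l z1.
  by apply: lval_le => [|i _]; [case: ls|rewrite ge_min lexx].
have le2 : lval l (fun i => Num.min (z1 i) (z2 i)) <= lval l z2.
  by apply: lval_le => [|i _]; [case: ls|rewrite ge_min lexx orbT].
have := z1H l ls; have := z2H l ls.
have [jk|jk] := eqVneq j k.
  subst j; rewrite /z1 /z2 !subrr minxx; move: gj lB; rewrite gk => -[<-].
  rewrite AE mem_cat => /orP[] lB.
    by have [C] := H1 k; rewrite /upd_row eqxx inE => /eqP -> /(_ l lB); lra.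
  by have [C] := H2 k; rewrite /upd_row eqxx inE => /eqP -> /(_ l lB); lra.
rewrite lt_min.
have [C] := H1 j; rewrite /upd_row (negbTE jk) gj inE => /eqP -> /(_ l lB).
have [C'] := H2 j; rewrite /upd_row (negbTE jk) gj inE => /eqP -> /(_ l lB).
by rewrite /z1 /z2 => *; apply/andP; split; lra.
Qed.

Lemma max_dichotomy (g : game) :
  stochastic_game g -> (forall k, exists2 A, g k = [:: A] & A != [::]) ->
  winning g \/ losing g.
Proof.
have [N] := ubnP (\sum_k (size (head [::] (g k))))%N.
elim: N g => // N IH g; rewrite ltnS => gN gs g1.
have [/existsP[k k2]|/existsPn small] :=
    boolP [exists k, (1 < size (head [::] (g k)))%N].
  have [A gk _] := g1 k; move: k2; rewrite gk /=.
  case AE: A => [|l1 [|l2 A']] // _.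
  have rec (B : seq line) : {subset B <= A} -> B != [::] -> (size B < size A)%N ->
      winning (upd_row g k [:: B]) \/ losing (upd_row g k [:: B]).
    move=> BA B0 sB; apply: IH.
    - apply: leq_trans gN; apply: (@upd_row_sum _ _ k).
        by move=> j /negbTE jk; rewrite /upd_row jk.
      by rewrite /upd_row eqxx gk.
    - move=> j C; rewrite /upd_row; case: eqP => [jk|_]; last exact: gs.
      rewrite inE => /eqP -> l /BA; apply: (gs k); by rewrite gk inE.
    move=> j; rewrite /upd_row; case: eqP => [jk|_]; last exact: g1.
    by exists B.
  have up (B : seq line) : {subset B <= A} -> winning (upd_row g k [:: B]) -> winning g.
    move=> BA [S [x [S0 H]]]; exists S, x; split=> // j jS C Cg.
    have [jk|jk] := eqVneq j k; last first.
      by apply: H => //; rewrite /upd_row (negbTE jk).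
    subst j; have [|l [lB ? ?]] := H k jS B; first by rewrite /upd_row eqxx inE.
    by exists l; split=> //; move: Cg; rewrite gk inE => /eqP ->; apply: BA.
  have sub1 : {subset [:: l1] <= A} by move=> l; rewrite AE !inE => ->.
  have sub2 : {subset l2 :: A' <= A} by move=> l; rewrite AE !inE => H; rewrite H orbT.
  case: (rec [:: l1]) => // [|/(up _ sub1)|H1]; [by rewrite AE|by left|].
  case: (rec (l2 :: A')) => // [|/(up _ sub2)|H2]; [by rewrite AE|by left|].
  right; apply: losing_split (gk) _ H1 H2 => //.
    by move=> j; have [B ? _] := g1 j; exists B.
  by rewrite AE.
have row k : exists l, g k = [:: [:: l]].
  have [A gk A0] := g1 k; have := small k; rewrite gk /=.
  by case: A gk A0 => [|l [|]] // gk _ _; exists l.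
pose r k := Some (head (0, [ffun=> 0]) (head [::] (g k))) : option line.
case: (@chain_dichotomy setT r).
- move=> k l _ [<-]; have [l' gk] := row k; rewrite gk /=.
  split; last by move=> i; rewrite inE.
  by apply: (gs k [:: l']); rewrite ?gk inE.
- move=> [y Hy]; right; exists y => k; have [l gk] := row k.
  exists [:: l]; first by rewrite gk inE.
  move=> l'; rewrite inE => /eqP ->.
  by apply: Hy; rewrite ?inE // /r gk.
- move=> [S [x [S0 _ H]]]; left; exists S, x; split=> // k kS A.
  have [l [+ + +]] := H k kS; have [l' gk] := row k; rewrite /r gk /= inE.
  by move=> [<-] lS xl /eqP ->; exists l'; rewrite inE.
Qed.

(** Induction on the number of moves of the minimizer. If one half of the moves at [k] loses, so
    does the whole game; otherwise both halves win and [winning_split] joins them. [max_dichotomy]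
    is the dual induction once the minimizer has no choice left. *)
Theorem game_dichotomy (g : game) :
  stochastic_game g ->
  (forall k, g k != [::]) -> (forall k A, A \in g k -> A != [::]) ->
  winning g \/ losing g.
Proof.
have [N] := ubnP (\sum_k (size (g k)))%N.
elim: N g => // N IH g; rewrite ltnS => gN gs g0 gA.
have [/existsP[k k2]|/existsPn small] := boolP [exists k, (1 < size (g k))%N].
  move: k2; case gk: (g k) => [|A1 [|A2 s]] // _.
  have rec (s' : seq (seq line)) : {subset s' <= g k} -> s' != [::] -> (size s' < size (g k))%N ->
      winning (upd_row g k s') \/ losing (upd_row g k s').
    move=> sg s0 ss; apply: IH.
    - apply: leq_trans gN; apply: (@upd_row_sum _ _ k).
        by move=> j /negbTE jk; rewrite /upd_row jk.
      by rewrite /upd_row eqxx.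
    - move=> j C; rewrite /upd_row; case: eqP => [jk|_]; last exact: gs.
      by move=> /sg; apply: gs.
    - by move=> j; rewrite /upd_row; case: (j =P k) => // _; apply: g0.
    - move=> j C; rewrite /upd_row; case: eqP => [jk|_]; last exact: gA.
      by move=> /sg; apply: gA.
  have up (s' : seq (seq line)) : {subset s' <= g k} -> losing (upd_row g k s') -> losing g.
    move=> sg [y Hy]; exists y => j; have [A + HA] := Hy j.
    rewrite /upd_row; case: (j =P k) => [jk|_] AS; last by exists A.
    by subst j; exists A => //; apply: sg.
  have sub1 : {subset [:: A1] <= g k} by move=> l; rewrite gk !inE => ->.
  have sub2 : {subset A2 :: s <= g k} by move=> l; rewrite gk !inE => H; rewrite H orbT.
  case: (rec [:: A1]) => // [|H1|/(up _ sub1)]; [by rewrite gk| |by right].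
  case: (rec (A2 :: s)) => // [|H2|/(up _ sub2)]; [by rewrite gk| |by right].
  by left; apply: winning_split H1 H2 => //; rewrite gk.
apply: max_dichotomy => // k; move: (small k) (g0 k) (gA k).
case: (g k) => [|A [|]] // _ _ /(_ A); rewrite inE eqxx => /(_ isT) A0.
by exists A.
Qed.

End Games.

(** * Small solutions of systems with integer coefficients *)

Lemma norm_det_le (R : numDomainType) (d : nat) (A : 'M[R]_d) (H : R) :
  0 <= H -> (forall i j, `|A i j| <= H) -> `|\det A| <= d`!%:R * H ^+ d.
Proof.
move=> H0 AH; rewrite /determinant.
apply: le_trans (ler_norm_sum _ _ _) _.
apply: (@le_trans _ _ (\sum_(s : 'S_d) H ^+ d)).
  apply: ler_sum => s _; rewrite normrM normrX normrN1 expr1n mul1r normr_prod.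
  rewrite -[in leRHS](card_ord d) -prodr_const.
  by apply: ler_prod => i _; rewrite normr_ge0 AH.
by rewrite sumr_const card_Sn mulr_natl.
Qed.

Definition is_int (x : rat) : Prop := exists z : int, x = z%:~R.

Lemma int_norm_ge1 (x : rat) : is_int x -> x != 0 -> 1 <= `|x|.
Proof.
move=> [z ->]; rewrite intr_eq0 -intr_norm => z0.
by rewrite (ler_int _ 1) -gtz0_ge1 normr_gt0.
Qed.

Section Vertex.
Variables (N d : nat) (A : 'M[rat]_(N, d)) (b : 'I_N -> rat).

Definition tight (z : 'cV[rat]_d) (r : 'I_N) := (A *m z) r 0 == b r.

Definition feasible (z : 'cV[rat]_d) := forall r, b r <= (A *m z) r 0.

(** Loose rows are zeroed instead of removed, which keeps the shape fixed while the set of tight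
    rows grows. *)
Definition tight_mx (z : 'cV[rat]_d) : 'M_(N, d) :=
  \matrix_(r, c) if tight z r then A r c else 0.

Lemma mul_tight_mx z (v : 'cV_d) r :
  (tight_mx z *m v) r 0 = if tight z r then (A *m v) r 0 else 0.
Proof.
rewrite !mxE; case: ifP => H; first by apply: eq_bigr => c _; rewrite mxE H.
by rewrite big1 // => c _; rewrite mxE H mul0r.
Qed.

(* Moving along a direction of the kernel of the tight rows keeps them tight,
   until a further row becomes tight. *)
Lemma purification_step (z : 'cV[rat]_d) :
  feasible z ->
  (forall v : 'cV[rat]_d, v != 0 -> exists r, (A *m v) r 0 != 0) ->
  (\rank (tight_mx z) < d)%N ->
  exists2 z', feasible z' & (#|tight z| < #|tight z'|)%N.
Proof.
move=> fz ker rk.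
have [v v0 tv] : exists2 v : 'cV[rat]_d, v != 0 & tight_mx z *m v = 0.
  have : kermx (tight_mx z)^T != 0.
    rewrite kermx_eq0 -row_leq_rank -ltnNge mxrank_tr //.
  case/rowV0Pn => u /sub_kermxP u1 u0; exists u^T.
    by rewrite -(inj_eq (@trmx_inj _ _ _)) trmxK trmx0.
  by apply: (can_inj trmxK); rewrite trmx_mul trmxK u1 trmx0.
have tv0 r : tight z r -> (A *m v) r 0 = 0.
  by move=> zr; have := mul_tight_mx z v r; rewrite tv zr mxE.
(* Up to its sign, the kernel direction decreases some row, so the motion along it has to stop. *)
have [w [r0 wr0] wt] : exists2 w : 'cV[rat]_d, exists r, (A *m w) r 0 < 0 &
    forall r, tight z r -> (A *m w) r 0 = 0.
  have [r rv] := ker v v0.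
  case: (ltrgt0P ((A *m v) r 0)) rv => // rv _.
    exists (- v); first by exists r; rewrite mulmxN mxE oppr_lt0.
    by move=> s /tv0 s0; rewrite mulmxN mxE s0 oppr0.
  by exists v => //; exists r.
(* Ratio test: [t r] is the step length at which a decreasing row [r] becomes tight, and the
   smallest one preserves feasibility. *)
pose t r := ((A *m z) r 0 - b r) / - (A *m w) r 0.
case: (@arg_minP _ _ _ r0 [pred r | (A *m w) r 0 < 0] t wr0) => r /= wr tmin.
have zr : ~~ tight z r by apply/negP => /wt wr'; rewrite wr' ltxx in wr.
have tr : 0 <= t r.
  by rewrite divr_ge0 ?subr_ge0 ?fz // oppr_ge0 ltW.
have E s : (A *m (z + t r *: w)) s 0 = (A *m z) s 0 + t r * (A *m w) s 0.
  by rewrite mulmxDr -scalemxAr !mxE.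
have tw s : (A *m w) s 0 < 0 -> t s * (A *m w) s 0 = b s - (A *m z) s 0.
  by move=> ws; rewrite /t; field; rewrite lt_eqF.
exists (z + t r *: w).
  move=> s; rewrite E; case: (ltP ((A *m w) s 0) 0) => ws.
    have := tmin s ws; have := tw s ws.
    have : 0 <= (t s - t r) * - (A *m w) s 0 -> t s * (A *m w) s 0 <= t r * (A *m w) s 0.
      by lra.
    move=> H1 H2 H3; have := H1; rewrite mulr_ge0 ?subr_ge0 ?oppr_ge0 ?(ltW ws) //.
    by move=> /(_ isT); lra.
  by rewrite -[b s]addr0 lerD ?fz // mulr_ge0.
apply: proper_card; apply/properP; split.
  by apply/subsetP => s; rewrite !unfold_in E => zs; rewrite wt // mulr0 addr0.
by exists r => //; rewrite unfold_in /tight E tw //; apply/eqP; ring.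
Qed.

Lemma purification (z : 'cV[rat]_d) :
  feasible z ->
  (forall v : 'cV[rat]_d, v != 0 -> exists r, (A *m v) r 0 != 0) ->
  exists2 z', feasible z' & \rank (tight_mx z') = d.
Proof.
move=> + ker.
have [k] := ubnP (N - #|tight z|)%N; elim: k z => // k IH z; rewrite ltnS => zk fz.
have [H|H] := ltnP (\rank (tight_mx z)) d; last first.
  by exists z => //; apply/eqP; rewrite eqn_leq H rank_leq_col.
have [z' fz' z'z] := purification_step fz ker H.
apply: (IH z') => //; have := max_card (tight z'); rewrite card_ord => zN.
apply: leq_trans zk; rewrite ltn_sub2l //; exact: leq_trans zN.
Qed.

(** At a point whose tight rows have full rank, [d] independent ones form an integer matrix [B] with
    [|det B| >= 1]. By Cramer's rule each coordinate is then at most a sum of [d] cofactors in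
    absolute value, as the right sides lie in [[0, 1]]. *)
Lemma vertex_bound (H : nat) (z : 'cV[rat]_d) :
  (0 < H)%N ->
  (forall r c, is_int (A r c) /\ `|A r c| <= H%:R) ->
  (forall r, 0 <= b r <= 1) -> feasible z ->
  (forall v : 'cV[rat]_d, v != 0 -> exists r, (A *m v) r 0 != 0) ->
  exists2 z', feasible z' & forall c, `|z' c 0| <= (d`! * H ^ d)%N%:R.
Proof.
move=> H0 AH b01 fz ker; have [z' fz' rk] := purification fz ker.
exists z' => // c.
have full : row_full (tight_mx z') by rewrite /row_full rk.
pose f := fullrankfun full.
have Bu : rowsub f (tight_mx z') \in unitmx.
  by rewrite -row_full_unit fullrowsub_full.
set B := rowsub f _ in Bu.
(* A loose row among the selected ones would be a zero row of the invertible matrix [B]. *)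
have ft i : tight z' (f i).
  apply/negP => /negP nt.
  have Bi : row i B = 0 by apply/rowP => j; rewrite !mxE (negbTE nt).
  have := mulmxV Bu => /(congr1 (row i)).
  rewrite row_mul Bi mul0mx => /rowP/(_ i).
  by rewrite !mxE eqxx => /eqP; rewrite eq_sym oner_eq0.
have BE i j : B i j = A (f i) j by rewrite !mxE ft.
have Bz : B *m z' = \col_i b (f i).
  apply/colP => i; rewrite mxE [RHS]mxE.
  have /eqP <- := ft i; rewrite mxE; by apply: eq_bigr => j _; rewrite BE.
have detB : is_int (\det B).
  have BZ i : exists g : {ffun 'I_d -> int}, forall j, B i j = (g j)%:~R.
    have [g Hg] : exists g : 'I_d -> int, forall j, B i j = (g j)%:~R.
      by apply: (@fin_all_exists _ (fun=> int) (fun j z => B i j = z%:~R)) => j; rewrite BE; apply: (AH _ _).1.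
    by exists (finfun g) => j; rewrite ffunE.
  have [g Hg] := @fin_all_exists _ (fun=> {ffun 'I_d -> int}) (fun i g => forall j, B i j = (g j)%:~R) BZ.
  exists (\det (\matrix_(i, j) g i j)).
  have -> : B = map_mx intr (\matrix_(i, j) g i j).
    by apply/matrixP => i j; rewrite (Hg i j) !mxE.
  by rewrite det_map_mx.
have detB0 : \det B != 0 by move: Bu; rewrite unitmxE unitfE.
have zE : \det B * z' c 0 = \sum_j \adj B c j * b (f j).
  have : \det B *: z' = \adj B *m (B *m z').
    by rewrite mulmxA mul_adj_mx mul_scalar_mx.
  rewrite Bz => /colP/(_ c); rewrite [LHS]mxE [RHS]mxE => ->.
  by apply: eq_bigr => j _; congr (_ * _); rewrite mxE.
have := int_norm_ge1 detB detB0 => det1.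
apply: (@le_trans _ _ `|\det B * z' c 0|).
  by rewrite normrM ler_peMl.
rewrite zE; apply: le_trans (ler_norm_sum _ _ _) _.
apply: (@le_trans _ _ (\sum_(j < d) (d.-1`! * H ^ d.-1)%N%:R)); last first.
  rewrite sumr_const card_ord -mulrnA ler_nat.
  case: (d) c {f full Bu B ft BE Bz detB detB0 zE det1} => [[]//|d'] _ /=.
  by rewrite factS expnS; nia.
apply: ler_sum => j _; rewrite normrM -[leRHS]mulr1.
apply: ler_pM => //; last by have /andP[b0 b1] := b01 (f j); rewrite ger0_norm.
rewrite mxE /cofactor normrM normrX normrN1 expr1n mul1r natrM natrX.
apply: norm_det_le => // i k; rewrite 2!mxE BE; exact: (AH _ _).2.
Qed.

End Vertex.

Lemma leq_fact_exp d : (d`! <= d ^ d)%N.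
Proof.
elim: d => // d IH; rewrite factS expnS leq_mul2l /=.
by apply: leq_trans IH _; case: d => // d; rewrite leq_exp2r.
Qed.

(** The extra unknown [t] homogenizes the constants, so that strict inequalities can be scaled up to
    a margin of 1. As the coefficients of a row sum to 0, a solution may be translated until it is
    nonnegative, and [vertex_bound] applies to the polyhedron cut out by these sign conditions. *)
Lemma bounded_solution (T : finType) (n : nat) (A : T -> 'I_n -> int)
    (C : T -> int) (H : nat) (strict : bool) (y : 'I_n -> rat) :
  (0 < H)%N -> (forall r k, `|A r k| <= H%:Z) -> (forall r, `|C r| <= H%:Z) ->
  (forall r, \sum_k A r k = 0) ->
  (forall r, 0 < \sum_k (A r k)%:~R * y k + (C r)%:~R ?<= if ~~ strict) ->
  exists (z : 'I_n -> rat) t, [/\ forall k, 0 <= z k <= ((n.+1 * H) ^ n.+1)%N%:R,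
    1 <= t <= ((n.+1 * H) ^ n.+1)%N%:R &
    forall r, strict%:R <= \sum_k (A r k)%:~R * z k + (C r)%:~R * t].
Proof.
move=> H0 AH CH A0 Hy.
(* In the strict case [s] collects the inverse of every row value. *)
have [s s1 Hs] : exists2 s : rat, 1 <= s &
    forall r, strict%:R <= s * (\sum_k (A r k)%:~R * y k + (C r)%:~R).
  suff [s s1 Hs] : exists2 s : rat, 1 <= s & forall r, r \in enum T ->
      strict%:R <= s * (\sum_k (A r k)%:~R * y k + (C r)%:~R).
    by exists s => // r; apply: Hs; rewrite mem_enum.
  elim: (enum T) => [|r q [s s1 IH]]; first by exists 1.
  pose v r := \sum_k (A r k)%:~R * y k + (C r)%:~R.
  have v0 r' : 0 <= v r' by apply: lteifW (Hy r').
  exists (s + strict%:R / v r).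
    by rewrite ler_wpDr // divr_ge0.
  move=> r'; rewrite inE -/(v r') mulrDl => /orP[/eqP ->|/IH rq]; last first.
    by rewrite ler_wpDr // mulr_ge0 // divr_ge0.
  case: strict Hy {IH} => Hy; last by rewrite mul0r mul0r addr0 mulr_ge0 // (le_trans ler01).
  have := Hy r; rewrite /= -/(v r) => vr; rewrite divfK ?gt_eqF //.
  by rewrite ler_wpDl // mulr_ge0 // (le_trans ler01).
have [M HM] := fin_upper_bound (fun k => - y k).
pose c0 := @ord_max n.
(* The last coordinate [c0] stands for [t]. The added unit rows demand nonnegative coordinates and
   [t >= 1]; they also leave no nonzero vector in the kernel of all rows. *)
pose A' (i : T + 'I_n.+1) (c : 'I_n.+1) : int := match i with
  | inl r => if unlift c0 c is Some k then A r k else C r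
  | inr c' => (c == c')%:Z end.
pose b' (i : T + 'I_n.+1) : rat := match i with
  | inl _ => strict%:R | inr c' => (c' == c0)%:R end.
pose AM := \matrix_(r < #|{: T + 'I_n.+1}|, c < n.+1) (A' (enum_val r) c)%:~R : 'M[rat]_(_, _).
have unl (i : 'I_n) : unlift c0 (widen_ord (leqnSn n) i) = Some i.
  have -> : widen_ord (leqnSn n) i = lift c0 i by apply/val_inj; rewrite /= /bump leqNgt ltn_ord.
  exact: liftK.
have AE i (z : 'cV[rat]_n.+1) : (AM *m z) (enum_rank i) 0 = match i with
  | inl r => \sum_k (A r k)%:~R * z (widen_ord (leqnSn n) k) 0 + (C r)%:~R * z c0 0
  | inr c' => z c' 0 end.
  rewrite mxE (eq_bigr (fun c => (A' i c)%:~R * z c 0)); last first.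
    by move=> c _; rewrite mxE enum_rankK.
  case: i => [r|c'].
    rewrite big_ord_recr /= unlift_none; congr (_ + _).
    by apply: eq_bigr => k _; rewrite unl.
  rewrite (bigD1 c') //= eqxx mul1r big1 ?addr0 // => c cc'.
  by rewrite (negbTE cc') mul0r.
pose z0 := \col_c (if unlift c0 c is Some k then s * (y k + M) else s) : 'cV[rat]_n.+1.
have s0 : 0 <= s by apply: le_trans s1.
case: (@vertex_bound _ _ AM (fun r => b' (enum_val r)) H z0 H0).
- move=> r c; rewrite mxE; split; first by eexists.
  rewrite -intr_norm (_ : H%:R = (H%:Z)%:~R) // ler_int.
  rewrite /A'; case: (enum_val r) => [r'|c'].
    by case: unliftP => *; [apply: AH|apply: CH].
  by case: (c == c'); rewrite ?normr0 ?normr1.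
- by move=> r; rewrite /b'; case: (enum_val r) => [_|c']; [case: strict {Hy Hs b'}|case: eqP].
- move=> r; rewrite -{2}(enum_valK r) AE; case: (enum_val r) => [r'|c'] /=.
    apply: le_trans (Hs r') _; rewrite mxE unlift_none.
    under [in leRHS]eq_bigr => k _ do rewrite mxE unl mulrCA mulrDr.
    rewrite -mulr_sumr big_split /= -mulr_suml -rmorph_sum A0 mul0r addr0.
    by rewrite mulrDr [s * (C _)%:~R]mulrC.
  rewrite mxE; case: (eqVneq c' c0) => [->|cc]; first by rewrite unlift_none.
  case: unliftP => [k _|//]; rewrite mulr_ge0 //; have := HM k; lra.
- move=> v v0; have [c vc] : exists c, v c 0 != 0.
    apply/existsP; rewrite -negb_forall; apply: contra v0 => /forallP v0.
    by apply/eqP/colP => c; rewrite mxE; apply/eqP.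
  by exists (enum_rank (inr c)); rewrite AE.
move=> z fz zb.
have le_kap : ((n.+1)`! * H ^ n.+1)%N%:R <= ((n.+1 * H) ^ n.+1)%N%:R :> rat.
  by rewrite ler_nat expnMn leq_mul2r leq_fact_exp orbT.
have fz' i : b' i <= (AM *m z) (enum_rank i) 0.
  by have := fz (enum_rank i); rewrite enum_rankK.
have z_ge0 c : 0 <= z c 0.
  have := fz' (inr c); rewrite AE /=; apply: le_trans; by case: eqP.
have zle c : z c 0 <= ((n.+1 * H) ^ n.+1)%N%:R.
  by apply: le_trans le_kap; apply: le_trans (zb c); apply: ler_norm.
exists (fun k => z (widen_ord (leqnSn n) k) 0), (z c0 0); split=> [k||r].
- by rewrite z_ge0 zle.
- by rewrite zle andbT; have := fz' (inr c0); rewrite AE /= eqxx.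
- by have := fz' (inl r); rewrite AE.
Qed.

(** * The game of a tropical Metzler spectrahedron *)

Section MetzlerGame.
Variables (m n : nat) (Q : 'I_n -> 'M[strop rat]_m).

(** The inequality [2 (|Q_k,ij| + x_k) <= (|Q_l,ii| + x_l) + (|Q_l',jj| + x_l')], solved for [x_k],
    has this constant term. *)
Definition payoff (k : 'I_n) (i j : 'I_m) (l l' : 'I_n) : rat :=
  (modulus (Q l i i) + modulus (Q l' j j)) / 2 - modulus (Q k i j).

Definition half_line (c : rat) (l l' : 'I_n) : line rat n :=
  (c, [ffun a => ((a == l)%:R + (a == l')%:R) / 2]).

Definition min_moves (k : 'I_n) : seq ('I_m * 'I_m) :=
  enum [pred p : 'I_m * 'I_m | is_neg (Q k p.1 p.2)].

Definition max_moves (p : 'I_m * 'I_m) : seq ('I_n * 'I_n) :=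
  enum [pred q : 'I_n * 'I_n | is_pos (Q q.1 p.1 p.1) && is_pos (Q q.2 p.2 p.2)].

Definition move_line (k : 'I_n) (p : 'I_m * 'I_m) (q : 'I_n * 'I_n) : line rat n :=
  half_line (payoff k p.1 p.2 q.1 q.2) q.1 q.2.

Definition metzler_game : game rat n := fun k =>
  [seq [seq move_line k p q | q <- max_moves p] | p <- min_moves k].

(** A policy answers rows rather than pairs of rows: the two halves of a reply contribute separate
    terms, so they can be optimized independently of each other and of [k]. *)
Definition policy_game (sigma : 'I_m -> 'I_n) : game rat n := fun k =>
  [seq [:: move_line k p (sigma p.1, sigma p.2)] | p <- min_moves k].

Lemma sum_delta (l : 'I_n) (y : 'I_n -> rat) : \sum_i (i == l)%:R * y i = y l.
Proof.
rewrite (bigD1 l) //= eqxx mul1r big1 ?addr0 // => i /negbTE ->.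
by rewrite mul0r.
Qed.

Lemma lval_half c l l' y : lval (half_line c l l') y = c + (y l + y l') / 2.
Proof.
rewrite /lval /=; congr (_ + _).
rewrite -(sum_delta l y) -(sum_delta l' y) -big_split mulr_suml /=.
by apply: eq_bigr => i _; rewrite ffunE; field.
Qed.

Lemma half_stochastic c l l' : stochastic (half_line c l l').
Proof.
split=> /= [i|]; first by rewrite ffunE divr_ge0 ?addr_ge0.
have := lval_half c l l' (fun=> 1); rewrite /lval /= => /addrI E.
transitivity ((1 + 1) / 2 : rat); last by field.
by rewrite -E; apply: eq_bigr => i _; rewrite mulr1.
Qed.

Lemma half_supported c l l' (S : {set 'I_n}) :
  supported (half_line c l l') S <-> l \in S /\ l' \in S.
Proof.
split=> [H|[lS l'S] i].
  split; apply: H; rewrite /= ffunE eqxx mulf_neq0 // gt_eqF //;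
    [apply: ltr_wpDr|apply: ltr_wpDl] => //.
rewrite /= ffunE; case: (eqVneq i l) => [->|_] //=.
by case: (eqVneq i l') => [->|_] //=; rewrite add0r mul0r eqxx.
Qed.

Lemma mem_min_moves k p : (p \in min_moves k) = is_neg (Q k p.1 p.2).
Proof. by rewrite mem_enum. Qed.

Lemma mem_max_moves p q :
  (q \in max_moves p) = is_pos (Q q.1 p.1 p.1) && is_pos (Q q.2 p.2 p.2).
Proof. by rewrite mem_enum. Qed.

Lemma metzler_stochastic : stochastic_game metzler_game.
Proof.
by move=> k A /mapP[p _ ->] l /mapP[q _ ->]; apply: half_stochastic.
Qed.

Lemma policy_stochastic sigma : stochastic_game (policy_game sigma).
Proof.
by move=> k A /mapP[p _ ->] l; rewrite inE => /eqP ->; apply: half_stochastic.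
Qed.

Hypothesis inst : tmsdfp_instance Q.

Lemma metzler_dichotomy : winning metzler_game \/ losing metzler_game.
Proof.
apply: game_dichotomy => [|k|k A].
- exact: metzler_stochastic.
- have [i [j ij]] := inst_neg inst k; apply/eqP => E.
  have := mem_min_moves k (i, j); rewrite ij.
  by move: E; rewrite /metzler_game; case: min_moves.
- move=> /mapP[[i j] _ ->]; have [l li] := inst_diag inst i.
  have [l' lj] := inst_diag inst j; have := mem_max_moves (i, j) (l, l').
  by rewrite /= li lj; case: max_moves.
Qed.

Lemma policy_dichotomy sigma : winning (policy_game sigma) \/ losing (policy_game sigma).
Proof.
apply: game_dichotomy => [|k|k A].
- exact: policy_stochastic.
- have [i [j ij]] := inst_neg inst k; apply/eqP => E.
  have := mem_min_moves k (i, j); rewrite ij.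
  by move: E; rewrite /policy_game; case: min_moves.
- by move=> /mapP[[i j] _ ->].
Qed.

Lemma metzler_winningP :
  winning metzler_game <-> exists (S : {set 'I_n}) x, S != finset.set0 /\
    forall k i j, k \in S -> is_neg (Q k i j) -> exists l l',
      [/\ is_pos (Q l i i) /\ is_pos (Q l' j j), l \in S /\ l' \in S &
          x k <= payoff k i j l l' + (x l + x l') / 2].
Proof.
split=> -[S [x [S0 H]]]; exists S, x; split=> //.
  move=> k i j kS ij.
  have Ag : [seq move_line k (i, j) q | q <- max_moves (i, j)] \in metzler_game k.
    by apply/mapP; exists (i, j) => //; rewrite mem_min_moves.
  have [l [/mapP[[l1 l2] + ->] lS xk]] := H k kS _ Ag.
  rewrite mem_max_moves => /andP[? ?]; exists l1, l2; split=> //.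
    exact: (half_supported _ _ _ S).1 lS.
  by move: xk; rewrite lval_half.
move=> k kS A /mapP[[i j] + ->]; rewrite mem_min_moves => ij.
have [l [l' [[li lj] lS xk]]] := H k i j kS ij.
exists (move_line k (i, j) (l, l')); split.
- by apply/mapP; exists (l, l') => //; rewrite mem_max_moves /= li lj.
- exact/half_supported.
- by rewrite lval_half.
Qed.

Lemma policy_winningP sigma :
  winning (policy_game sigma) <-> exists (S : {set 'I_n}) x, S != finset.set0 /\
    forall k i j, k \in S -> is_neg (Q k i j) ->
      [/\ sigma i \in S, sigma j \in S &
          x k <= payoff k i j (sigma i) (sigma j) + (x (sigma i) + x (sigma j)) / 2].
Proof.
split=> -[S [x [S0 H]]]; exists S, x; split=> //.
  move=> k i j kS ij.
  have Ag : [:: move_line k (i, j) (sigma i, sigma j)] \in policy_game sigma k.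
    by apply/mapP; exists (i, j) => //; rewrite mem_min_moves.
  have [l [+ lS xk]] := H k kS _ Ag; rewrite inE => /eqP lE.
  rewrite lE in lS xk; have [? ?] := (half_supported _ _ _ S).1 lS.
  by split=> //; move: xk; rewrite lval_half.
move=> k kS A /mapP[[i j] + ->]; rewrite mem_min_moves => ij.
have [iS jS xk] := H k i j kS ij.
exists (move_line k (i, j) (sigma i, sigma j)); rewrite inE eqxx; split=> //.
- exact/half_supported.
- by rewrite lval_half.
Qed.

Lemma metzler_losingP :
  losing metzler_game <-> exists y, forall k, exists i j, is_neg (Q k i j) /\
    forall l l', is_pos (Q l i i) -> is_pos (Q l' j j) ->
      payoff k i j l l' + (y l + y l') / 2 < y k.
Proof.
split=> -[y H]; exists y => k.
  have [A /mapP[[i j] + ->] Hk] := H k; rewrite mem_min_moves => ij.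
  exists i, j; split=> // l l' li lj; rewrite -lval_half; apply: Hk.
  by apply/mapP; exists (l, l') => //; rewrite mem_max_moves /= li lj.
have [i [j [ij Hk]]] := H k.
exists [seq move_line k (i, j) q | q <- max_moves (i, j)].
  by apply/mapP; exists (i, j) => //; rewrite mem_min_moves.
move=> l /mapP[[l1 l2] + ->]; rewrite mem_max_moves => /andP[li lj].
by rewrite lval_half; apply: Hk.
Qed.

Lemma policy_losingP sigma :
  losing (policy_game sigma) <-> exists y, forall k, exists i j, is_neg (Q k i j) /\
      payoff k i j (sigma i) (sigma j) + (y (sigma i) + y (sigma j)) / 2 < y k.
Proof.
split=> -[y H]; exists y => k.
  have [A /mapP[[i j] + ->] Hk] := H k; rewrite mem_min_moves => ij.
  exists i, j; split=> //; rewrite -lval_half; apply: Hk.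
  by rewrite inE.
have [i [j [ij Hk]]] := H k.
exists [:: move_line k (i, j) (sigma i, sigma j)].
  by apply/mapP; exists (i, j) => //; rewrite mem_min_moves.
by move=> l; rewrite inE => /eqP ->; rewrite lval_half.
Qed.

(* The policy picks a maximizing diagonal entry in every row. *)
Lemma winning_policy : winning metzler_game -> exists sigma,
  (forall i, is_pos (Q (sigma i) i i)) /\ winning (policy_game sigma).
Proof.
move=> /metzler_winningP[S [x [S0 H]]].
have best i : exists l, is_pos (Q l i i) /\ forall l', l' \in S -> is_pos (Q l' i i) ->
    l \in S /\ modulus (Q l' i i) + x l' <= modulus (Q l i i) + x l.
  have [/existsP[l0 /andP[l0S l0i]]|/existsPn none] :=
      boolP [exists l, (l \in S) && is_pos (Q l i i)].
    have P0 : (fun l => (l \in S) && is_pos (Q l i i)) l0 by rewrite l0S l0i.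
    case: (@arg_maxP _ _ _ l0 (fun l => (l \in S) && is_pos (Q l i i))
      (fun l => modulus (Q l i i) + x l) P0) => l /andP[lS li] lmax.
    by exists l; split=> // l' l'S l'i; split=> //; apply: lmax; rewrite l'S l'i.
  (* No matrix of [S] is available in row [i], so no move from [S] involves this row and any
     positive entry will do. *)
  have [l li] := inst_diag inst i; exists l; split=> // l' l'S l'i.
  by have := none l'; rewrite l'S l'i.
have [sigma Hs] := fin_all_exists best.
exists sigma; split=> [i|]; first by have [] := Hs i.
apply/policy_winningP; exists S, x; split=> // k i j kS ij.
have [l [l' [[li lj] [lS l'S] xk]]] := H k i j kS ij.
have [_ /(_ l lS li) [iS ile]] := Hs i.
have [_ /(_ l' l'S lj) [jS jle]] := Hs j.
split=> //; apply: le_trans xk _; rewrite /payoff; lra.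
Qed.

Lemma policy_winning sigma :
  (forall k i j, is_neg (Q k i j) ->
     is_pos (Q (sigma i) i i) && is_pos (Q (sigma j) j j)) ->
  winning (policy_game sigma) -> winning metzler_game.
Proof.
move=> spos /policy_winningP[S [x [S0 H]]]; apply/metzler_winningP.
exists S, x; split=> // k i j kS ij; have [? ? ?] := H k i j kS ij.
by have /andP[] := spos k i j ij; exists (sigma i), (sigma j).
Qed.

Section Real.
Import constructive_ereal.
Variable R : realType.

(** This and its converse identify the diagonal condition with the case [i = j] of the off-diagonal
    one. *)
Lemma double_le (a b : \bar R) :
  (a <= b)%E -> (2%:E * a <= b + b)%E.
Proof.
have y : (2%:E * +oo = +oo :> \bar R)%E by rewrite gt0_muley // lte_fin.
have Ny : (2%:E * -oo = -oo :> \bar R)%E by rewrite gt0_muleNy // lte_fin.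
case: a b => [a| |] [b| |] //=; rewrite ?y ?Ny ?leey ?leNye //.
by rewrite lee_fin => ab; rewrite -EFinM -EFinD lee_fin; lra.
Qed.

Lemma half_le (a b : \bar R) :
  (2%:E * a <= b + b)%E -> (a <= b)%E.
Proof.
have y : (2%:E * +oo = +oo :> \bar R)%E by rewrite gt0_muley // lte_fin.
have Ny : (2%:E * -oo = -oo :> \bar R)%E by rewrite gt0_muleNy // lte_fin.
case: a b => [a| |] [b| |] //=; rewrite ?y ?Ny ?leey ?leNye //.
by rewrite -EFinM -EFinD !lee_fin => ab; lra.
Qed.

Lemma ratr_half (a b : rat) : ratr ((a + b) / 2) = (ratr a + ratr b) / 2 :> R.
Proof. by rewrite fmorph_div /= rmorphD /= ratr_nat. Qed.

Implicit Types x : 'I_n -> \bar R.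

Lemma is_pos_real k i j : is_pos (to_real R Q k i j) = is_pos (Q k i j).
Proof. by rewrite /to_real mxE; case: (Q k i j). Qed.

Lemma is_neg_real k i j : is_neg (to_real R Q k i j) = is_neg (Q k i j).
Proof. by rewrite /to_real mxE; case: (Q k i j). Qed.

Lemma tabs_real k i j : is_pos (Q k i j) || is_neg (Q k i j) ->
  tabs (to_real R Q k i j) = (ratr (modulus (Q k i j)))%:E.
Proof. by rewrite /to_real mxE; case: (Q k i j). Qed.

Lemma bigmaxe_attained (P : pred 'I_n) (f : 'I_n -> \bar R) :
  (\big[maxe/-oo]_(k | P k) f k)%E = -oo%E \/
  exists2 k, P k & (\big[maxe/-oo]_(k | P k) f k)%E = f k.
Proof.
apply: (big_ind (fun y => y = -oo%E \/ exists2 k, P k & y = f k)).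
- by left.
- move=> a b Ha Hb; rewrite maxEle; by case: ifP.
- by move=> k Pk; right; exists k.
Qed.

Lemma bigmaxe_ge (P : pred 'I_n) (f : 'I_n -> \bar R) k : P k ->
  (f k <= \big[maxe/-oo]_(k | P k) f k)%E.
Proof. by move=> Pk; rewrite (bigD1 k) //= le_max lexx. Qed.

Lemma spectrahedron_le x : spectrahedron (to_real R Q) x -> forall i j,
  (2%:E * Qminus (to_real R Q) i j x <=
   Qplus (to_real R Q) i i x + Qplus (to_real R Q) j j x)%E.
Proof.
move=> [_ Hd Hij] i j; case: (ltngtP i j) => [|ji|/val_inj ->]; first exact: Hij.
  rewrite addeC; apply: le_trans (Hij _ _ ji); rewrite le_eqVlt; apply/orP; left.
  have E k : to_real R Q k i j = to_real R Q k j i.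
    by rewrite /to_real !mxE -[in LHS](inst_sym inst k) mxE.
  apply/eqP; congr (_ * _)%E; rewrite /Qminus; apply: eq_big => k; rewrite E //.
have := Hd j; move: (Qminus _ _ _ _) (Qplus _ _ _ _) => a b.
exact: double_le.
Qed.

(** If [x k] is finite, both maxima on the larger side are finite too, hence attained at matrices
    with finite coordinates. *)
Lemma spectrahedron_moves x : spectrahedron (to_real R Q) x ->
  forall k i j, is_neg (Q k i j) -> x k != -oo%E -> exists l l',
    [/\ is_pos (Q l i i) /\ is_pos (Q l' j j), x l != -oo%E /\ x l' != -oo%E &
        fine (x k) <= ratr (payoff k i j l l') + (fine (x l) + fine (x l')) / 2].
Proof.
move=> xs k i j ij xk; have [xfin _ _] := xs.
have fin l : x l != -oo%E -> x l = (fine (x l))%:E.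
  by have := xfin l; case: (x l).
have := spectrahedron_le xs i j.
have : (tabs (to_real R Q k i j) + x k <= Qminus (to_real R Q) i j x)%E.
  by apply: (bigmaxe_ge (fun k => tabs (to_real R Q k i j) + x k)%E); rewrite is_neg_real.
rewrite tabs_real ?ij ?orbT // (fin k xk) => Hm Hp.
have {Hp} : ((2 * (ratr (modulus (Q k i j)) + fine (x k)))%:E <=
    Qplus (to_real R Q) i i x + Qplus (to_real R Q) j j x)%E.
  by apply: le_trans Hp; rewrite EFinM; apply: lee_wpmul2l => //; rewrite lee_fin.
have plus i' : Qplus (to_real R Q) i' i' x = -oo%E \/ exists l,
    [/\ is_pos (Q l i' i'), x l != -oo%E &
     Qplus (to_real R Q) i' i' x = (ratr (modulus (Q l i' i')) + fine (x l))%:E].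
  case: (bigmaxe_attained (fun k => is_pos (to_real R Q k i' i'))
    (fun k => tabs (to_real R Q k i' i') + x k)%E) => [E|[l]]; first by left.
  rewrite is_pos_real => lp; rewrite -/(Qplus _ _ _ _) tabs_real ?lp // => E.
  have [xl|xl] := eqVneq (x l) -oo%E; first by left; rewrite E xl.
  by right; exists l; split=> //; rewrite E (fin l xl).
case: (plus i) => [->|[l [li xl ->]]]; first by rewrite addNye.
case: (plus j) => [->|[l' [lj xl' ->]]]; first by rewrite addeNy.
rewrite -EFinD lee_fin => H; exists l, l'; split=> //.
rewrite /payoff rmorphB /= ratr_half; move: H; lra.
Qed.

(** Maximum principle: at a finite coordinate [k] where [x k - y k] is largest, the move chosen by
    [y] contradicts the inequality satisfied by [x]. *)
Lemma losing_trivial : losing metzler_game ->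
  trivial_spectrahedron (to_real R Q).
Proof.
move=> /metzler_losingP[y Hy]; rewrite /trivial_spectrahedron; apply/classical_sets.seteqP; split=> [x xs|x ->]; last first.
  have minf (P : pred 'I_n) f : (\big[maxe/-oo]_(k < n | P k) (f k + -oo))%E = -oo%E :> \bar R.
    by case: (bigmaxe_attained P (fun k => f k + -oo)%E) => // -[k _ ->]; rewrite addeNy.
  split=> [//|i|i j _]; rewrite /Qminus minf ?leNye //.
  by rewrite gt0_muleNy ?leNye // lte_fin.
apply/funext => k0; apply: contrapT => /eqP xk0.
have P0 : (fun k => x k != -oo%E) k0 by [].
case: (@arg_maxP _ _ _ k0 (fun k => x k != -oo%E) (fun k => fine (x k) - ratr (y k)) P0).
move=> k xk kmax; have [i [j [ij Hk]]] := Hy k.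
have [l [l' [[li lj] [xl xl'] Hx]]] := spectrahedron_moves xs ij xk.
have := Hk l l' li lj; rewrite -(ltr_rat R) rmorphD /= ratr_half.
have /= := kmax l xl; have /= := kmax l' xl'; move: Hx.
move: (ratr (payoff _ _ _ _ _) : R) (fine (x k) : R) (fine (x l) : R) (fine (x l') : R)
  (ratr (y k) : R) (ratr (y l) : R) (ratr (y l') : R) => p a b c e f g; lra.
Qed.

Lemma winning_nontrivial : winning metzler_game ->
  ~ trivial_spectrahedron (to_real R Q).
Proof.
move=> /metzler_winningP[S [x [/finset.set0Pn[k0 k0S] H]]] triv.
pose z k : \bar R := if k \in S then (ratr (x k))%:E else -oo%E.
have main i j : (2%:E * Qminus (to_real R Q) i j z <=
   Qplus (to_real R Q) i i z + Qplus (to_real R Q) j j z)%E.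
  case: (bigmaxe_attained (fun k => is_neg (to_real R Q k i j))
    (fun k => tabs (to_real R Q k i j) + z k)%E) => [|[k]];
    rewrite -/(Qminus _ _ _ _) ?is_neg_real.
    by move=> ->; rewrite gt0_muleNy ?leNye // lte_fin.
  move=> ij ->; rewrite tabs_real ?ij ?orbT // {1}/z; case: ifP => kS; last first.
    by rewrite addeNy gt0_muleNy ?leNye // lte_fin.
  have [l [l' [[li lj] [lS l'S] Hx]]] := H k i j kS ij.
  have ge i' l2 : is_pos (Q l2 i' i') -> l2 \in S ->
      ((ratr (modulus (Q l2 i' i')) + ratr (x l2))%:E <= Qplus (to_real R Q) i' i' z)%E.
    move=> l2p l2S; have := @bigmaxe_ge (fun k => is_pos (to_real R Q k i' i'))
      (fun k => tabs (to_real R Q k i' i') + z k)%E l2.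
    by rewrite is_pos_real tabs_real ?l2p // {1}/z l2S => /(_ isT).
  apply: le_trans (leeD (ge i l li lS) (ge j l' lj l'S)).
  rewrite -EFinD -EFinM -EFinD lee_fin.
  move: Hx; rewrite -(ler_rat R) rmorphD /payoff rmorphB /= !ratr_half; lra.
have : spectrahedron (to_real R Q) z.
  split=> [k|i|i j _]; last exact: main.
    by rewrite /z; case: ifP => _; rewrite ?ltry ?ltNyr.
  have := main i i; move: (Qminus _ _ _ _) (Qplus _ _ _ _) => a b.
  exact: half_le.
rewrite triv => /(congr1 (fun f => f k0)); by rewrite /z k0S.
Qed.

End Real.
End MetzlerGame.

(** * Sizes of potentials and of gaps *)

Section Bounds.
Variables (m n : nat) (Q : 'I_n -> 'M[strop rat]_m).

(** It dominates both numerator and denominator. The square takes the place of an absolute value, so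
    that the program obtains it by additions and multiplications. *)
Definition ent_factor (p : nat) : nat :=
  ((1 + `|numq (modulus (entry_at Q p))| ^ 2) * `|denq (modulus (entry_at Q p))|)%N.

Definition size_bound : nat := \prod_(p < n * m * m) ent_factor p.

Definition common_den : nat :=
  \prod_(p < n * m * m) `|denq (modulus (entry_at Q p))|%N.

(** Rows cleared of denominators have size at most [4 * size_bound], for which [bounded_solution]
    gives [(n.+1 * (4 * size_bound)) ^ n.+1]. The factor 8 makes [kap] dominate [8] and
    [8 * size_bound] as well. *)
Definition kap : nat := ((8 * n.+1 * size_bound) ^ n.+1)%N.

Lemma absz_denq_gt0 (q : rat) : (0 < `|denq q|)%N.
Proof. by rewrite absz_gt0 denq_neq0. Qed.

Lemma ent_factor_gt0 p : (0 < ent_factor p)%N.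
Proof. by rewrite muln_gt0 absz_denq_gt0. Qed.

Lemma size_bound_gt0 : (0 < size_bound)%N.
Proof. by apply: prodn_gt0 => p; apply: ent_factor_gt0. Qed.

Lemma common_den_gt0 : (0 < common_den)%N.
Proof. by apply: prodn_gt0 => p; apply: absz_denq_gt0. Qed.

Lemma den_le_factor p : (`|denq (modulus (entry_at Q p))| <= ent_factor p)%N.
Proof. by rewrite leq_pmull. Qed.

Lemma common_den_le : (common_den <= size_bound)%N.
Proof. by apply: leq_prod => p _; apply: den_le_factor. Qed.

Lemma kap_ge : (8 * n.+1 * size_bound <= kap)%N.
Proof.
rewrite /kap expnS leq_pmulr // expn_gt0 !muln_gt0 /=.
by rewrite size_bound_gt0.
Qed.

Lemma index3_lt (k i j : nat) : (k < n)%N -> (i < m)%N -> (j < m)%N ->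
  ((k * m + i) * m + j < n * m * m)%N.
Proof. nia. Qed.

Lemma den_modulus (k : 'I_n) (i j : 'I_m) : exists2 z : int,
  z%:~R = common_den%:R * modulus (Q k i j) & (`|z| <= size_bound)%N.
Proof.
rewrite -(entry_atE Q k i j); set p := ((k * m + i) * m + j)%N.
have pE : (p < n * m * m)%N by apply: index3_lt.
set q := modulus _.
(* After clearing, the numerator is multiplied by the other denominators only; each of these numbers
   is covered by its own factor of [size_bound]. *)
pose rest := (\prod_(p' < n * m * m | p' != Ordinal pE) `|denq (modulus (entry_at Q p'))|)%N.
have DE : common_den = (`|denq q| * rest)%N by rewrite /common_den (bigD1 (Ordinal pE)).
exists (numq q * rest%:Z).
  have dq : (`|denq q|%N)%:R = (denq q)%:~R :> rat by rewrite natr_absz gtr0_norm.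
  rewrite DE rmorphM /= natrM dq -pmulrn.
  have := divq_num_den q; have : (denq q)%:~R != 0 :> rat by rewrite intr_eq0 denq_neq0.
  by move: (_%:~R : rat) (_%:~R : rat) => b a b0 <-; field.
rewrite abszM absz_nat /size_bound (bigD1 (Ordinal pE)) //= leq_mul //.
  rewrite /ent_factor -/q; have := absz_denq_gt0 q.
  move: `|numq q|%N `|denq q|%N => a b; nia.
by apply: leq_prod => p' _; apply: den_le_factor.
Qed.

Lemma modulus_le (k : 'I_n) (i j : 'I_m) :
  `|modulus (Q k i j)| <= size_bound%:R.
Proof.
have [z zE zb] := den_modulus k i j.
have D1 : 1 <= common_den%:R :> rat by rewrite ler1n common_den_gt0.
apply: (@le_trans _ _ `|common_den%:R * modulus (Q k i j)|).
  by rewrite normrM ger0_norm ?ler_peMl // (le_trans ler01).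
by rewrite -zE -intr_norm -natr_absz ler_nat.
Qed.

Lemma payoff_le k i j l l' : `|payoff Q k i j l l'| <= 2 * size_bound%:R.
Proof.
have := modulus_le k i j; have := modulus_le l i i; have := modulus_le l' j j.
rewrite /payoff !ler_norml => /andP[? ?] /andP[? ?] /andP[? ?].
by apply/andP; split; lra.
Qed.

Lemma den_payoff k i j l l' : exists2 z : int,
  z%:~R = 2 * common_den%:R * payoff Q k i j l l' & (`|z| <= 4 * size_bound)%N.
Proof.
have [z1 E1 b1] := den_modulus l i i; have [z2 E2 b2] := den_modulus l' j j.
have [z3 E3 b3] := den_modulus k i j.
exists (z1 + z2 - 2 * z3); last by lia.
by rewrite !rmorphD rmorphN rmorphM /= E1 E2 E3 /payoff; field.
Qed.

(* The sign [sg] covers both directions of the inequality between a potential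
   and its one-step expectation. *)
Lemma bounded_potential (T : finType) (P : pred T) (k a b : T -> 'I_n)
    (pay : T -> rat) (strict : bool) (sg : bool) (y : 'I_n -> rat) :
  (forall r, P r -> exists2 z : int,
    z%:~R = 2 * common_den%:R * pay r & (`|z| <= 4 * size_bound)%N) ->
  (forall r, P r ->
    0 < (-1) ^+ sg * (y (k r) - (y (a r) + y (b r)) / 2 - pay r) ?<= if ~~ strict) ->
  exists (z : 'I_n -> rat) t, [/\ forall k, 0 <= z k <= kap%:R,
    1 <= t <= kap%:R &
    forall r, P r -> strict%:R <=
      2 * common_den%:R * ((-1) ^+ sg * (z (k r) - (z (a r) + z (b r)) / 2 - pay r * t))].
Proof.
move=> payZ Hy.
(* Indices outside [P] get zero coefficients and, after the sign change, the constant 1: their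
   inequality reads [0 < 1] before and [1 <= t] after homogenization. *)
have Cex r : exists z : int, if P r then
    z%:~R = 2 * common_den%:R * pay r /\ (`|z| <= 4 * size_bound)%N
    else z = (-1) ^+ ~~ sg.
  case: (boolP (P r)) => [/payZ[z E b']|_]; first by exists z.
  by exists ((-1) ^+ ~~ sg).
have [C HC] := @fin_all_exists _ (fun=> int) _ Cex.
pose A r (c : 'I_n) : int := if P r then (-1) ^+ sg * common_den%:Z *
  (2 * (c == k r)%:Z - (c == a r)%:Z - (c == b r)%:Z) else 0.
have AE r (z : 'I_n -> rat) : P r -> \sum_c (A r c)%:~R * z c =
    (-1) ^+ sg * common_den%:R * (2 * z (k r) - z (a r) - z (b r)).
  move=> Pr; rewrite -(sum_delta (k r)) -(sum_delta (a r)) -(sum_delta (b r)).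
  rewrite mulr_sumr -!sumrB mulr_sumr; apply: eq_bigr => c _; rewrite /A Pr.
  by rewrite !(rmorphM, rmorphB, rmorphXn) /= !rmorphN1 -!natz !pmulrn; ring.
have D0 : 0 < common_den%:R :> rat by rewrite ltr0n common_den_gt0.
have S1 := size_bound_gt0; have DS := common_den_le.
case: (@bounded_solution T n A (fun r => (-1) ^+ (~~ sg) * C r) (4 * size_bound) strict y).
- by rewrite muln_gt0.
- move=> r c; rewrite /A; case: (P r); last by rewrite normr0.
  rewrite !normrM normrX normrN1 expr1n mul1r.
  by case: (c == k r); case: (c == a r); case: (c == b r); rewrite /=; lia.
- move=> r; rewrite normrM normrX normrN1 expr1n mul1r; have := HC r.
  case: (P r) => [[_]|->]; first by lia.
  by rewrite normrX normrN1 expr1n; lia.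
- move=> r; rewrite /A; case Pr: (P r); last by rewrite big1.
  apply/eqP; rewrite -(intr_eq0 rat) rmorph_sum; apply/eqP.
  transitivity (\sum_c (A r c)%:~R * (1 : rat)).
    by apply: eq_bigr => c _; rewrite mulr1 /A Pr.
  by rewrite (AE r (fun=> 1)) //; ring.
- move=> r; have := HC r; case: (boolP (P r)) => [Pr [CE _]|Pr CE].
    rewrite AE // rmorphM /= CE rmorphXn rmorphN1.
    have := Hy r Pr; set u := _ * (_ - _ - _) => Hu.
    have -> : (-1) ^+ sg * common_den%:R * (2 * y (k r) - y (a r) - y (b r)) +
      (-1) ^+ (~~ sg) * (2 * common_den%:R * pay r) = 2 * common_den%:R * u.
      by rewrite /u; case: (sg); rewrite /= ?expr0 ?expr1; field.
    have D20 : 0 < 2 * common_den%:R :> rat by lra.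
    by case: strict Hu {Hy} => /= Hu; [apply: mulr_gt0|apply: mulr_ge0 => //; apply: ltW].
  rewrite big1 ?add0r => [|c _]; last by rewrite /A (negbTE Pr) mul0r.
  by rewrite CE -signr_addb addbb expr0; case: strict {Hy}.
move=> z [t [zb tb Hz]].
have le_kap : ((n.+1 * (4 * size_bound)) ^ n.+1 <= kap)%N.
  by rewrite /kap leq_exp2r //; nia.
exists z, t; split.
- move=> c; have /andP[-> zc] := zb c; apply: le_trans zc _; by rewrite ler_nat.
- have /andP[-> tc] := tb; apply: le_trans tc _; by rewrite ler_nat.
move=> r Pr; apply: le_trans (Hz r) _; rewrite AE //.
have := HC r; rewrite Pr => -[CE _]; rewrite rmorphM /= CE rmorphXn rmorphN1.
by rewrite le_eqVlt; apply/orP; left; apply/eqP; case: (sg); rewrite /= ?expr0 ?expr1; field.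
Qed.


Hypothesis inst : tmsdfp_instance Q.

Lemma kap_bounds : [/\ 8 <= kap%:R :> rat, n.+1%:R <= kap%:R :> rat,
  8 * size_bound%:R <= kap%:R :> rat & 1 <= size_bound%:R :> rat].
Proof.
have := kap_ge; have := size_bound_gt0 => S1 kg; split.
- by rewrite (ler_nat _ 8); nia.
- by rewrite ler_nat; nia.
- by rewrite -natrM ler_nat; nia.
- by rewrite ler1n.
Qed.

(** Clearing denominators leaves a slack of at least 1, hence at least [2 / kap ^ 2] before
    clearing; dividing by [t <= kap] gives the third power. The gap is twice the bonus added
    later. *)
Lemma losing_policy_gap sigma : losing (policy_game Q sigma) ->
  exists y, (forall k, 0 <= y k <= kap%:R) /\ forall k, exists i j, is_neg (Q k i j) /\
    payoff Q k i j (sigma i) (sigma j) + (y (sigma i) + y (sigma j)) / 2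
      + 2 * kap%:R^-1 ^+ 3 <= y k.
Proof.
move=> /policy_losingP[y Hy].
have Hy' k : exists p : 'I_m * 'I_m, is_neg (Q k p.1 p.2) /\
  payoff Q k p.1 p.2 (sigma p.1) (sigma p.2) + (y (sigma p.1) + y (sigma p.2)) / 2 < y k.
  by have [i [j H]] := Hy k; exists (i, j).
have [p Hp] := fin_all_exists Hy'.
case: (@bounded_potential 'I_n predT id (fun k => sigma (p k).1) (fun k => sigma (p k).2)
  (fun k => payoff Q k (p k).1 (p k).2 (sigma (p k).1) (sigma (p k).2)) true false y).
- by move=> k _; apply: den_payoff.
- by move=> k _; rewrite /= expr0 mul1r; have [_] := Hp k; lra.
move=> z [t [zb /andP[t1 tk] Hz]].
have t0 : 0 < t by lra.
have [kap8 _ kapS S1] := kap_bounds.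
have K0 : 0 < kap%:R :> rat by lra.
exists (fun k => z k / t); split=> k.
  have /andP[z0 zk] := zb k; rewrite divr_ge0 ?(ltW t0) //= ler_pdivrMr //.
  by apply: le_trans zk _; rewrite ler_peMr // ltW.
exists (p k).1, (p k).2; split; first by case: (Hp k).
have := Hz k isT; rewrite /= expr0 mul1r.
set pay := payoff _ _ _ _ _ _; set z1 := z (sigma _); set z2 := z (sigma _).
have DS : common_den%:R <= size_bound%:R :> rat by rewrite ler_nat common_den_le.
set v := z k - _ - _ => Hv.
have v0 : 0 < v.
  have D0 : 0 < 2 * common_den%:R :> rat by rewrite mulr_gt0 ?ltr0n ?common_den_gt0.
  by rewrite -(pmulr_rgt0 _ D0); apply: lt_le_trans Hv.
have kv : 2 / kap%:R ^+ 2 <= v.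
  rewrite ler_pdivrMr ?exprn_gt0 //.
  have h1 : 2 * common_den%:R * v <= 2 * size_bound%:R * v by rewrite ler_pM2r //; lra.
  have h2 : 2 * size_bound%:R * v * 4 <= v * kap%:R by nra.
  have h3 : v * kap%:R * 8 <= v * kap%:R ^+ 2.
    by rewrite expr2 mulrA ler_pM2l ?mulr_gt0.
  lra.
rewrite -subr_ge0.
have -> : z k / t - (pay + (z1 / t + z2 / t) / 2 + 2 * kap%:R^-1 ^+ 3) =
   v / t - 2 * kap%:R^-1 ^+ 3 by rewrite /v; field; rewrite !gt_eqF.
rewrite subr_ge0 ler_pdivlMr //.
apply: le_trans kv; rewrite -exprVn.
have : 0 <= 1 - kap%:R^-1 * t by rewrite subr_ge0 mulrC ler_pdivrMr // mul1r.
move: (_^-1) => u ut; have := mulr_ge0 (sqr_ge0 u) ut; lra.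
Qed.

(** Equality may hold on a winning set, so only the size of the potential is controlled here; the
    bonus supplies a margin later. *)
Lemma winning_policy_bounded sigma : winning (policy_game Q sigma) ->
  exists (S : {set 'I_n}) x, [/\ S != finset.set0, forall k, 0 <= x k <= kap%:R &
    forall k i j, k \in S -> is_neg (Q k i j) ->
      [/\ sigma i \in S, sigma j \in S &
          x k <= payoff Q k i j (sigma i) (sigma j) + (x (sigma i) + x (sigma j)) / 2]].
Proof.
move=> /policy_winningP[S [x [S0 Hx]]].
case: (@bounded_potential ('I_n * ('I_m * 'I_m))%type
  [pred r | (r.1 \in S) && is_neg (Q r.1 r.2.1 r.2.2)] fst
  (fun r => sigma r.2.1) (fun r => sigma r.2.2)
  (fun r => payoff Q r.1 r.2.1 r.2.2 (sigma r.2.1) (sigma r.2.2)) false true x).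
- by move=> r _; apply: den_payoff.
- by move=> [k [i j]] /= /andP[kS ij]; have [_ _] := Hx k i j kS ij; rewrite expr1; lra.
move=> z [t [zb /andP[t1 tk] Hz]].
have t0 : 0 < t by lra.
have [kap8 _ kapS S1] := kap_bounds.
exists S, (fun k => z k / t); split=> // [k|k i j kS ij].
  have /andP[z0 zk] := zb k; rewrite divr_ge0 ?(ltW t0) //= ler_pdivrMr //.
  by apply: le_trans zk _; rewrite ler_peMr //; lra.
have [iS jS _] := Hx k i j kS ij; split=> //.
have := Hz (k, (i, j)); rewrite /= kS ij expr1 => /(_ isT).
set pay := payoff _ _ _ _ _ _; set z1 := z (sigma _); set z2 := z (sigma _).
rewrite pmulr_rge0 ?mulr_gt0 ?ltr0n ?common_den_gt0 // mulN1r oppr_ge0 => H.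
rewrite -(ler_pM2r t0).
have -> : (pay + (z1 / t + z2 / t) / 2) * t = pay * t + (z1 + z2) / 2.
  by field; rewrite gt_eqF.
rewrite divfK ?gt_eqF //; lra.
Qed.

(** Here [t] is not divided out, because the linear programs have a coordinate for it; the margin
    therefore stays of order [1 / kap]. *)
Lemma losing_bounded : losing (metzler_game Q) -> exists (tau : 'I_n -> 'I_m * 'I_m)
    (z : 'I_n -> rat) t,
  [/\ forall k, is_neg (Q k (tau k).1 (tau k).2),
      forall k, 0 <= z k <= kap%:R, 1 <= t <= kap%:R &
      forall k l l', is_pos (Q l (tau k).1 (tau k).1) -> is_pos (Q l' (tau k).2 (tau k).2) ->
        2 * kap%:R^-1 <= z k - (z l + z l') / 2 - payoff Q k (tau k).1 (tau k).2 l l' * t].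
Proof.
move=> /metzler_losingP[y Hy].
have Hy' k : exists p : 'I_m * 'I_m, is_neg (Q k p.1 p.2) /\
  forall l l', is_pos (Q l p.1 p.1) -> is_pos (Q l' p.2 p.2) ->
  payoff Q k p.1 p.2 l l' + (y l + y l') / 2 < y k.
  by have [i [j H]] := Hy k; exists (i, j).
have [p Hp] := fin_all_exists Hy'.
case: (@bounded_potential ('I_n * ('I_n * 'I_n))%type
  [pred r | is_pos (Q r.2.1 (p r.1).1 (p r.1).1) && is_pos (Q r.2.2 (p r.1).2 (p r.1).2)]
  fst (fun r => r.2.1) (fun r => r.2.2)
  (fun r => payoff Q r.1 (p r.1).1 (p r.1).2 r.2.1 r.2.2) true false y).
- by move=> r _; apply: den_payoff.
- move=> [k [l l']] /= /andP[li lj]; have [_ /(_ l l' li lj)] := Hp k.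
  by rewrite expr0; lra.
move=> z [t [zb tb Hz]]; exists p, z, t; split=> //.
  by move=> k; case: (Hp k).
move=> k l l' li lj; have := Hz (k, (l, l')); rewrite /= li lj expr0 mul1r => /(_ isT).
set v := z k - _ - _ => Hv.
have [kap8 _ kapS S1] := kap_bounds.
have K0 : 0 < kap%:R :> rat by lra.
have DS : common_den%:R <= size_bound%:R :> rat by rewrite ler_nat common_den_le.
have v0 : 0 < v.
  have D0 : 0 < 2 * common_den%:R :> rat by rewrite mulr_gt0 ?ltr0n ?common_den_gt0.
  by rewrite -(pmulr_rgt0 _ D0); apply: lt_le_trans Hv.
rewrite ler_pdivrMr //.
have h1 : 2 * common_den%:R * v <= 2 * size_bound%:R * v by rewrite ler_pM2r //; lra.
have h2 : 2 * size_bound%:R * v * 4 <= v * kap%:R by nra.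
lra.
Qed.

End Bounds.

(** * The perceptron with rescaling *)

Section Perceptron.
Variables (N d : nat) (M : nat -> nat -> rat) (K : rat).
Implicit Types (e y : nat -> nat) (w x z u v : nat -> rat).

Definition dot x z : rat := \sum_(c < d) x c * z c.

(* The form of the positive definite matrix
   [1 + \sum_r (4 ^ e r - 1) (M r)^T (M r)]. *)
Definition form e x z : rat :=
  dot x z + \sum_(r < N) (4 ^+ e r - 1) * (dot (M r) x * dot (M r) z).

Definition mulB (B : nat -> nat -> rat) x : nat -> rat := fun c => dot (B c) x.

Definition scaled e : nat -> nat -> rat := fun r c => 2 ^+ e r * M r c.

Lemma dotC x z : dot x z = dot z x.
Proof. by apply: eq_bigr => c _; rewrite mulrC. Qed.

Lemma eq_dot x x' z z' :
  (forall c, (c < d)%N -> x c = x' c) -> (forall c, (c < d)%N -> z c = z' c) ->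
  dot x z = dot x' z'.
Proof. by move=> xx zz; apply: eq_bigr => c _; rewrite xx ?zz. Qed.

Lemma dotDr x z u a : dot x (fun c => z c + a * u c) = dot x z + a * dot x u.
Proof.
rewrite /dot mulr_sumr -big_split /=; apply: eq_bigr => c _; ring.
Qed.

Lemma dotZl x z a : dot (fun c => a * x c) z = a * dot x z.
Proof. rewrite /dot mulr_sumr; apply: eq_bigr => c _; ring. Qed.

Lemma dotZr x z a : dot x (fun c => a * z c) = a * dot x z.
Proof. by rewrite dotC dotZl dotC. Qed.

Lemma dot_ge0 x : 0 <= dot x x.
Proof. by apply: sumr_ge0 => c _; rewrite -expr2 sqr_ge0. Qed.

Lemma formC e x z : form e x z = form e z x.
Proof.
rewrite /form dotC; congr (_ + _).
by apply: eq_bigr => r _; rewrite [dot _ x * _]mulrC.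
Qed.

Lemma eq_form e x x' z z' :
  (forall c, (c < d)%N -> x c = x' c) -> (forall c, (c < d)%N -> z c = z' c) ->
  form e x z = form e x' z'.
Proof.
move=> xx zz; rewrite /form; congr (_ + _); first exact: eq_dot.
by apply: eq_bigr => r _; rewrite !(@eq_dot (M r) (M r) _ _ _ xx) // (@eq_dot (M r) (M r) z z').
Qed.

Lemma formDr e x z u a :
  form e x (fun c => z c + a * u c) = form e x z + a * form e x u.
Proof.
rewrite /form dotDr mulrDr [X in _ = _ + (_ + X)]mulr_sumr addrACA -big_split /=.
congr (_ + _).
by apply: eq_bigr => r _; rewrite dotDr; ring.
Qed.

Lemma formDl e x z u a :
  form e (fun c => z c + a * u c) x = form e z x + a * form e u x.
Proof. by rewrite formC formDr !(formC _ x). Qed.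

Lemma pow4_ge1 k : 0 <= 4 ^+ k - 1 :> rat.
Proof. by rewrite subr_ge0 exprn_ege1. Qed.

Lemma form_ge0 e x : 0 <= form e x x.
Proof.
rewrite addr_ge0 ?dot_ge0 //; apply: sumr_ge0 => r _.
by rewrite mulr_ge0 ?pow4_ge1 // -expr2 sqr_ge0.
Qed.

(** The form is nonnegative at [C x - h z]. Stating the inequality with bounds on the squared norms
    avoids roots. *)
Lemma form_cauchy_schwarz e x z (T C : rat) :
  form e x x <= T -> form e z z <= C -> 0 < C -> form e x z ^+ 2 <= C * T.
Proof.
move=> xT zC C0; set h := form e x z.
have := form_ge0 e (fun c => (fun c => C * x c) c + - h * z c).
have E a : form e (fun c => C * x c) a = C * form e x a.
  rewrite -[RHS]add0r (_ : 0 = form e (fun=> 0) a); last first.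
    rewrite /form /dot big1 ?add0r; last by move=> c _; rewrite mul0r.
    by rewrite big1 // => r _; rewrite big1 ?mul0r ?mulr0 // => c _; rewrite mulr0.
  by rewrite -formDl; apply: eq_form => // c _; rewrite add0r.
have E' a : form e a (fun c => C * x c) = C * form e a x by rewrite formC E formC.
rewrite formDl !formDr !E' !E (formC e z x) -/h.
move=> H; rewrite -(ler_pM2l C0) -subr_ge0.
have : 0 <= C ^+ 2 * (T - form e x x) + h ^+ 2 * (C - form e z z).
  by rewrite addr_ge0 // mulr_ge0 ?sqr_ge0 // subr_ge0.
move: H; lra.
Qed.

Lemma dot_cauchy_schwarz x z : dot x x <= 1 -> dot x z ^+ 2 <= dot z z.
Proof.
move=> x1.
have E a b : form (fun=> 0%N) a b = dot a b.
  rewrite /form big1 ?addr0 // => r _; rewrite expr0; ring.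
have := @form_cauchy_schwarz (fun=> 0%N) z x (dot z z) 1.
by rewrite !E mul1r dotC => ->.
Qed.

(** The form contains [4 ^+ e r - 1] times the square of the product with row [r]; the missing 1
    comes from [dot u u], as the row has norm at most one. *)
Lemma form_row e u r : (r < N)%N -> dot (M r) (M r) <= 1 ->
  dot (scaled e r) u ^+ 2 <= form e u u.
Proof.
move=> rN M1; rewrite /form (bigD1 (Ordinal rN)) //=.
have : 0 <= \sum_(i < N | i != Ordinal rN)
    (4 ^+ e i - 1) * (dot (M i) u * dot (M i) u).
  apply: sumr_ge0 => i _; by rewrite mulr_ge0 ?pow4_ge1 // -expr2 sqr_ge0.
have := dot_cauchy_schwarz u M1; rewrite dotZl exprMn -exprM mulnC exprM.
rewrite (_ : 2 ^+ 2 = 4) // ; lra.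
Qed.

Definition incr y (k : nat) : nat -> nat := fun r => if r == k then (y r).+1 else y r.

Lemma sum_pick (f : nat -> rat) k : (k < N)%N ->
  \sum_(r < N) (if (r : nat) == k then f r else 0) = f k.
Proof.
move=> kN; rewrite (bigD1 (Ordinal kN)) //= eqxx big1 ?addr0 // => r rk.
case: eqP => // E; case/eqP: rk; exact: val_inj.
Qed.

(** Since [4 ^ (e + 1) - 4 ^ e = 3 * 4 ^ e], doubling row [k] is a rank one change of the matrix
    with coefficient 3. *)
Lemma form_incr e k x z : (k < N)%N ->
  form (incr e k) x z =
    form e x z + 3 * (dot (scaled e k) x * dot (scaled e k) z).
Proof.
move=> kN; rewrite /form -addrA; congr (_ + _).
rewrite -(@sum_pick (fun k => 3 * (dot (scaled e k) x * dot (scaled e k) z))) //.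
rewrite -big_split /=; apply: eq_bigr => r _; rewrite /incr.
case: eqP => [->|_]; last by rewrite addr0.
rewrite !dotZl exprS (_ : 4 = 2 * 2 :> rat) // [(2 * 2) ^+ _]exprMn; ring.
Qed.

Definition witness x := dot x x <= 1 /\ forall r, (r < N)%N -> K^-1 <= dot (M r) x.

(** Let [v] be a scaled row whose counter reaches [tau], and [x] a witness. Then
    [tau (v . x) <= form e w x], whose square is at most [(N + 1) (N tau)], so
    [(v . x)^2 <= N (N + 1) / tau = 1 / 4]. *)
Definition tau : nat := (4 * N * N.+1)%N.

(** [B] and [w] are described through the form: [inv_B] says that [B] inverts its matrix, [inv_w]
    that [w] is [B] applied to the sum of the scaled rows with multiplicities [y]. [inv_norm] bounds
    the squared norm by the number of steps since the last rescaling, and [inv_e] keeps doubled rows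
    at most 1 on all witnesses. *)
Record solver_inv (B : nat -> nat -> rat) w y e : Prop := {
  inv_B : forall x z, form e (mulB B x) z = dot x z;
  inv_w : forall z, form e w z = \sum_(r < N) (y r)%:R * dot (scaled e r) z;
  inv_norm : form e w w <= (\sum_(r < N) y r)%N%:R;
  inv_y : forall r, (r < N)%N -> (y r < tau)%N;
  inv_e : forall x, witness x -> forall r, (r < N)%N -> dot (scaled e r) x <= 1
}.

Hypothesis K0 : 0 < K.
Hypothesis rows_le1 : forall r, (r < N)%N -> dot (M r) (M r) <= 1.

Lemma tau_gt0 : (0 < N)%N -> (0 < tau)%N.
Proof. by move=> N0; rewrite /tau !muln_gt0 N0. Qed.

Lemma form0 e z : form e (fun=> 0) z = 0.
Proof.
rewrite /form /dot big1 ?add0r; last by move=> c _; rewrite mul0r.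
by rewrite big1 // => r _; rewrite big1 ?mul0r ?mulr0 // => c _; rewrite mulr0.
Qed.

Lemma eq_solver_inv B w y e B' w' y' :
  (forall c c', (c < d)%N -> (c' < d)%N -> B' c c' = B c c') ->
  (forall c, (c < d)%N -> w' c = w c) -> (forall r, (r < N)%N -> y' r = y r) ->
  solver_inv B w y e -> solver_inv B' w' y' e.
Proof.
move=> EB Ew Ey [IB Iw In Iy Ie]; split=> //.
- move=> x z; rewrite -IB; apply: eq_form => // c cd; apply: eq_dot => // c' c'd.
  exact: EB.
- move=> z; rewrite (eq_form _ Ew (fun _ _ => erefl)) Iw.
  by apply: eq_bigr => r _; rewrite Ey.
- rewrite (eq_form _ Ew Ew) (eq_bigr (fun r : 'I_N => y r)) // => r _; exact: Ey.
- by move=> r rN; rewrite Ey ?Iy.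
Qed.

Lemma solver_init : solver_inv (fun c c' => (c == c')%:R) (fun=> 0) (fun=> 0%N) (fun=> 0%N).
Proof.
split=> [x z|z||r rN|x [x1 _] r rN].
- rewrite /form [X in _ + X]big1 ?addr0; last by move=> r _; rewrite subrr mul0r.
  apply: eq_bigr => c _; congr (_ * _); rewrite /mulB /dot (bigD1 c) //= eqxx mul1r.
  by rewrite big1 ?addr0 // => c' c'c; rewrite eq_sym (inj_eq val_inj) (negbTE c'c) mul0r.
- by rewrite form0 big1 // => r _; rewrite mul0r.
- by rewrite form0 ler0n.
- by apply: tau_gt0; apply: leq_ltn_trans rN.
rewrite dotZl expr0 mul1r.
have := dot_cauchy_schwarz x (rows_le1 rN) => H.
have {}H : dot (M r) x ^+ 2 <= 1 by apply: le_trans x1.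
by rewrite leNgt; apply/negP => H1; nra.
Qed.

Lemma solver_step B w y e k :
  solver_inv B w y e -> (k < N)%N -> dot (scaled e k) w <= 0 ->
  let w' := fun c => w c + dot (B c) (scaled e k) in
  let y' := incr y k in
  [/\ forall z, form e w' z = \sum_(r < N) (y' r)%:R * dot (scaled e r) z,
      form e w' w' <= (\sum_(r < N) y' r)%N%:R &
      (y' k < tau)%N -> solver_inv B w' y' e].
Proof.
move=> [IB Iw In Iy Ie] kN kw w' y'; set v := scaled e k; set u := mulB B v.
have w'E c : (c < d)%N -> w' c = w c + 1 * u c by rewrite mul1r.
have uE z : form e u z = dot v z by exact: IB.
have i1 z : form e w' z = \sum_(r < N) (y' r)%:R * dot (scaled e r) z.
  rewrite (eq_form _ w'E (fun _ _ => erefl)) formDl Iw uE mul1r.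
  rewrite -(@sum_pick (fun r => dot (scaled e r) z) k) // -big_split /=.
  apply: eq_bigr => r _; rewrite /y' /incr; case: eqP => [->|_]; last by rewrite addr0.
  by rewrite -[in RHS]addn1 natrD mulrDl mul1r.
have sumy : (\sum_(r < N) y' r = (\sum_(r < N) y r).+1)%N.
  rewrite (bigD1 (Ordinal kN)) //= [in RHS](bigD1 (Ordinal kN)) //= /y' /incr eqxx addSn.
  congr (_ + _).+1; apply: eq_bigr => r rk; case: eqP => // E.
  by case/eqP: rk; exact: val_inj.
have i2 : form e w' w' <= (\sum_(r < N) y' r)%N%:R.
  rewrite (eq_form _ w'E w'E) formDl !formDr !mul1r uE (formC e w u) uE.
  have := form_row e u kN (rows_le1 kN); rewrite -/v uE.
  rewrite sumy -[in X in _ -> X]addn1 natrD; move: In kw; rewrite -/v.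
  by move=> H1 H2 H3; nra.
split=> // y'k; split=> // r rN; rewrite /y' /incr; case: eqP => [rk|_]; last exact: Iy.
by move: y'k; rewrite /y' /incr eqxx rk.
Qed.

(** The new [B] is the Sherman-Morrison inverse after adding [3 v v^T]. The essential point is
    [inv_e] at [k]: row [k] must be at most 1/2 on witnesses before it is doubled. The counter
    bounds [form e w' x] from below and Cauchy-Schwarz bounds it from above. *)
Lemma solver_rescale B w y e k :
  solver_inv B w y e -> (k < N)%N -> dot (scaled e k) w <= 0 ->
  (tau <= incr y k k)%N ->
  let u := fun c => dot (B c) (scaled e k) in
  solver_inv
    (fun c c' => B c c' - 3 * u c * u c' / (1 + 3 * dot u (scaled e k)))
    (fun=> 0) (fun=> 0%N) (incr e k).
Proof.
move=> I kN kw tk u; have [i1 i2 _] := solver_step I kN kw.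
case: I => IB Iw In Iy Ie; set y' := incr y k in tk i1 i2.
set w' := fun c => _ in i1 i2.
set v := scaled e k in u *; set beta := dot u v.
have N0 : (0 < N)%N by apply: leq_ltn_trans kN.
have beta0 : 0 <= beta by rewrite /beta dotC -[dot v u]IB form_ge0.
have beta1 : 1 + 3 * beta != 0 by rewrite gt_eqF //; lra.
split=> [x z|z||r rN|x xw r rN].
- have E c : (c < d)%N -> mulB (fun c c' => B c c' - 3 * u c * u c' / (1 + 3 * beta)) x c
      = mulB B x c + (- (3 * dot u x / (1 + 3 * beta))) * u c.
    move=> _; rewrite /mulB dotC.
    rewrite (@eq_dot x x _ (fun c' => B c c' + (- (3 * u c / (1 + 3 * beta))) * u c')) //.
      by rewrite dotDr dotC (dotC x u); ring.
    by move=> c' _; ring.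
  rewrite (eq_form _ E (fun _ _ => erefl)) form_incr // !formDl dotDr -/v.
  rewrite (dotC v u) -/beta.
  have -> : form e u z = dot v z by exact: IB.
  have -> : dot v (mulB B x) = dot u x.
    by rewrite -[LHS]IB formC IB dotC.
  rewrite IB -/v; field.
  exact: beta1.
- by rewrite form0 big1 // => r _; rewrite mul0r.
- by rewrite form0 ler0n.
- exact: tau_gt0.
have H r' : (r' < N)%N -> 0 <= dot (scaled e r') x.
  move=> r'N; rewrite dotZl mulr_ge0 ?exprn_ge0 //.
  by apply: le_trans (xw.2 r' r'N); rewrite invr_ge0 ltW.
have y'tau r' : (r' < N)%N -> (y' r' <= tau)%N.
  by move=> r'N; rewrite /y' /incr; case: eqP => [->|_]; [|apply: ltnW]; apply: Iy.
(* On a witness every scaled product lies in [[0, 1]], so each of the [N] rows adds at most 1 to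
   [dot x x <= 1]. *)
have formx : form e x x <= N.+1%:R.
  apply: (@le_trans _ _ (1 + \sum_(r < N) 1)); last first.
    by rewrite sumr_const card_ord -natr1 addrC.
  rewrite lerD ?xw.1 //; apply: ler_sum => r' _.
  have := Ie x xw r' (ltn_ord r'); have := H r' (ltn_ord r').
  rewrite dotZl; set p := 2 ^+ _; set m := dot _ x.
  have -> : 4 ^+ e r' = p ^+ 2 :> rat by rewrite -exprM mulnC exprM.
  by move=> H1 H2; nra.
have ysum : (\sum_(r < N) y' r)%N%:R <= N%:R * tau%:R :> rat.
  rewrite -natrM ler_nat -[X in (_ <= X * _)%N](card_ord N) -sum_nat_const.
  by apply: leq_sum => r' _; apply: y'tau.
have CS := @form_cauchy_schwarz e w' x _ N.+1%:R (le_trans i2 ysum) formx (ltr0Sn _ _).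
have tau0 : 0 < tau%:R :> rat by rewrite ltr0n tau_gt0.
have sk : tau%:R * dot v x <= form e w' x.
  rewrite i1 (bigD1 (Ordinal kN)) //=.
  apply: (@le_trans _ _ ((y' k)%:R * dot v x)).
    by rewrite ler_wpM2r ?H // ler_nat.
  rewrite lerDl; apply: sumr_ge0 => r' _; by rewrite mulr_ge0 ?H.
have half : 2 * dot v x <= 1.
  rewrite leNgt; apply/negP => big.
  have : (tau%:R * dot v x) ^+ 2 <= form e w' x ^+ 2.
    rewrite ler_sqr ?nnegrE //; first by rewrite mulr_ge0 ?H // ltW.
    by apply: le_trans sk; rewrite mulr_ge0 ?H // ltW.
  move=> /le_trans/(_ CS).
  have tE : tau%:R = 4 * (N%:R * N.+1%:R) :> rat by rewrite /tau !natrM mulrA.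
  rewrite mulrA [N.+1%:R * N%:R]mulrC.
  have -> : N%:R * N.+1%:R = tau%:R / 4 :> rat by rewrite tE; field.
  move: big tau0; move: (tau%:R : rat) (dot v x) => t s big t0.
  apply/negP; rewrite -ltNge.
  have -> : (t * s) ^+ 2 = t * t * s ^+ 2 by ring.
  have -> : t / 4 * t = t * t * (1 / 4) by field.
  rewrite ltr_pM2l ?mulr_gt0 //; nra.
have [rk|rk] := eqVneq r k; last first.
  by rewrite /scaled /incr (negbTE rk); apply: Ie.
rewrite rk dotZl /incr eqxx exprS -mulrA -dotZl; exact: half.
Qed.

Lemma solver_no B w y e k :
  solver_inv B w y e -> (k < N)%N -> K < 2 ^+ e k -> forall x, ~ witness x.
Proof.
move=> [_ _ _ _ Ie] kN Kk x xw; have := Ie x xw k kN; rewrite dotZl.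
have := xw.2 k kN; move: (dot _ _) => s Ks; apply/negP; rewrite -ltNge.
have s0 : 0 < s by apply: lt_le_trans Ks; rewrite invr_gt0.
apply: (@le_lt_trans _ _ (K * s)).
  by rewrite -(ler_pM2l K0) divff ?gt_eqF // in Ks.
by rewrite ltr_pM2r.
Qed.

End Perceptron.

(** * Rows of the linear programs and the perturbation *)

Section Rows.
Variables (n : nat).

(* The denominator only serves to make the norm of the row at most one. *)
Definition row_vec (sgn al del cc : rat) (k a b k0 c : nat) : rat :=
  sgn / (16 + cc * cc) *
  (al * ((c == a)%:R + (c == b)%:R) + del * (c == k0)%:R - (c == k)%:R
   + cc * (c == n)%:R).

Definition row_value (al del cc : rat) (k a b k0 : nat) (x : nat -> rat) : rat :=
  al * (x a + x b) + del * x k0 - x k + cc * x n.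

Lemma sum_delta_nat (d k : nat) (x : nat -> rat) : (k < d)%N ->
  \sum_(c < d) (nat_of_ord c == k)%:R * x c = x k.
Proof.
move=> kd; rewrite (bigD1 (Ordinal kd)) //= eqxx mul1r big1 ?addr0 // => c ck.
by case: eqP => [E|_]; [case/eqP: ck; apply: val_inj|rewrite mul0r].
Qed.

Lemma dot_row_vec sgn al del cc k a b k0 (x : nat -> rat) :
  (k < n)%N -> (a < n)%N -> (b < n)%N -> (k0 < n)%N ->
  dot n.+1 (row_vec sgn al del cc k a b k0) x =
  sgn / (16 + cc * cc) * row_value al del cc k a b k0 x.
Proof.
move=> kn an bn k0n; have S i : (i <= n)%N -> x i = \sum_(c < n.+1) (nat_of_ord c == i)%:R * x c.
  by move=> i_n; rewrite sum_delta_nat.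
rewrite /row_value (S k (ltnW kn)) (S a (ltnW an)) (S b (ltnW bn)) (S k0 (ltnW k0n)).
rewrite (S n (leqnn n)) -big_split /= !mulr_sumr -big_split /= -sumrB -big_split /= mulr_sumr.
apply: eq_bigr => c _; rewrite /row_vec; ring.
Qed.

Lemma row_vec_norm sgn al del cc k a b k0 :
  (k < n)%N -> (a < n)%N -> (b < n)%N -> (k0 < n)%N ->
  sgn ^+ 2 = 1 -> 0 <= al <= 1 -> 0 <= del <= 1 ->
  dot n.+1 (row_vec sgn al del cc k a b k0) (row_vec sgn al del cc k a b k0) <= 1.
Proof.
move=> kn an bn k0n sgn1 al1 del1.
(* The indices may coincide, so an entry is treated as a sum of five terms, whose square is at most
   5 times the sum of the squares. The total [20 + 5 cc^2] is at most [(16 + cc^2)^2]. *)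
pose f (c : nat) : rat := ((c == a)%:R + (c == b)%:R + (c == k0)%:R + (c == k)%:R) * 5
  + 5 * (cc * cc) * (c == n)%:R.
have q0 : 0 < 16 + cc * cc by rewrite ltr_wpDr // -expr2 sqr_ge0.
have bound c : row_vec sgn al del cc k a b k0 c * row_vec sgn al del cc k a b k0 c <=
    (16 + cc * cc)^-1 ^+ 2 * f c.
  rewrite /row_vec /f.
  have -> t : sgn / (16 + cc * cc) * t * (sgn / (16 + cc * cc) * t) =
      (16 + cc * cc)^-1 ^+ 2 * (t * t) by rewrite -(mul1r (_ * (t * t))) -sgn1; ring.
  rewrite ler_pM2l ?exprn_gt0 ?invr_gt0 //.
  have sq (t u v w z : rat) : (t + u + v - w + z) * (t + u + v - w + z) <=
      5 * (t * t + u * u + v * v + w * w + z * z).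
    rewrite -subr_ge0.
    have -> : 5 * (t * t + u * u + v * v + w * w + z * z) - (t + u + v - w + z) * (t + u + v - w + z)
      = (t - u) ^+ 2 + (t - v) ^+ 2 + (t + w) ^+ 2 + (t - z) ^+ 2 + (u - v) ^+ 2
        + (u + w) ^+ 2 + (u - z) ^+ 2 + (v + w) ^+ 2 + (v - z) ^+ 2 + (w + z) ^+ 2 by ring.
    by rewrite !addr_ge0 ?sqr_ge0.
  rewrite [al * (_ + _)]mulrDr; apply: le_trans (sq _ _ _ _ _) _.
  have ind (e : rat) (p : bool) : 0 <= e <= 1 -> e * p%:R * (e * p%:R) <= p%:R.
    by move=> /andP[e0 e1]; case: p; rewrite ?mulr1 ?mulr0 // mulr_ile1.
  have h1 := ind _ (c == a) al1; have h2 := ind _ (c == b) al1.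
  have h3 := ind _ (c == k0) del1.
  have h4 (p : bool) : p%:R * p%:R = p%:R :> rat by case: p; rewrite ?mulr1 ?mulr0.
  have -> : cc * (c == n)%:R * (cc * (c == n)%:R) = cc * cc * ((c == n)%:R * (c == n)%:R) by ring.
  rewrite !h4; lra.
apply: (@le_trans _ _ (\sum_(c < n.+1) (16 + cc * cc)^-1 ^+ 2 * f c)).
  by apply: ler_sum => c _; apply: bound.
have S i : (i <= n)%N -> \sum_(c < n.+1) (nat_of_ord c == i)%:R = 1 :> rat.
  move=> i_n; have := @sum_delta_nat n.+1 i (fun=> 1) i_n.
  by under eq_bigr do rewrite mulr1.
have Sf : \sum_(c < n.+1) f c = (1 + 1 + 1 + 1) * 5 + 5 * (cc * cc).
  rewrite big_split /=; congr (_ + _); last by rewrite -mulr_sumr (S n (leqnn n)) mulr1.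
  rewrite -mulr_suml; congr (_ * _); rewrite !big_split /=.
  by rewrite (S a (ltnW an)) (S b (ltnW bn)) (S k0 (ltnW k0n)) (S k (ltnW kn)).
rewrite -mulr_sumr Sf; have : 0 <= cc * cc by rewrite -expr2 sqr_ge0.
move: (cc * cc) q0 => u q0 u0.
have v0 : 0 < (16 + u) ^+ 2 by rewrite exprn_gt0.
have : (1 + 1 + 1 + 1) * 5 + 5 * u <= (16 + u) ^+ 2 by nra.
rewrite exprVn; move: v0; set v := (16 + u) ^+ 2; set w := _ + 5 * u => v0 wv; clearbody v w.
by rewrite mulrC ler_pdivrMr // mul1r.
Qed.

End Rows.

(** The exponents 3 and 5 balance bonus and restart: [d * K] is small against the bonus [e], while
    [d * K ^+ 6] is still as large as [K]. *)
Lemma perturbation_params (K : rat) (e := K^-1 ^+ 3) (d := K^-1 ^+ 5) : 8 <= K ->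
  [/\ 0 < e <= 1, 0 <= d <= 1, d * K * 8 <= e, d * e * 8 <= e & d * K ^+ 6 = K].
Proof.
move=> K8; have K0 : 0 < K by lra.
rewrite /e /d; have : K^-1 * K = 1 by rewrite mulVf // gt_eqF.
have : 0 < K^-1 by rewrite invr_gt0.
move: (K^-1) => u u0 uK.
have u8 : 8 * u <= 1 by nra.
have u1 : u <= 1 by lra.
have u3 : 0 < u ^+ 3 by rewrite exprn_gt0.
split.
- by rewrite u3 exprn_ile1 // ltW.
- by rewrite exprn_ge0 ?exprn_ile1 // ltW.
- have -> : u ^+ 5 * K * 8 = u ^+ 3 * (u * K * (8 * u)) by ring.
  by rewrite uK mul1r ler_piMr // ltW.
- have u5 : u ^+ 5 <= u by rewrite exprS ler_piMr ?exprn_ile1 // ltW.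
  by rewrite mulrAC ler_piMl ?(ltW u3) //; lra.
have -> : u ^+ 5 * K ^+ 6 = (u * K) ^+ 5 * K by ring.
by rewrite uK expr1n mul1r.
Qed.

Section Policies.
Variables (m n : nat) (Q : 'I_n -> 'M[strop rat]_m).
Hypothesis inst : tmsdfp_instance Q.
Let kapR : rat := (kap Q)%:R.

Definition eps_of : rat := kapR^-1 ^+ 3.
Definition del_of : rat := kapR^-1 ^+ 5.

(* The perturbed one-step expectation moves to the state [k0] with probability
   [del_of], which makes all the states share one mean payoff. *)
Lemma max_sound (sigma : 'I_m -> 'I_n) (k0 : 'I_n) (w : 'I_n -> rat) (t : rat) :
  (forall k i j, is_neg (Q k i j) ->
     is_pos (Q (sigma i) i i) && is_pos (Q (sigma j) j j)) ->
  0 < t ->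
  (forall k i j, is_neg (Q k i j) ->
     0 < (1 - del_of) / 2 * (w (sigma i) + w (sigma j)) + del_of * w k0 - w k
         + ((1 - del_of) * payoff Q k i j (sigma i) (sigma j) + eps_of) * t) ->
  winning (metzler_game Q).
Proof.
move=> spos t0 Hw; apply: (@policy_winning _ _ Q sigma) => //.
(* Were the policy game lost, consider a state [k] where [w / t - y] is largest. The gap
   [2 * eps_of] of [y] there exceeds what the bonus [eps_of] and the restart, at most about
   [del_of * kapR], can add. *)
case: (policy_dichotomy inst sigma) => // /losing_policy_gap[y [yb Hy]]; exfalso.
pose x k := w k / t.
case: (@arg_maxP _ _ _ k0 predT (fun k => x k - y k) isT) => k _ kmax.
have {}kmax l : x l <= y l + (x k - y k) by have := kmax l isT; rewrite /=; lra.
have [i [j [ij gap]]] := Hy k.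
have := Hw k i j ij; rewrite -(pmulr_lgt0 _ (_ : 0 < t^-1)) ?invr_gt0 //.
set p := payoff _ _ _ _ _ _ in gap *.
have -> : ((1 - del_of) / 2 * (w (sigma i) + w (sigma j)) + del_of * w k0 - w k
   + ((1 - del_of) * p + eps_of) * t) / t =
   (1 - del_of) * (p + (x (sigma i) + x (sigma j)) / 2) + del_of * x k0 - x k + eps_of.
  by rewrite /x; field; rewrite gt_eqF.
have [kap8 _ _ _] := kap_bounds Q.
have /andP[y0k _] := yb k; have /andP[_ yk] := yb k0.
have h1 := kmax (sigma i); have h2 := kmax (sigma j); have h3 := kmax k0.
move: gap; rewrite -/kapR in kap8 yk *; rewrite -/eps_of.
have [/andP[e0 e1] /andP[d0 d1] dk de _] := perturbation_params kap8.
rewrite -/eps_of -/del_of in e0 e1 d0 d1 dk de.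
move: (x _) (x _) (x k0) (y _) (y _) (y k0) (x k) (y k) yk y0k h1 h2 h3 => a b c f g h xk yk yk0 h1 h2 h3 h4 gap H.
have q1 : (1 - del_of) * (p + (a + b) / 2) <= (1 - del_of) * (yk - 2 * eps_of + (xk - yk)).
  by apply: ler_wpM2l; lra.
have q2 : del_of * c <= del_of * (h + (xk - yk)) by apply: ler_wpM2l.
have q3 : del_of * (h - yk) <= del_of * kapR by apply: ler_wpM2l; lra.
lra.
Qed.

Lemma max_complete : winning (metzler_game Q) ->
  exists (sigma : 'I_m -> 'I_n) (k0 : 'I_n) (x : 'I_n -> rat),
  [/\ forall i, is_pos (Q (sigma i) i i), forall k, `|x k| <= kapR ^+ 6 &
   forall k i j, is_neg (Q k i j) ->
     eps_of / 2 <= (1 - del_of) / 2 * (x (sigma i) + x (sigma j)) + del_of * x k0 - x k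
         + ((1 - del_of) * payoff Q k i j (sigma i) (sigma j) + eps_of)].
Proof.
move=> /(winning_policy inst)[sigma [spos win]].
have [S [x [/finset.set0Pn[k0 k0S] xb Hx]]] := winning_policy_bounded win.
have [kap8 _ kapS S1] := kap_bounds Q; rewrite -/kapR in kap8 kapS xb *.
have K0 : 0 < kapR by lra.
(* A finite substitute for -oo. Outside [S] the restart gains [del_of * kapR ^+ 6 = kapR], which
   outweighs any payoff; inside [S] it costs at most [del_of * kapR], which the bonus covers. *)
pose z k := if k \in S then x k else - kapR ^+ 6.
have zin l : l \in S -> z l = x l by rewrite /z => ->.
have ge l : - kapR ^+ 6 <= z l.
  rewrite /z; case: ifP => // _; have /andP[x0 _] := xb l; apply: le_trans x0.
  by rewrite oppr_le0 exprn_ge0 // ltW.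
exists sigma, k0, z; split=> //.
  move=> k; rewrite /z; case: ifP => _; last by rewrite normrN ger0_norm // exprn_ge0 // ltW.
  have /andP[x0 xk] := xb k; rewrite ger0_norm //; apply: le_trans xk _.
  by rewrite exprS ler_peMr ?(ltW K0) // exprn_ege1 //; lra.
have [/andP[e0 e1] /andP[d0 d1] dk de dk6] := perturbation_params kap8.
rewrite -/eps_of -/del_of in e0 e1 d0 d1 dk de dk6.
move=> k i j ij; rewrite (zin k0 k0S); have /andP[x00 _] := xb k0.
have q2 : 0 <= del_of * x k0 by apply: mulr_ge0.
have [kS|kS] := boolP (k \in S).
  have [iS jS xk] := Hx k i j kS ij; rewrite !zin //.
  have /andP[x0 xkk] := xb k.
  have q1 : (1 - del_of) * x k <= (1 - del_of) *
     (payoff Q k i j (sigma i) (sigma j) + (x (sigma i) + x (sigma j)) / 2).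
    by apply: ler_wpM2l => //; lra.
  have q3 : del_of * x k <= del_of * kapR by apply: ler_wpM2l.
  lra.
have -> : z k = - kapR ^+ 6 by rewrite /z (negbTE kS).
have := payoff_le Q k i j (sigma i) (sigma j); rewrite ler_norml => /andP[p1 _].
move: (ge (sigma i)) (ge (sigma j)) p1 q2 dk6.
move: (z _) (z _) (payoff _ _ _ _ _ _) (x k0) (kapR ^+ 6) => A B p y v Av Bv pZ q2 dk6.
have q1 : (1 - del_of) * (- (2 * (size_bound Q)%:R) - v) <= (1 - del_of) * (p + (A + B) / 2).
  by apply: ler_wpM2l; lra.
have q3 : 0 <= del_of * (2 * (size_bound Q)%:R) by apply: mulr_ge0 => //; lra.
lra.
Qed.

Lemma min_sound (tau : 'I_n -> 'I_m * 'I_m) (w : 'I_n -> rat) (t : rat) :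
  (forall k, is_neg (Q k (tau k).1 (tau k).2)) -> 0 < t ->
  (forall k l l', is_pos (Q l (tau k).1 (tau k).1) -> is_pos (Q l' (tau k).2 (tau k).2) ->
     0 < w k - (w l + w l') / 2 - payoff Q k (tau k).1 (tau k).2 l l' * t) ->
  losing (metzler_game Q).
Proof.
move=> tneg t0 Hw; apply/metzler_losingP; exists (fun k => w k / t) => k.
exists (tau k).1, (tau k).2; split=> // l l' li lj.
have := Hw k l l' li lj; set p := payoff _ _ _ _ _ _ => H.
rewrite -(ltr_pM2r t0) divfK ?gt_eqF //.
have -> : (p + (w l / t + w l' / t) / 2) * t = p * t + (w l + w l') / 2.
  by field; rewrite gt_eqF.
lra.
Qed.

End Policies.

Lemma denominator_gt0 (cc : rat) : 0 < 16 + cc * cc.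
Proof. by rewrite ltr_wpDr // -expr2 sqr_ge0. Qed.

(* The potentials are scaled by [K ^ 7] to fit into the unit ball. *)
Lemma scaled_witness (n N : nat) (row : nat -> nat -> rat) (K : rat)
    (x : 'I_n -> rat) (t : rat) :
  8 <= K -> n.+1%:R <= K -> (forall k, `|x k| <= K ^+ 6) -> 1 <= t <= K ^+ 6 ->
  (forall z : nat -> rat, (forall k : 'I_n, z k = x k) -> z n = t ->
    forall r, (r < N)%N -> K^-1 ^+ 6 <= dot n.+1 (row r) z) ->
  exists z, witness N n.+1 row (K ^+ 13) z.
Proof.
move=> K8 Kn xb /andP[t1 tb] Hrow; have K0 : 0 < K by lra.
have [z [zx zn]] : exists z : nat -> rat, (forall k : 'I_n, z k = x k) /\ z n = t.
  exists (fun c => if insub c is Some k then x k else t); split=> [k|].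
    by rewrite valK.
  by rewrite insubF // ltnn.
have u0 : 0 < K^-1 by rewrite invr_gt0.
exists (fun c => K^-1 ^+ 7 * z c); split; last first.
  move=> r rN; rewrite dotZr; have := Hrow z zx zn r rN.
  by rewrite -exprVn (_ : 13 = 7 + 6)%N // exprD ler_pM2l // exprn_gt0.
have zb c : (c < n.+1)%N -> z c * z c <= K ^+ 12.
  move=> cn; have : `|z c| <= K ^+ 6.
    move: cn; rewrite ltnS leq_eqVlt => /orP[/eqP ->|cn].
      by rewrite zn ger0_norm //; lra.
    by rewrite (zx (Ordinal cn)).
  rewrite (_ : 12 = 6 + 6)%N // exprD ler_norml => /andP[].
  by move: (K ^+ 6) (z c) => v y; nra.
rewrite dotZl dotZr mulrA -exprD.
apply: (@le_trans _ _ (K^-1 ^+ 14 * \sum_(c < n.+1) K ^+ 12)).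
  rewrite ler_pM2l ?exprn_gt0 //; apply: ler_sum => c _; exact: zb.
rewrite sumr_const card_ord -mulr_natr.
have -> : K^-1 ^+ 14 * (K ^+ 12 * n.+1%:R) = (K^-1 * K) ^+ 12 * (K^-1 * (K^-1 * n.+1%:R)) by ring.
rewrite mulVf ?gt_eqF // expr1n mul1r.
have : K^-1 * n.+1%:R <= 1 by rewrite mulrC ler_pdivrMr // mul1r.
have : K^-1 <= 1 by rewrite invf_le1; lra.
by move: (K^-1 * _) => v u1 v1; apply: (@le_trans _ _ (K^-1 * 1)); rewrite ?ler_pM2l ?mulr1.
Qed.

(** Normalizing a row divides its margin by at most [K * K], so [K^-1 ^+ 3 / 2] leaves [K^-1 ^+ 6].
    Together with the factor [K^-1 ^+ 7] that moves the point into the unit ball, this is the origin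
    of [K ^+ 13]. *)
Lemma normalized_row_ge (K Z p e d v : rat) :
  8 <= K -> 8 * Z <= K -> 1 <= Z -> `|p| <= 2 * Z -> 0 <= e <= 1 -> 0 <= d <= 1 ->
  K^-1 ^+ 3 / 2 <= v ->
  K^-1 ^+ 6 <= (16 + ((1 - d) * p + e) * ((1 - d) * p + e))^-1 * v.
Proof.
move=> K8 KZ Z1 pZ /andP[e0 e1] /andP[d0 d1] Hv.
set cc := (1 - d) * p + e; have q0 := denominator_gt0 cc.
have qK : 16 + cc * cc <= K * K.
  have c1 : `|cc| <= 3 * Z.
    apply: le_trans (ler_normD _ _) _; rewrite normrM.
    have : `|1 - d| * `|p| <= 1 * (2 * Z).
      by apply: ler_pM => //; rewrite ger0_norm; lra.
    by rewrite (ger0_norm e0); lra.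
  by move: c1; rewrite ler_norml => /andP[]; move: cc {q0} => cc; nra.
have K0 : 0 < K by lra.
have u0 : 0 < K^-1 by rewrite invr_gt0.
have qu : K^-1 * K^-1 <= (16 + cc * cc)^-1 by rewrite -invfM lef_pV2 ?posrE ?mulr_gt0.
apply: (@le_trans _ _ (K^-1 * K^-1 * (K^-1 ^+ 3 / 2))).
  have u8 : K^-1 * 8 <= 1 by rewrite mulrC ler_pdivrMr // mul1r.
  have -> : K^-1 ^+ 6 = K^-1 ^+ 5 * K^-1 by rewrite exprSr.
  have -> : K^-1 * K^-1 * (K^-1 ^+ 3 / 2) = K^-1 ^+ 5 * (1 / 2) by rewrite !exprS; ring.
  by rewrite ler_pM2l ?exprn_gt0 //; lra.
by apply: ler_pM; rewrite ?mulr_ge0 ?exprn_ge0 ?(ltW u0).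
Qed.

Lemma half_inv_cube_le (K : rat) : 8 <= K -> K^-1 ^+ 3 / 2 <= 2 * K^-1.
Proof.
move=> K8; have u0 : 0 <= K^-1 by rewrite invr_ge0; lra.
have u1 : K^-1 <= 1 by rewrite invf_le1; lra.
have : K^-1 ^+ 3 <= K^-1 by rewrite exprS ler_piMr // exprn_ile1.
lra.
Qed.

(** * The linear program of a policy *)

Section LinearPrograms.
Variables (m n : nat) (Q : 'I_n -> 'M[strop rat]_m).

Definition ent (k i j : nat) : strop rat := entry_at Q ((k * m + i) * m + j).

Definition pos_at (l i : nat) : bool := kind (ent l i i) == 1%N.
Definition neg_at (k i j : nat) : bool := kind (ent k i j) == 2%N.

Definition pay_at (k i j l l' : nat) : rat :=
  (modulus (ent l i i) + modulus (ent l' j j)) / 2 - modulus (ent k i j).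

(* In mode [0] a policy maps the row [i] to the matrix [pol i]; in mode [1] it
   maps the matrix [k] to the entry [(pol (2 k), pol (2 k + 1))]. *)
Definition selected (mode : nat) (pol : nat -> nat) (k i j l l' : nat) : bool :=
  if mode == 0%N then (pol i == l) && (pol j == l')
  else (pol (2 * k)%N == i) && (pol (2 * k + 1)%N == j).

Definition real_at mode pol (k i j l l' : nat) : bool :=
  [&& (k < n)%N, selected mode pol k i j l l', neg_at k i j, pos_at l i & pos_at l' j].

(* A policy choosing an entry that is not available yields a zero row, and
   hence an infeasible system. *)
Definition zero_at mode pol (k i j l l' : nat) : bool :=
  [&& (k < n)%N, selected mode pol k i j l l' &
    if mode == 0%N then neg_at k i j && ~~ (pos_at l i && pos_at l' j)
    else ~~ neg_at k i j].

(** Every quintuple gets a row, which makes the layout independent of the policy. A quintuple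
    without an inequality of its own states that the last coordinate, the homogenizing [t], is
    positive. *)
Definition lp_coef mode pol (sgn del eps : rat) (k0 k i j l l' c : nat) : rat :=
  if real_at mode pol k i j l l' then
    row_vec n sgn ((1 - del) / 2) del ((1 - del) * pay_at k i j l l' + eps) k l l' k0 c
  else if zero_at mode pol k i j l l' then 0 else (c == n)%:R.

Definition encode (k i j l l' : nat) : nat := ((((k * m + i) * m + j) * n + l) * n + l')%N.

Definition lp_row mode pol sgn del eps k0 (r c : nat) : rat :=
  let r1 := (r %/ n)%N in let r2 := (r1 %/ n)%N in let r3 := (r2 %/ m)%N in
  lp_coef mode pol sgn del eps k0 (r3 %/ m) (r3 %% m) (r2 %% m) (r1 %% n) (r %% n) c.

(** The additional block [k = n] consists of rows [t > 0], so that this inequality is present in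
    every system. *)
Definition nrows : nat := (n.+1 * m * m * n * n)%N.

Lemma lp_row_encode mode pol sgn del eps k0 k i j l l' c :
  (i < m)%N -> (j < m)%N -> (l < n)%N -> (l' < n)%N ->
  lp_row mode pol sgn del eps k0 (encode k i j l l') c =
  lp_coef mode pol sgn del eps k0 k i j l l' c.
Proof.
have D (a b d : nat) : (b < d)%N -> ((a * d + b) %/ d = a)%N.
  by move=> bd; rewrite divnMDl ?divn_small ?addn0 //; lia.
have E (a b d : nat) : (b < d)%N -> ((a * d + b) %% d = b)%N.
  by move=> bd; rewrite modnMDl modn_small.
by move=> im jm ln l'n; rewrite /lp_row /encode /= !D ?E.
Qed.

Lemma encode_lt k i j l l' : (k <= n)%N ->
  (i < m)%N -> (j < m)%N -> (l < n)%N -> (l' < n)%N -> (encode k i j l l' < nrows)%N.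
Proof.
have step a b A d : (a < A)%N -> (b < d)%N -> (a * d + b < A * d)%N by nia.
by move=> kn im jm ln l'n; rewrite /encode /nrows; by apply: (step); [apply: (step); [apply: (step); [apply: (step)|]|]|].
Qed.

Lemma decode r : (r < nrows)%N -> exists k i j l l',
  [/\ (k <= n)%N, (i < m)%N && (j < m)%N, (l < n)%N && (l' < n)%N & r = encode k i j l l'].
Proof.
move=> rN.
have n0 : (0 < n)%N by move: rN; rewrite /nrows; case: (n) => //; rewrite muln0.
have m0 : (0 < m)%N by move: rN; rewrite /nrows; case: (m) => //; rewrite muln0 !mul0n.
exists (r %/ n %/ n %/ m %/ m)%N, (r %/ n %/ n %/ m %% m)%N, (r %/ n %/ n %% m)%N,
  (r %/ n %% n)%N, (r %% n)%N; split.
- by rewrite -ltnS !ltn_divLR.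
- by rewrite !ltn_mod m0.
- by rewrite !ltn_mod n0.
- by rewrite /encode -!divn_eq.
Qed.

Lemma ent_ordE (k : 'I_n) (i j : 'I_m) : ent k i j = Q k i j.
Proof. exact: entry_atE. Qed.

Lemma pos_atE (l : 'I_n) (i : 'I_m) : pos_at l i = is_pos (Q l i i).
Proof. by rewrite /pos_at ent_ordE; case: (Q l i i). Qed.

Lemma neg_atE (k : 'I_n) (i j : 'I_m) : neg_at k i j = is_neg (Q k i j).
Proof. by rewrite /neg_at ent_ordE; case: (Q k i j). Qed.

Lemma pay_atE (k : 'I_n) (i j : 'I_m) (l l' : 'I_n) :
  pay_at k i j l l' = payoff Q k i j l l'.
Proof. by rewrite /pay_at !ent_ordE. Qed.

Lemma lp_row_norm mode pol sgn del eps k0 r :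
  sgn ^+ 2 = 1 -> 0 <= del <= 1 -> (k0 < n)%N -> (r < nrows)%N ->
  dot n.+1 (lp_row mode pol sgn del eps k0 r) (lp_row mode pol sgn del eps k0 r) <= 1.
Proof.
move=> sgn1 del1 k0n /decode[k [i [j [l [l' [kn /andP[im jm] /andP[ln l'n] ->]]]]]].
have E c : (c < n.+1)%N -> lp_row mode pol sgn del eps k0 (encode k i j l l') c =
  lp_coef mode pol sgn del eps k0 k i j l l' c by move=> _; exact: lp_row_encode.
rewrite (eq_dot E E).
rewrite /lp_coef; have [/and5P[kn' _ _ _ _]|_] := boolP (real_at mode pol k i j l l').
  by apply: row_vec_norm => //; case/andP: del1 => ? ?; apply/andP; split; lra.
case: (zero_at mode pol k i j l l'); first by rewrite /dot big1 // => c _; rewrite mul0r.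
by rewrite /dot (@sum_delta_nat n.+1 n (fun c => (c == n)%:R)) // eqxx.
Qed.

Lemma dot_lp_row mode pol sgn del eps k0 k i j l l' (x : nat -> rat) :
  (k <= n)%N -> (i < m)%N -> (j < m)%N -> (l < n)%N -> (l' < n)%N -> (k0 < n)%N ->
  dot n.+1 (lp_row mode pol sgn del eps k0 (encode k i j l l')) x =
  if real_at mode pol k i j l l' then
    let cc := (1 - del) * pay_at k i j l l' + eps in
    sgn / (16 + cc * cc) * row_value n ((1 - del) / 2) del cc k l l' k0 x
  else if zero_at mode pol k i j l l' then 0 else x n.
Proof.
move=> kn im jm ln l'n k0n.
have E c : (c < n.+1)%N -> lp_row mode pol sgn del eps k0 (encode k i j l l') c =
  lp_coef mode pol sgn del eps k0 k i j l l' c by move=> _; exact: lp_row_encode.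
rewrite (eq_dot E (fun _ _ => erefl)).
rewrite /lp_coef; have [/and5P[kn' _ _ _ _]|_] := boolP (real_at mode pol k i j l l');
  first exact: dot_row_vec.
case: (zero_at mode pol k i j l l'); first by rewrite /dot big1 // => c _; rewrite mul0r.
by rewrite /dot sum_delta_nat.
Qed.

Hypothesis inst : tmsdfp_instance Q.

Lemma dot_lp_row_ord mode pol sgn del eps (k0 k : 'I_n) (i j : 'I_m) (l l' : 'I_n)
    (x : nat -> rat) :
  dot n.+1 (lp_row mode pol sgn del eps k0 (encode k i j l l')) x =
  if [&& selected mode pol k i j l l', is_neg (Q k i j), is_pos (Q l i i) & is_pos (Q l' j j)]
  then let cc := (1 - del) * payoff Q k i j l l' + eps in
    sgn / (16 + cc * cc) * row_value n ((1 - del) / 2) del cc k l l' k0 x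
  else if selected mode pol k i j l l' &&
    (if mode == 0%N then is_neg (Q k i j) && ~~ (is_pos (Q l i i) && is_pos (Q l' j j))
     else ~~ is_neg (Q k i j)) then 0 else x n.
Proof.
rewrite dot_lp_row ?ltn_ord ?(ltnW (ltn_ord k)) // /real_at /zero_at ltn_ord.
by rewrite neg_atE !pos_atE pay_atE.
Qed.

Lemma dot_last_row mode pol sgn del eps (k0 : 'I_n) (i : 'I_m) (x : nat -> rat) :
  dot n.+1 (lp_row mode pol sgn del eps k0 (encode n i i k0 k0)) x = x n.
Proof.
by rewrite dot_lp_row ?ltn_ord ?leqnn // /real_at /zero_at ltnn.
Qed.

Lemma encode_lt_ord (k l l' : 'I_n) (i j : 'I_m) : (encode k i j l l' < nrows)%N.
Proof. by apply: encode_lt; rewrite ?ltn_ord ?(ltnW (ltn_ord k)). Qed.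

Lemma encode_last_lt (l : 'I_n) (i : 'I_m) : (encode n i i l l < nrows)%N.
Proof. by apply: encode_lt; rewrite ?ltn_ord ?leqnn. Qed.

Lemma mode0_sound pol (k0 : 'I_n) (w : nat -> rat) :
  (forall i, (i < m)%N -> (pol i < n)%N) ->
  (forall r, (r < nrows)%N ->
     0 < dot n.+1 (lp_row 0 pol 1 (del_of Q) (eps_of Q) k0 r) w) ->
  winning (metzler_game Q).
Proof.
move=> poln Hw.
pose sigma (i : 'I_m) := Ordinal (poln i (ltn_ord i)).
have si (i : 'I_m) : (pol i == sigma i) = true by apply/eqP.
clearbody sigma.
have [i0 [_ _]] := inst_neg inst k0.
have t0 : 0 < w n.
  by have := Hw _ (encode_last_lt k0 i0); rewrite dot_last_row.
have row (k : 'I_n) (i j : 'I_m) : is_neg (Q k i j) ->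
    is_pos (Q (sigma i) i i) && is_pos (Q (sigma j) j j) /\
    0 < row_value n ((1 - del_of Q) / 2) (del_of Q)
      ((1 - del_of Q) * payoff Q k i j (sigma i) (sigma j) + eps_of Q)
      k (sigma i) (sigma j) k0 w.
  move=> ij; have := Hw _ (encode_lt_ord k (sigma i) (sigma j) i j).
  rewrite dot_lp_row_ord /selected eqxx !si ij !andTb.
  case: andP => _; last by rewrite ltxx.
  cbv zeta; set v := row_value _ _ _ _ _ _ _ _ _.
  have q0 := denominator_gt0 ((1 - del_of Q) * payoff Q k i j (sigma i) (sigma j) + eps_of Q).
  rewrite pmulr_rgt0 ?divr_gt0 ?ltr01 //; by split.
apply: (@max_sound _ _ Q inst sigma k0 (fun k => w k) (w n)) => // k i j ij.
  by have [] := row k i j ij.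
by have [_] := row k i j ij.
Qed.

(** The inequalities are reversed by the sign -1. They need neither restart nor bonus, because a
    losing potential is finite and strict already. *)
Lemma mode1_sound pol (k0 : 'I_n) (w : nat -> rat) :
  (forall k, (k < 2 * n)%N -> (pol k < m)%N) ->
  (forall r, (r < nrows)%N -> 0 < dot n.+1 (lp_row 1 pol (-1) 0 0 k0 r) w) ->
  losing (metzler_game Q).
Proof.
move=> polm Hw.
have p1 (k : 'I_n) : (2 * k < 2 * n)%N by rewrite ltn_pmul2l.
have p2 (k : 'I_n) : (2 * k + 1 < 2 * n)%N by have := ltn_ord k; lia.
pose tau (k : 'I_n) := (Ordinal (polm _ (p1 k)), Ordinal (polm _ (p2 k))).
have ti1 (k : 'I_n) : (pol (2 * k)%N == (tau k).1) = true by apply/eqP.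
have ti2 (k : 'I_n) : (pol (2 * k + 1)%N == (tau k).2) = true by apply/eqP.
clearbody tau.
have [i0 [_ _]] := inst_neg inst k0.
have t0 : 0 < w n.
  by have := Hw _ (encode_last_lt k0 i0); rewrite dot_last_row.
have row (k : 'I_n) (l l' : 'I_n) : is_neg (Q k (tau k).1 (tau k).2) /\
   (is_pos (Q l (tau k).1 (tau k).1) -> is_pos (Q l' (tau k).2 (tau k).2) ->
    0 < - row_value n ((1 - 0) / 2) 0
      ((1 - 0) * payoff Q k (tau k).1 (tau k).2 l l' + 0) k l l' k0 w).
  have := Hw _ (encode_lt_ord k l l' (tau k).1 (tau k).2).
  rewrite dot_lp_row_ord /selected ti1 ti2 !andTb.
  case: (is_neg _); last by rewrite ltxx.
  move=> H; split; first by [].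
  move=> lp l'p; move: H; rewrite lp l'p andTb; cbv zeta.
  set v := row_value _ _ _ _ _ _ _ _ _.
  have q0 := denominator_gt0 ((1 - 0) * payoff Q k (tau k).1 (tau k).2 l l' + 0).
  have -> : -1 / (16 + ((1 - 0) * payoff Q k (tau k).1 (tau k).2 l l' + 0) *
    ((1 - 0) * payoff Q k (tau k).1 (tau k).2 l l' + 0)) * v =
    (16 + ((1 - 0) * payoff Q k (tau k).1 (tau k).2 l l' + 0) *
    ((1 - 0) * payoff Q k (tau k).1 (tau k).2 l l' + 0))^-1 * - v by rewrite mulN1r mulNr mulrN.
  rewrite pmulr_rgt0 ?invr_gt0 //; exact.
apply: (@min_sound _ _ Q tau (fun k => w k) (w n)).
- by move=> k; have [] := row k k0 k0.
- exact: t0.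
- move=> k l l' li lj; have [_ /(_ li lj)] := row k l l'.
  rewrite /row_value subr0 addr0 mul0r mul1r addr0.
  move: (payoff _ _ _ _ _ _) => p; lra.
Qed.

(** The witness has to exist for every array extending [sigma], as the machine array has further
    cells with arbitrary content. *)
Lemma mode0_complete : winning (metzler_game Q) ->
  exists (sigma : 'I_m -> 'I_n) (k0 : 'I_n), forall pol : nat -> nat,
  (forall i : 'I_m, pol i = sigma i) ->
  exists z, witness nrows n.+1 (lp_row 0 pol 1 (del_of Q) (eps_of Q) k0)
    ((kap Q)%:R ^+ 13) z.
Proof.
move=> /(max_complete inst)[sigma [k0 [x [spos xb Hx]]]]; exists sigma, k0 => pol polE.
have [kap8 kapn kapS S1] := kap_bounds Q.
have [e01 d01 _ _ _] := perturbation_params kap8; rewrite -/(eps_of Q) -/(del_of Q) in e01 d01.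
have epsE : eps_of Q = (kap Q)%:R^-1 ^+ 3 by [].
apply: (scaled_witness kap8 kapn xb (t := 1)).
  by rewrite lexx exprn_ege1 // (le_trans _ kap8).
move: (eps_of Q) (del_of Q) e01 d01 epsE Hx => e d e01 d01 epsE Hx.
move: ((kap Q)%:R : rat) kap8 kapS epsE {kapn xb} => K K8 KS epsE.
have one : K^-1 ^+ 6 <= 1 by rewrite exprn_ile1 ?invr_ge0 ?invf_le1; lra.
move=> z zx zn r /decode[k [i [j [l [l' [kn /andP[im jm] /andP[ln l'n] ->]]]]]].
move: kn; rewrite leq_eqVlt => /orP[/eqP ->|kn].
  by rewrite dot_lp_row // /real_at /zero_at ltnn zn.
rewrite (dot_lp_row_ord _ _ _ _ _ k0 (Ordinal kn) (Ordinal im) (Ordinal jm)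
  (Ordinal ln) (Ordinal l'n)).
rewrite /selected eqxx (polE (Ordinal im)) (polE (Ordinal jm)).
have [/andP[/eqP iE /eqP jE]|nsel] :=
  boolP ((nat_of_ord (sigma (Ordinal im)) == l) && (nat_of_ord (sigma (Ordinal jm)) == l'));
  last by rewrite zn.
have {}iE : sigma (Ordinal im) = Ordinal ln by apply: val_inj.
have {}jE : sigma (Ordinal jm) = Ordinal l'n by apply: val_inj.
rewrite !andTb -iE -jE !spos andbT andbF.
case: (boolP (is_neg _)) => ij; last by rewrite zn.
have := Hx _ _ _ ij; have := payoff_le Q (Ordinal kn) (Ordinal im) (Ordinal jm)
  (sigma (Ordinal im)) (sigma (Ordinal jm)).
cbv zeta; rewrite /row_value zn !zx mulr1.
move: (payoff _ _ _ _ _ _) => p pb Hp; rewrite [true && true]/= mul1r.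
have /andP[e0 e1] := e01.
apply: normalized_row_ge K8 KS S1 pb _ d01 _; first by rewrite (ltW e0).
apply: le_trans Hp.
by rewrite epsE.
Qed.

Lemma mode1_complete : losing (metzler_game Q) ->
  exists tau : 'I_n -> 'I_m * 'I_m, forall pol : nat -> nat,
  (forall k : 'I_n, pol (2 * k)%N = (tau k).1 /\ pol (2 * k + 1)%N = (tau k).2) ->
  forall k0 : 'I_n,
  exists z, witness nrows n.+1 (lp_row 1 pol (-1) 0 0 k0) ((kap Q)%:R ^+ 13) z.
Proof.
move=> /losing_bounded[tau [x [t [tneg xb tb Hx]]]]; exists tau => pol polE k0.
have [kap8 kapn kapS S1] := kap_bounds Q.
have K6 : (kap Q)%:R <= (kap Q)%:R ^+ 6 :> rat.
  rewrite exprS ler_peMr // ?exprn_ege1 //; move: kap8; move: (_%:R : rat) => K; lra.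
apply: (scaled_witness kap8 kapn (x := x) (t := t)).
- by move=> k; have /andP[x0 xk] := xb k; rewrite ger0_norm // (le_trans xk).
- by have /andP[-> tk] := tb; rewrite (le_trans tk).
move: tb xb {K6 kapn} => /andP[t1 _] _.
move: ((kap Q)%:R : rat) kap8 kapS Hx => K K8 KS Hx.
have one : K^-1 ^+ 6 <= 1 by rewrite exprn_ile1 ?invr_ge0 ?invf_le1; lra.
move=> z zx zn r /decode[k [i [j [l [l' [kn /andP[im jm] /andP[ln l'n] ->]]]]]].
move: kn; rewrite leq_eqVlt => /orP[/eqP ->|kn].
  by rewrite dot_lp_row // /real_at /zero_at ltnn zn (le_trans one).
rewrite (dot_lp_row_ord _ _ _ _ _ k0 (Ordinal kn) (Ordinal im) (Ordinal jm)
  (Ordinal ln) (Ordinal l'n)).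
have [p1 p2] := polE (Ordinal kn).
rewrite /selected p1 p2 [(1 == 0)%N]/=.
have [/andP[/eqP iE /eqP jE]|nsel] :=
  boolP ((nat_of_ord (tau (Ordinal kn)).1 == i) && (nat_of_ord (tau (Ordinal kn)).2 == j));
  last by rewrite zn (le_trans one).
have {}iE : (tau (Ordinal kn)).1 = Ordinal im by apply: val_inj.
have {}jE : (tau (Ordinal kn)).2 = Ordinal jm by apply: val_inj.
have := tneg (Ordinal kn); have := Hx (Ordinal kn) (Ordinal ln) (Ordinal l'n).
rewrite iE jE => Hp ->; rewrite !andTb [~~ true]/=.
have [/andP[lp l'p]|_] := boolP (is_pos (Q (Ordinal ln) _ _) && is_pos _); last by rewrite zn (le_trans one).
have := Hp lp l'p; have := payoff_le Q (Ordinal kn) (Ordinal im) (Ordinal jm)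
  (Ordinal ln) (Ordinal l'n).
cbv zeta; rewrite /row_value zn !zx.
move: (payoff _ _ _ _ _ _) => p pb {}Hp.
set v := _ + _ * t; have -> : -1 / (16 + ((1 - 0) * p + 0) * ((1 - 0) * p + 0)) * v =
  (16 + ((1 - 0) * p + 0) * ((1 - 0) * p + 0))^-1 * - v by rewrite mulN1r mulNr mulrN.
have z01 : 0 <= (0 : rat) <= 1 by rewrite lexx ler01.
apply: (normalized_row_ge K8 KS S1 pb z01 z01).
have := le_trans (half_inv_cube_le K8) Hp; rewrite /v.
by move: (x _) (x _) (x _) (x _) => a b c f; lra.
Qed.

End LinearPrograms.

(** * A program logic for total correctness with time bounds *)

Definition run (c : cmd) (s : state) (T : nat) (Q : state -> Prop) : Prop :=
  exists t s', [/\ exec c s t s', (t <= T)%N & Q s'].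

Definition may_be (e : nexp) (i : nat) : bool :=
  if e is NConst j then i == j else true.

Fixpoint nwrites (c : cmd) (a i : nat) : bool :=
  match c with
  | NSet b e _ => (a == b) && may_be e i
  | Seq c1 c2 | If _ c1 c2 => nwrites c1 a i || nwrites c2 a i
  | While _ c => nwrites c a i
  | _ => false
  end.

Fixpoint qwrites (c : cmd) (a i : nat) : bool :=
  match c with
  | QSet b e _ => (a == b) && may_be e i
  | Seq c1 c2 | If _ c1 c2 => qwrites c1 a i || qwrites c2 a i
  | While _ c => qwrites c a i
  | _ => false
  end.

(** A syntactic frame rule: constant addresses are told apart, a computed one may hit its whole
    array. Postconditions then need to mention only what a program changes. *)
Definition frame (c : cmd) (s s' : state) : Prop :=
  (forall a i, ~~ nwrites c a i -> nmem s' a i = nmem s a i) /\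
  (forall a i, ~~ qwrites c a i -> qmem s' a i = qmem s a i).

Lemma frame_refl c s : frame c s s. Proof. by []. Qed.

Lemma frame_trans c s s1 s2 : frame c s s1 -> frame c s1 s2 -> frame c s s2.
Proof.
move=> [n1 q1] [n2 q2].
by split=> a i w; [rewrite n2 // n1 | rewrite q2 // q1].
Qed.

Lemma frame_sub c c' s s' :
  (forall a i, nwrites c a i -> nwrites c' a i) ->
  (forall a i, qwrites c a i -> qwrites c' a i) ->
  frame c s s' -> frame c' s s'.
Proof.
move=> nn qq [n1 q1]; split=> a i w; [apply: n1 | apply: q1];
  apply: contra w; [exact: nn | exact: qq].
Qed.

Lemma may_be_eval s e : may_be e (neval s e).
Proof. by case: e => //= j; rewrite eqxx. Qed.

Lemma exec_frame c s t s' : exec c s t s' -> frame c s s'.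
Proof.
elim=> {c s t s'} [s|s a e v|s a e v|c1 c2 s s1 s2 t1 t2 _ F1 _ F2
  |b c1 c2 s s' t _ F|b c s _|b c s s1 s2 t1 t2 _ _ F1 _ F2] //.
- split=> //= a' i; rewrite /upd; case: eqP => [->|] //=.
  by case: eqP => [->|] //=; rewrite may_be_eval.
- split=> //= a' i; rewrite /upd; case: eqP => [->|] //=.
  by case: eqP => [->|] //=; rewrite may_be_eval.
- apply: frame_trans (frame_sub _ _ F1) (frame_sub _ _ F2) => a i /= -> //;
    by rewrite orbT.
- by apply: frame_sub F => a i /=; case: ifP => _ ->; rewrite ?orbT.
- by apply: frame_trans F1 F2.
Qed.

Lemma run_frame c s T Q : run c s T Q -> run c s T (fun s' => frame c s s' /\ Q s').
Proof.
by move=> [t [s' [E tT Qs]]]; exists t, s'; split=> //; split=> //; apply: exec_frame E.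
Qed.

Lemma run_weaken c s T T' (Q Q' : state -> Prop) :
  run c s T Q -> (T <= T')%N -> (forall s', frame c s s' -> Q s' -> Q' s') ->
  run c s T' Q'.
Proof.
move=> /run_frame[t [s' [E tT [F Qs]]]] TT QQ; exists t, s'; split=> //.
  exact: leq_trans TT.
exact: QQ.
Qed.

Lemma run_time c s T T' Q : run c s T Q -> (T <= T')%N -> run c s T' Q.
Proof. by move=> H TT; apply: run_weaken H TT _. Qed.

Lemma run_skip s (Q : state -> Prop) : Q s -> run Skip s 1 Q.
Proof. by exists 1%N, s; split=> //; constructor. Qed.

Lemma run_nset s a e v (Q : state -> Prop) :
  Q (State (upd (nmem s) a (neval s e) (neval s v)) (qmem s)) ->
  run (NSet a e v) s (ncost e + ncost v).+1 Q.
Proof. by move=> H; do 2 eexists; split; [constructor| |exact: H]. Qed.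

Lemma run_qset s a e v (Q : state -> Prop) :
  Q (State (nmem s) (upd (qmem s) a (neval s e) (qeval s v))) ->
  run (QSet a e v) s (ncost e + qcost v).+1 Q.
Proof. by move=> H; do 2 eexists; split; [constructor| |exact: H]. Qed.

Lemma run_seq c1 c2 s T1 T2 Q :
  run c1 s T1 (fun s1 => frame c1 s s1 -> run c2 s1 T2 Q) ->
  run (Seq c1 c2) s (T1 + T2) Q.
Proof.
move=> [t1 [s1 [E1 tT1 H]]]; have [t2 [s2 [E2 tT2 Q2]]] := H (exec_frame E1).
by exists (t1 + t2)%N, s2; split=> //; [econstructor; eauto | apply: leq_add].
Qed.

(** Both branches are charged, so that the bound does not depend on the test. *)
Lemma run_if b c1 c2 s T1 T2 Q :
  (beval s b -> run c1 s T1 Q) -> (~~ beval s b -> run c2 s T2 Q) ->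
  run (If b c1 c2) s (bcost b + (T1 + T2)).+1 Q.
Proof.
move=> H1 H2; case: (boolP (beval s b)) => hb.
  have [t [s' [E tT Qs]]] := H1 hb; exists (bcost b + t).+1, s'; split=> //.
    by constructor; rewrite hb.
  by rewrite ltnS leq_add2l (leq_trans tT) ?leq_addr.
have [t [s' [E tT Qs]]] := H2 hb; exists (bcost b + t).+1, s'; split=> //.
  by constructor; rewrite (negbTE hb).
by rewrite ltnS leq_add2l (leq_trans tT) ?leq_addl.
Qed.

(* The first argument of the invariant bounds the number of remaining
   iterations. *)
Lemma run_while b c s T k (I : nat -> state -> Prop) :
  I k s ->
  (forall k s', frame c s s' -> I k s' -> beval s' b ->
     run c s' T (fun s2 => exists2 k', (k' < k)%N & I k' s2)) ->
  run (While b c) s (k * (bcost b + T).+1 + (bcost b).+1)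
    (fun s' => ~~ beval s' b /\ exists k', I k' s').
Proof.
move=> + step.
suff H s' : frame c s s' -> I k s' ->
    run (While b c) s' (k * (bcost b + T).+1 + (bcost b).+1)
    (fun s' => ~~ beval s' b /\ exists k', I k' s') by apply: H.
elim/ltn_ind: k s' => k IH s' Fs Is.
case: (boolP (beval s' b)) => hb; last first.
  exists (bcost b).+1, s'; split; [exact: exec_while_false|exact: leq_addl|].
  by split=> //; exists k.
have [t1 [s1 [E1 tT1 [k' kk I1]]]] := step k s' Fs Is hb.
have Fs1 : frame c s s1 by apply: frame_trans Fs (exec_frame E1).
have [t2 [s2 [E2 tT2 Q2]]] := IH k' kk s1 Fs1 I1.
exists (bcost b + t1 + t2).+1, s2; split=> //; first exact: exec_while_true E1 E2.
apply: (@leq_trans ((bcost b + T).+1 + (k' * (bcost b + T).+1 + (bcost b).+1))).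
  by rewrite addSn ltnS leq_add // leq_add2l.
by rewrite addnA leq_add2r -mulSn leq_mul2r kk orbT.
Qed.

Definition setn (s : state) (v x : nat) : state :=
  State (upd (nmem s) 2 v x) (qmem s).

Definition sc (v : nat) : nexp := NGet 2 (NConst v).
Definition qsc (v : nat) : qexp := QGet 2 (NConst v).

Definition For (v : nat) (e : nexp) (body : cmd) : cmd :=
  Seq (NSet 2 (NConst v) (NConst 0))
      (While (BNot (NLe e (sc v)))
             (Seq body (NSet 2 (NConst v) (NAdd (sc v) (NConst 1))))).

Definition for_time (b T ce : nat) : nat := (b * (ce + T + 12) + (ce + 12))%N.

(** The bound [e] is evaluated anew in every round, hence the premise that no state within the frame
    of the loop changes it. The invariant is tested with the counter already advanced, since the
    increment follows the body. *)
Lemma run_for v e body s b T (I : nat -> state -> Prop) :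
  ~~ nwrites body 2 v ->
  (forall s', frame (For v e body) s s' -> neval s' e = b) ->
  I 0 (setn s v 0) ->
  (forall i s', (i < b)%N -> frame (For v e body) s s' -> nmem s' 2 v = i ->
     I i s' -> run body s' T (fun s2 => I i.+1 (setn s2 v i.+1))) ->
  run (For v e body) s (for_time b T (ncost e)) (I b).
Proof.
move=> wv eb I0 step.
have F0 : frame (For v e body) s (setn s v 0).
  by apply: frame_sub (@exec_frame (NSet 2 (NConst v) (NConst 0)) _ _ _ _) => //=;
    [move=> a i -> | constructor].
apply: (@run_weaken _ _ (3 + (b * (ncost e + 4 + (T + 6)).+1 + (ncost e + 4).+1))%N
  _ (I b)) => //; last by rewrite /for_time; nia.
apply: run_seq; apply: run_nset => _ /=.
set body' := Seq body _.
apply: (@run_weaken _ _ (b * (bcost (BNot (NLe e (sc v))) + (T + 6)).+1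
   + (bcost (BNot (NLe e (sc v)))).+1) _
  (fun s' => ~~ beval s' (BNot (NLe e (sc v))) /\
   exists k, [/\ frame (For v e body) s s', k = (b - nmem s' 2 v)%N,
     (nmem s' 2 v <= b)%N & I (nmem s' 2 v) s'])).
- apply: (@run_while _ _ _ _ _ (fun k s' => [/\ frame (For v e body) s s',
    k = (b - nmem s' 2 v)%N, (nmem s' 2 v <= b)%N & I (nmem s' 2 v) s'])).
    by split=> //=; rewrite /upd !eqxx /= ?subn0.
  move=> k s' _ [F ke vb Is] /=; rewrite eb // -ltnNge => vb'.
  apply: (@run_weaken _ _ (T + 6) _ (fun s2 => I (nmem s' 2 v).+1 s2 /\
     nmem s2 2 v = (nmem s' 2 v).+1)) => //.
    apply: run_seq; apply: run_weaken (step (nmem s' 2 v) s' vb' F erefl Is) _ _ => //.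
    move=> s1 F1 I1 _; have v1 : nmem s1 2 v = nmem s' 2 v by apply: F1.1.
    apply: run_nset => /=; rewrite v1 addn1; split=> //=.
    by rewrite /upd !eqxx.
  move=> s2 F2 [I2 v2]; exists (b - (nmem s' 2 v).+1)%N; first by rewrite ke ltn_sub2l.
  rewrite v2; split=> //; apply: frame_trans F (frame_sub _ _ F2) => //=.
  by move=> a i H; rewrite H orbT.
- rewrite /=; nia.
- by move=> s' _ /= [+ [k [F _ vb Is]]]; rewrite negbK eb // => bv;
    have -> : b = nmem s' 2 v by apply/eqP; rewrite eqn_leq bv vb.
Qed.

Definition filled (T : Type) (f old : nat -> T) (lo hi j : nat) : T :=
  if (lo <= j < hi)%N then f j else old j.

Lemma filled0 T (f old : nat -> T) lo j : filled f old lo lo j = old j.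
Proof. by rewrite /filled; case: andP => // -[H1 H2]; lia. Qed.

Lemma filledS T (f old : nat -> T) lo hi j : (lo <= hi)%N ->
  filled f old lo hi.+1 j = if j == hi then f hi else filled f old lo hi j.
Proof.
move=> lh; rewrite /filled ltnS; case: eqP => [->|jh]; first by rewrite lh leqnn.
by congr (if _ then _ else _); congr (_ && _); lia.
Qed.

(** In round [i] the cells from [lo + i] on still hold their old content, which permits updates in
    place. *)
Lemma run_fill v e a ei ev s b lo f :
  (forall s', frame (For v e (QSet a ei ev)) s s' -> neval s' e = b) ->
  (forall i s', (i < b)%N -> frame (For v e (QSet a ei ev)) s s' ->
     nmem s' 2 v = i ->
     (forall j, qmem s' a j = filled f (qmem s a) lo (lo + i) j) ->
     neval s' ei = (lo + i)%N /\ qeval s' ev = f (lo + i)%N) ->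
  run (For v e (QSet a ei ev)) s (for_time b (ncost ei + qcost ev).+1 (ncost e))
    (fun s' => forall j, qmem s' a j = filled f (qmem s a) lo (lo + b) j).
Proof.
move=> eb step; apply: (run_for (I := fun i s' => forall j,
  qmem s' a j = filled f (qmem s a) lo (lo + i) j)) => //.
  by move=> j /=; rewrite addn0 filled0.
move=> i s' ib F vi Is; have [e1 e2] := step i s' ib F vi Is.
apply: run_qset => j /=; rewrite /upd eqxx /= e1 e2 addnS filledS ?leq_addr //.
by case: eqP.
Qed.

Lemma run_nfill v e a ei ev s b lo f :
  a != 2%N ->
  (forall s', frame (For v e (NSet a ei ev)) s s' -> neval s' e = b) ->
  (forall i s', (i < b)%N -> frame (For v e (NSet a ei ev)) s s' ->
     nmem s' 2 v = i ->
     (forall j, nmem s' a j = filled f (nmem s a) lo (lo + i) j) ->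
     neval s' ei = (lo + i)%N /\ neval s' ev = f (lo + i)%N) ->
  run (For v e (NSet a ei ev)) s (for_time b (ncost ei + ncost ev).+1 (ncost e))
    (fun s' => forall j, nmem s' a j = filled f (nmem s a) lo (lo + b) j).
Proof.
move=> a2 eb step; apply: (run_for (I := fun i s' => forall j,
  nmem s' a j = filled f (nmem s a) lo (lo + i) j)) => //.
- by rewrite /= negb_and eq_sym a2.
- by move=> j /=; rewrite /upd (negbTE a2) addn0 filled0.
move=> i s' ib F vi Is; have [e1 e2] := step i s' ib F vi Is.
apply: run_nset => j /=; rewrite /upd eqxx (negbTE a2) /= e1 e2 addnS filledS ?leq_addr //.
by case: eqP.
Qed.

Definition Sum (acc v : nat) (e : nexp) (x : qexp) : cmd :=
  Seq (QSet 2 (NConst acc) (QConst 0))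
      (For v e (QSet 2 (NConst acc) (QAdd (qsc acc) x))).

Definition sum_time (b cx ce : nat) : nat := (for_time b (cx + 5) ce + 3)%N.

Lemma run_sum acc v e x s b (f : nat -> rat) :
  (forall s', frame (Sum acc v e x) s s' -> neval s' e = b) ->
  (forall i s', (i < b)%N -> frame (Sum acc v e x) s s' -> nmem s' 2 v = i ->
     qeval s' x = f i) ->
  run (Sum acc v e x) s (sum_time b (qcost x) (ncost e))
    (fun s' => qmem s' 2 acc = \sum_(i < b) f i).
Proof.
move=> eb step; pose body := For v e (QSet 2 (NConst acc) (QAdd (qsc acc) x)).
apply: (@run_weaken _ _ (3 + for_time b (qcost x + 5) (ncost e)) _
  (fun s' => qmem s' 2 acc = \sum_(i < b) f i)) => //; last by rewrite /sum_time addnC.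
apply: run_seq; apply: run_qset => F0.
have sub s' : frame body (State (nmem s) (upd (qmem s) 2 acc 0)) s' ->
    frame (Sum acc v e x) s s'.
  move=> F; apply: frame_trans (frame_sub _ _ F0) (frame_sub _ _ F) => a i /= H //;
    by rewrite H ?orbT.
apply: (@run_weaken _ _ (for_time b (1 + qcost (QAdd (qsc acc) x)).+1 (ncost e)) _
  (fun s' => qmem s' 2 acc = \sum_(i < b) f i)) => //; last first.
  by rewrite /for_time /=; nia.
apply: (@run_for _ _ _ _ _ _ (fun i s' => qmem s' 2 acc = \sum_(j < i) f j)) => //.
- by move=> s' /sub; apply: eb.
- by rewrite /= /upd !eqxx big_ord0.
move=> i s' ib /sub F vi Is; apply: run_qset.
by rewrite /= /upd !eqxx /= Is (step i) // big_ord_recr.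
Qed.

(* Natural arrays: 2 holds the scalars, 3 the policy, 4 the perceptron counters.
   Rational arrays: 2 holds the scalars, 3 the scaled rows of the linear program,
   4 the inverse matrix, 5 the current point, 6 the last step, 7 the scales.
   Natural scalars: 0, 1 the numbers of rows and columns; 2 the mode; 3, 4 the
   length and the base of the policies; 5 their number; 6 the answer found so
   far; 8 the restart state; 12, 13, 14 the violated row, the stopping flag and
   the result of the solver; 15 to 19 the loop indices k, i, j, l, l'.
   Rational scalars: 2 the bound on the scales, 3 [kap Q], 4 [size_bound Q],
   5 to 7 the parameters eps, del, sgn of the linear program. *)
Definition rowsE : nexp := sc 0.
Definition dimE : nexp := sc 1.
Definition at2 (a : nat) (r c : nexp) : qexp := QGet a (NAdd (NMul r dimE) c).
(** Truncated subtraction turns equality into 0 or 1, as Boolean expressions cannot be used as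
    numbers. *)
Definition ind (e1 e2 : nexp) : nexp :=
  NSub (NSub (NConst 1) (NSub e1 e2)) (NSub e2 e1).

Lemma neval_ind s e1 e2 : neval s (ind e1 e2) = (neval s e1 == neval s e2).
Proof. by rewrite /=; case: eqP => [->|]; rewrite /=; lia. Qed.

Lemma qeval_ind s e1 e2 :
  qeval s (QOfNat (ind e1 e2)) = (neval s e1 == neval s e2)%:R.
Proof. by rewrite -neval_ind. Qed.

(** * The perceptron as a program *)

Definition solver_setup : cmd :=
  Seq (For 9 rowsE (NSet 4 (sc 9) (NConst 0)))
  (Seq (For 9 rowsE (QSet 7 (sc 9) (QConst 1)))
  (Seq (For 10 dimE (QSet 5 (sc 10) (QConst 0)))
  (Seq (For 10 dimE (For 11 dimE
          (QSet 4 (NAdd (NMul (sc 10) dimE) (sc 11)) (QOfNat (ind (sc 10) (sc 11))))))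
  (Seq (NSet 2 (NConst 13) (NConst 0)) (NSet 2 (NConst 14) (NConst 0)))))).

(** Scalar 12 retains the last violated row; the number of rows, which is not an index of a row,
    means that there is none. *)
Definition find_violated : cmd :=
  Seq (NSet 2 (NConst 12) rowsE)
      (For 9 rowsE
         (Seq (Sum 0 10 dimE (QMul (at2 3 (sc 9) (sc 10)) (QGet 5 (sc 10))))
              (If (QLe (qsc 0) (QConst 0)) (NSet 2 (NConst 12) (sc 9)) Skip))).

(** The step [B v] stays in array 6, where [rescale] finds it for the rank one update. *)
Definition perceptron_update : cmd :=
  Seq (For 10 dimE
         (Seq (Sum 0 11 dimE (QMul (at2 4 (sc 10) (sc 11)) (at2 3 (sc 12) (sc 11))))
              (QSet 6 (sc 10) (qsc 0))))
  (Seq (NSet 4 (sc 12) (NAdd (NGet 4 (sc 12)) (NConst 1)))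
       (For 10 dimE (QSet 5 (sc 10) (QAdd (QGet 5 (sc 10)) (QGet 6 (sc 10)))))).

(** The denominator of the Sherman-Morrison formula is computed before row 12 is doubled. When the
    new scale exceeds the bound, only the stopping flag is raised, so the result remains 0. *)
Definition rescale : cmd :=
  Seq (Sum 1 10 dimE (QMul (QGet 6 (sc 10)) (at2 3 (sc 12) (sc 10))))
  (Seq (For 10 dimE (For 11 dimE
          (QSet 4 (NAdd (NMul (sc 10) dimE) (sc 11))
             (QSub (at2 4 (sc 10) (sc 11))
                (QDiv (QMul (QMul (QConst 3) (QGet 6 (sc 10))) (QGet 6 (sc 11)))
                      (QAdd (QConst 1) (QMul (QConst 3) (qsc 1))))))))
  (Seq (For 10 dimE (QSet 3 (NAdd (NMul (sc 12) dimE) (sc 10))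
          (QMul (QConst 2) (at2 3 (sc 12) (sc 10)))))
  (Seq (For 10 dimE (QSet 5 (sc 10) (QConst 0)))
  (Seq (QSet 7 (sc 12) (QMul (QConst 2) (QGet 7 (sc 12))))
  (Seq (For 9 rowsE (NSet 4 (sc 9) (NConst 0)))
       (If (QLe (QGet 7 (sc 12)) (qsc 2)) Skip (NSet 2 (NConst 13) (NConst 1)))))))).

Definition tauE : nexp := NMul (NMul (NConst 4) rowsE) (NAdd rowsE (NConst 1)).

Definition solver_body : cmd :=
  Seq find_violated
      (If (NLe rowsE (sc 12))
         (Seq (NSet 2 (NConst 13) (NConst 1)) (NSet 2 (NConst 14) (NConst 1)))
         (Seq perceptron_update
              (If (NLe tauE (NGet 4 (sc 12))) rescale Skip))).

Definition solver : cmd :=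
  Seq solver_setup (While (NLe (sc 13) (NConst 0)) solver_body).

Lemma index_lt c c' d D : (c < D)%N -> (c' < d)%N -> (c * d + c' < D * d)%N.
Proof. nia. Qed.

Lemma index_div c c' d : (c' < d)%N -> ((c * d + c') %/ d = c)%N.
Proof. by move=> cd; rewrite divnMDl ?divn_small ?addn0 //; lia. Qed.

Lemma index_mod c c' d : (c' < d)%N -> ((c * d + c') %% d = c')%N.
Proof. by move=> cd; rewrite modnMDl modn_small. Qed.

(** * Correctness and running time of the solver *)

Section SolverCorrect.
Variables (N d : nat).

Definition dims (s : state) := nmem s 2 0 = N /\ nmem s 2 1 = d.

Lemma frame_dims c s s' :
  ~~ nwrites c 2 0 -> ~~ nwrites c 2 1 -> frame c s s' -> dims s -> dims s'.
Proof. by move=> w0 w1 F [sN sd]; split; rewrite F.1. Qed.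

Lemma run_find s : dims s ->
  let val r := \sum_(c < d) qmem s 3 (r * d + c)%N * qmem s 5 c in
  run find_violated s (50 * N.+1 * d.+1)
    (fun s' => (nmem s' 2 12 = N /\ forall r, (r < N)%N -> 0 < val r) \/
               ((nmem s' 2 12 < N)%N /\ val (nmem s' 2 12) <= 0)).
Proof.
move=> ds val; eapply run_time; first eapply run_seq.
  apply: run_nset => F0; eapply (run_for (b := N)
    (I := fun i s' => (nmem s' 2 12 = N /\ forall r, (r < i)%N -> 0 < val r) \/
    ((nmem s' 2 12 < N)%N /\ val (nmem s' 2 12) <= 0))) => //.
  - by move=> s' F /=; rewrite F.1 //; case: ds.
  - by left; split=> //=; case: ds.
  move=> i s' iN F si Is.
  have F' : frame find_violated s s'.
    by apply: frame_trans (frame_sub _ _ F0) (frame_sub _ _ F) => a j /= H //; rewrite H ?orbT.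
  have [sN sd] := @frame_dims find_violated _ _ isT isT F' ds.
  eapply run_seq.
  apply: run_weaken (leqnn _) _.
    eapply (run_sum (b := d)
      (f := fun c => qmem s 3 (i * d + c)%N * qmem s 5 c)).
    + by move=> s2 F2 /=; rewrite F2.1.
    + by move=> c s2 cd F2 s2c /=; rewrite s2c !F2.1 // !F2.2 // si sd !F'.2.
  move=> s2 F2 s2v _; eapply run_if => /= [H|H].
    by apply: run_nset => /=; right; rewrite /upd /= F2.1 // si iN /val -s2v.
  apply: run_skip; rewrite /= /upd /= F2.1 //.
  case: Is => [[-> Is]|//]; [left|by right]; split=> // r.
  rewrite ltnS leq_eqVlt => /orP[/eqP ->|/Is //].
  by rewrite /val -s2v ltNge.
rewrite /sum_time /for_time /=; nia.
Qed.

Lemma run_update s : dims s ->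
  let v := nmem s 2 12 in
  let u c := \sum_(c' < d) qmem s 4 (c * d + c')%N * qmem s 3 (v * d + c')%N in
  run perceptron_update s (50 * d.+1 * d.+1)
    (fun s' => [/\ forall c, (c < d)%N -> qmem s' 6 c = u c,
      forall c, (c < d)%N -> qmem s' 5 c = qmem s 5 c + u c &
      forall r, nmem s' 4 r = incr (nmem s 4) v r]).
Proof.
move=> ds v u; have [sN sd] := ds; eapply run_time; first eapply run_seq.
  apply: run_weaken (leqnn _) _.
    eapply (run_for (b := d) (I := fun i s' => forall c, (c < i)%N -> qmem s' 6 c = u c)) => //.
    + by move=> s' F /=; rewrite F.1.
    move=> i s' id F si Is; eapply run_seq; apply: run_weaken (leqnn _) _.
      eapply (run_sum (b := d)
        (f := fun c => qmem s 4 (i * d + c)%N * qmem s 3 (v * d + c)%N)).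
      + by move=> s2 F2 /=; rewrite F2.1 // F.1.
      + by move=> c s2 cd F2 s2c /=; rewrite s2c !F2.1 // !F2.2 // si !F.1 // sd !F.2.
    move=> s2 F2 s2v _; apply: run_qset => c /=; rewrite ltnS leq_eqVlt.
    rewrite /upd eqxx /= F2.1 // si s2v; case: eqP => [->|_ /=] // /Is.
    by rewrite F2.2.
  move=> s1 F1 H1 _; eapply run_seq; apply: run_nset => F2.
  apply: run_weaken (leqnn _) _.
    eapply (run_fill (b := d) (lo := 0) (f := fun c => qmem s 5 c + qmem s1 6 c)).
    + by move=> s' F /=; rewrite F.1 //= /upd /= F1.1.
    + move=> i s' id F si Is /=; rewrite si Is /filled ltnn andbF /=; split=> //.
      by rewrite F.2 //= F1.2.
  move=> s3 F3 H3; split=> [c cd|c cd|r].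
  - by rewrite F3.2 //= H1.
  - by rewrite H3 /filled /= cd H1.
  - rewrite F3.1 //= /upd /= F1.1 // F1.1 // addn1 /incr F1.1 // -/v.
    by case: eqP => // ->.
rewrite /sum_time /for_time /=; nia.
Qed.

Lemma run_rescale s : dims s ->
  let v := nmem s 2 12 in let u := qmem s 6 in
  let V c := qmem s 3 (v * d + c)%N in
  (v < N)%N ->
  run rescale s (200 * N.+1 * d.+1 * d.+1)
    (fun s' => [/\ forall c c', (c < d)%N -> (c' < d)%N -> qmem s' 4 (c * d + c')%N =
        qmem s 4 (c * d + c')%N - 3 * u c * u c' / (1 + 3 * \sum_(c < d) u c * V c),
      forall r c, (c < d)%N -> qmem s' 3 (r * d + c)%N =
        if r == v then 2 * qmem s 3 (r * d + c)%N else qmem s 3 (r * d + c)%N,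
      forall c, (c < d)%N -> qmem s' 5 c = 0,
      forall r, (r < N)%N -> nmem s' 4 r = 0%N &
      (forall r, qmem s' 7 r = if r == v then 2 * qmem s 7 r else qmem s 7 r) /\
      nmem s' 2 13 = if 2 * qmem s 7 v <= qmem s 2 2 then nmem s 2 13 else 1%N]).
Proof.
move=> ds v u V vN; have [sN sd] := ds; eapply run_time; first eapply run_seq.
  apply: run_weaken (leqnn _) _.
    eapply (run_sum (b := d) (f := fun c => u c * V c)).
    + by move=> s' F /=; rewrite F.1.
    + by move=> c s2 cd F2 s2c /=; rewrite s2c !F2.1 // !F2.2 // sd.
  set beta := \sum_(i < d) _ => s1 F1 H1 _; eapply run_seq.
  pose f j := qmem s 4 j - 3 * u (j %/ d)%N * u (j %% d)%N / (1 + 3 * beta).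
  apply: run_weaken (leqnn _) _.
    eapply (run_for (b := d) (I := fun i s' => forall j,
      qmem s' 4 j = filled f (qmem s 4) 0 (i * d) j)) => //.
    + by move=> s' F /=; rewrite F.1 // F1.1.
    + by move=> j /=; rewrite mul0n filled0 F1.2.
    move=> i s' id F si Is; apply: run_weaken (leqnn _) _.
      eapply (run_fill (b := d) (lo := (i * d)%N) (f := f)).
      + by move=> s2 F2 /=; rewrite F2.1 // F.1 // F1.1.
      move=> c s2 cd F2 s2c Is2 /=.
      rewrite s2c (F2.1 2%N 10) // si (F2.1 2%N 1%N) // F.1 // F1.1 // sd; split=> //.
      rewrite Is2 /filled ltnn andbF Is /filled (F2.2 2%N 1%N) // (F.2 2%N 1%N) // H1.
      rewrite !(F2.2 6%N) // !(F.2 6%N) // !(F1.2 6%N) // /f index_div // index_mod //.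
      by rewrite ltnNge leq_addr andbF.
    move=> s2 F2 H2 j /=; rewrite H2 /filled Is /filled /= mulSn [(d + _)%N]addnC.
    by case: (ltnP j (i * d)) => // ji; rewrite ltn_addr.
  move=> s2 F2 H2 _; eapply run_seq.
  pose g j := 2 * qmem s 3 j.
  apply: run_weaken (leqnn _) _.
    eapply (run_fill (b := d) (lo := (v * d)%N) (f := g)).
    + by move=> s' F /=; rewrite F.1 // F2.1 // F1.1.
    move=> i s' id F si Is /=; rewrite si !F.1 // !F2.1 // !F1.1 // sd -/v; split=> //.
    rewrite Is /filled ltnn andbF /g F2.2 // F1.2 //.
  move=> s3 F3 H3 _; eapply run_seq; apply: run_weaken (leqnn _) _.
    eapply (run_fill (b := d) (lo := 0) (f := fun=> 0)).
    + by move=> s' F /=; rewrite F.1 // F3.1 // F2.1 // F1.1.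
    + by move=> i s' id F si Is /=; rewrite si.
  move=> s4 F4 H4 _; eapply run_seq; apply: run_qset => F5; eapply run_seq.
  apply: run_weaken (leqnn _) _.
    eapply (run_nfill (b := N) (lo := 0) (f := fun=> 0%N)) => //.
    by move=> s' F /=; rewrite F.1 //= F4.1 // F3.1 // F2.1 // F1.1.
  move=> s6 F6 H6 _.
  have v6 : nmem s6 2 12 = v by rewrite F6.1 //= F4.1 // F3.1 // F2.1 // F1.1.
  have v4 : nmem s4 2 12 = v by rewrite F4.1 // F3.1 // F2.1 // F1.1.
  have q7 r : qmem s6 7 r = if r == v then 2 * qmem s 7 r else qmem s 7 r.
    rewrite F6.2 //= /upd /= v4 !F4.2 // !F3.2 // !F2.2 // !F1.2 //.
    by case: eqP => // ->.
  have K6 : qmem s6 2 2 = qmem s 2 2.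
    by rewrite F6.2 //= /upd /= F4.2 // F3.2 // F2.2 // F1.2.
  (* Both branches of the final test end in a state that differs from [s6] at most in the stopping
     flag. *)
  have post s7 : frame (NSet 2 (NConst 13) (NConst 1)) s6 s7 ->
    nmem s7 2 13 = (if 2 * qmem s 7 v <= qmem s 2 2 then nmem s 2 13 else 1%N) ->
    [/\ forall c c', (c < d)%N -> (c' < d)%N -> qmem s7 4 (c * d + c')%N =
        qmem s 4 (c * d + c')%N - 3 * u c * u c' / (1 + 3 * beta),
      forall r c, (c < d)%N -> qmem s7 3 (r * d + c)%N =
        if r == v then 2 * qmem s 3 (r * d + c)%N else qmem s 3 (r * d + c)%N,
      forall c, (c < d)%N -> qmem s7 5 c = 0,
      forall r, (r < N)%N -> nmem s7 4 r = 0%N &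
      (forall r, qmem s7 7 r = if r == v then 2 * qmem s 7 r else qmem s 7 r) /\
      nmem s7 2 13 = if 2 * qmem s 7 v <= qmem s 2 2 then nmem s 2 13 else 1%N].
    move=> F7 H7; split=> [c c' cd c'd|r c cd|c cd|r rN|].
    - rewrite F7.2 // F6.2 //= /upd /= F4.2 // F3.2 // H2 /filled /= index_lt //.
      by rewrite /f index_div // index_mod.
    - rewrite F7.2 // F6.2 //= /upd /= F4.2 // H3 /filled F2.2 // F1.2 // /g.
      case: (eqVneq r v) => [->|rv]; first by rewrite leq_addr ltn_add2l cd.
      case: ifP => // /andP[h1 h2]; case/eqP: rv; nia.
    - by rewrite F7.2 // F6.2 //= /upd /= H4 /filled /= cd.
    - by rewrite F7.1 // H6 /filled /= rN.
    - by split=> // r; rewrite F7.2.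
  eapply run_if => /=; rewrite v6 q7 eqxx K6 => H.
    apply: run_skip; apply: post; first exact: frame_refl.
    by rewrite H F6.1 //= F4.1 // F3.1 // F2.1 // F1.1.
  apply: run_nset; apply: post => /=; last by rewrite (negbTE H).
  by apply: exec_frame; constructor.
rewrite /sum_time /for_time /=; nia.
Qed.

Variables (M : nat -> nat -> rat) (K : rat) (kappa : nat).
Hypothesis K1 : 1 <= K.
Hypothesis Kkappa : K <= 2 ^+ kappa.
Hypothesis rows_le1 : forall r, (r < N)%N -> dot d (M r) (M r) <= 1.

Definition solver_state (s : state) (e : nat -> nat) : Prop :=
  [/\ dims s /\ qmem s 2 2 = K,
      forall r c, (r < N)%N -> (c < d)%N -> qmem s 3 (r * d + c)%N = scaled M e r c,
      forall r, (r < N)%N -> qmem s 7 r = 2 ^+ e r,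
      forall r, (r < N)%N -> 2 ^+ e r <= K &
      solver_inv N d M K (fun c c' => qmem s 4 (c * d + c')%N) (qmem s 5) (nmem s 4) e].

Definition solver_answer (s : state) : Prop :=
  (nmem s 2 14 = 1%N /\ exists w, forall r, (r < N)%N -> 0 < dot d (M r) w) \/
  (nmem s 2 14 = 0%N /\ forall x, ~ witness N d M K x).

(** A lexicographic measure: a rescaling clears the counters, whose sum is at most [N * tau N], and
    in return raises the sum of the exponents by one. *)
Definition progress (e y : nat -> nat) : nat :=
  ((\sum_(r < N) e r) * (N * tau N).+1 + \sum_(r < N) y r)%N.

Lemma sum_incr (y : nat -> nat) k : (k < N)%N ->
  (\sum_(r < N) incr y k r = (\sum_(r < N) y r).+1)%N.
Proof.
move=> kN; rewrite (bigD1 (Ordinal kN)) //= [in RHS](bigD1 (Ordinal kN)) //=.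
rewrite /incr eqxx addSn; congr (_ + _).+1; apply: eq_bigr => r rk.
by case: eqP => // E; case/eqP: rk; exact: val_inj.
Qed.

Lemma sum_le (y : nat -> nat) b :
  (forall r, (r < N)%N -> (y r <= b)%N) -> (\sum_(r < N) y r <= N * b)%N.
Proof.
move=> yb; rewrite -[X in (_ <= X * _)%N](card_ord N) -sum_nat_const.
by apply: leq_sum => r _; apply: yb.
Qed.

(** Scales are powers of 2 bounded by [K <= 2 ^ kappa], so exponents are at most [kappa]. This makes
    the number of iterations polynomial in the number of bits of [K]. *)
Lemma progress_le s e : solver_state s e ->
  (progress e (nmem s 4) <= N * kappa * (N * tau N).+1 + N * tau N)%N.
Proof.
move=> [_ _ _ eK [_ _ _ Iy _]]; rewrite /progress leq_add //.
  rewrite leq_mul2r /=; apply: sum_le => r rN.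
  by rewrite -(ler_eXn2l (x := (2 : rat))) // (le_trans (eK r rN)).
by apply: sum_le => r rN; apply: ltnW; apply: Iy.
Qed.

Lemma run_solver_body s e :
  solver_state s e -> nmem s 2 13 = 0%N -> nmem s 2 14 = 0%N ->
  run solver_body s (400 * N.+1 * d.+1 * d.+1)
    (fun s' => (nmem s' 2 13 = 1%N /\ solver_answer s') \/
       [/\ nmem s' 2 13 = 0%N, nmem s' 2 14 = 0%N & exists2 e', solver_state s' e' &
           (progress e (nmem s 4) < progress e' (nmem s' 4))%N]).
Proof.
move=> [[ds sK] sV sE eK I] done0 res0; have K0 : 0 < K by apply: lt_le_trans K1.
eapply run_time; first eapply run_seq.
  apply: run_weaken (run_find ds) (leqnn _) _ => s1 F1 H1 _.
  have [sN sd] := ds.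
  have ds1 : dims s1 by apply: frame_dims F1 ds.
  have valE r : (r < N)%N ->
      \sum_(c < d) qmem s 3 (r * d + c)%N * qmem s 5 c = dot d (scaled M e r) (qmem s 5).
    by move=> rN; apply: eq_bigr => c _; rewrite sV.
  have s1N : nmem s1 2 0 = N by case: ds1.
  eapply run_if => /=; rewrite s1N => Hv.
    have {H1} [[v1 pos]|[]] := H1; last by move=> vN _; rewrite leqNgt vN in Hv.
    eapply run_seq; apply: run_nset => _; apply: run_nset; left; split=> //.
    left; split=> //; exists (qmem s 5) => r rN.
    have := pos r rN; rewrite valE // dotZl pmulr_rgt0 ?exprn_gt0 //.
  have {H1} [[v1 pos]|[vN vle]] := H1; first by rewrite v1 leqnn in Hv.
  move: vN vle; set v := nmem s1 2 12 => vN; rewrite valE // => vle.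
  have [U1 U2 U3] := solver_step rows_le1 I vN vle.
  have UR := solver_rescale K0 rows_le1 I vN vle.
  move: U1 U2 U3 UR.
  set y' := incr (nmem s 4) v; set w' := fun c => _ => U1 U2 U3 UR.
  eapply run_seq; apply: run_weaken (run_update ds1) (leqnn _) _.
  move=> s2 F2 [u2 w2 y2] _.
  have F12 a i : ~~ nwrites find_violated a i -> ~~ nwrites perceptron_update a i ->
      nmem s2 a i = nmem s a i by move=> n1 n2; rewrite F2.1 // F1.1.
  have G12 a i : ~~ qwrites find_violated a i -> ~~ qwrites perceptron_update a i ->
      qmem s2 a i = qmem s a i by move=> n1 n2; rewrite F2.2 // F1.2.
  have v2 : nmem s2 2 12 = v by rewrite F2.1.
  have ds2 : dims s2 by apply: frame_dims F2 ds1.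
  have uE c : (c < d)%N -> qmem s2 6 c =
      dot d (fun c' => qmem s 4 (c * d + c')%N) (scaled M e v).
    by move=> cd; rewrite u2 //; apply: eq_bigr => c' _; rewrite !F1.2 // sV.
  have wE c : (c < d)%N -> qmem s2 5 c = w' c.
    move=> cd; rewrite w2 // F1.2 // /w'; congr (_ + _).
    by apply: eq_bigr => c' _; rewrite !F1.2 // sV.
  have yE r : nmem s2 4 r = y' r by rewrite y2 /y' /incr (F1.1 4%N r).
  have s2N : nmem s2 2 0 = N by case: ds2.
  eapply run_if => /=; rewrite v2 yE s2N addn1 -/(tau N) => yk.
    have v2N : (nmem s2 2 12 < N)%N by rewrite v2.
    apply: run_weaken (run_rescale ds2 v2N) (leqnn _) _ => s3 F3.
    rewrite v2 => -[R4 R3 R5 Ry [R7 R13]].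
    have F13 a i : ~~ nwrites find_violated a i -> ~~ nwrites perceptron_update a i ->
      ~~ nwrites rescale a i -> nmem s3 a i = nmem s a i.
      by move=> n1 n2 n3; rewrite F3.1 // F12.
    have G13 a i : ~~ qwrites find_violated a i -> ~~ qwrites perceptron_update a i ->
      ~~ qwrites rescale a i -> qmem s3 a i = qmem s a i.
      by move=> n1 n2 n3; rewrite F3.2 // G12.
    have I3 : solver_inv N d M K (fun c c' => qmem s3 4 (c * d + c')%N)
        (qmem s3 5) (nmem s3 4) (incr e v).
      apply: eq_solver_inv (UR yk) => //.
      move=> c c' cd c'd; rewrite R4 // G12 // !uE //; congr (_ - _ / (1 + 3 * _)).
      by apply: eq_bigr => c2 _; rewrite uE // G12 // sV.
    have e3 r : (r < N)%N -> qmem s3 7 r = 2 ^+ incr e v r.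
      move=> rN; rewrite R7 G12 // sE // /incr.
      by case: eqP => // _; rewrite exprS.
    have K2 : qmem s2 2 2 = K by rewrite G12.
    have q2 : qmem s2 7 v = 2 ^+ e v by rewrite G12 // sE.
    (* Either all scales are still at most [K] and the loop goes on, or the doubled scale exceeds
       [K] and [solver_no] excludes every witness. *)
    move: R13; rewrite K2 q2 F12 // done0 -exprS; case: ifP => [le13|gt13] R13.
      right; split=> //; first by rewrite F13.
      exists (incr e v).
        split=> //.
        - split; last by rewrite G13.
          by apply: frame_dims F3 ds2.
        - move=> r c rN cd; rewrite R3 // G12 // sV // /scaled /incr.
          by case: eqP => [->|//]; rewrite exprS mulrA.
        - move=> r rN; rewrite /incr; case: eqP => [->|_] //; exact: eK.
      have y0 : (\sum_(r < N) nmem s3 4 r = 0)%N by apply: big1 => r _; exact: Ry.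
      rewrite /progress sum_incr // y0 addn0 mulSn addnC ltn_add2r ltnS; apply: sum_le => r rN.
      by case: I => _ _ _ Iy _; apply: ltnW; apply: Iy.
    left; split=> //; right; split; first by rewrite F13.
    apply: (solver_no K0 I3 vN).
    by rewrite ltNge /incr eqxx gt13.
  rewrite -ltnNge in yk; apply: run_skip; right.
  split; [by rewrite F12|by rewrite F12|exists e].
    split=> //.
    - by split=> //; rewrite G12.
    - by move=> r c rN cd; rewrite G12 // sV.
    - by move=> r rN; rewrite G12 // sE.
    apply: eq_solver_inv (U3 yk) => // c c' cd c'd; by rewrite G12.
  have y1 : (\sum_(r < N) nmem s2 4 r = (\sum_(r < N) nmem s 4 r).+1)%N.
    by rewrite -(sum_incr _ vN); apply: eq_bigr => r _; rewrite yE.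
  by rewrite /progress ltn_add2l y1.
rewrite /sum_time /for_time /=; nia.
Qed.

Definition solver_time (kappa : nat) : nat :=
  (1000 * N.+1 * d.+1 * d.+1 * (N * kappa * (N * tau N).+1 + N * tau N).+2)%N.

Lemma run_solver s :
  dims s -> qmem s 2 2 = K ->
  (forall r c, (r < N)%N -> (c < d)%N -> qmem s 3 (r * d + c)%N = M r c) ->
  run solver s (solver_time kappa) solver_answer.
Proof.
move=> ds sK sM; have [sN sd] := ds.
pose B := (N * kappa * (N * tau N).+1 + N * tau N)%N.
eapply run_time; first eapply run_seq.
  eapply run_weaken; [|exact: leqnn|].
  eapply (@run_seq _ _ _ _ _ (fun s' => solver_state s' (fun=> 0%N) /\
     nmem s' 2 13 = 0%N /\ nmem s' 2 14 = 0%N)).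
    apply: run_weaken (leqnn _) _.
    eapply (run_nfill (b := N) (lo := 0) (f := fun=> 0%N)) => //.
      by move=> s' F /=; rewrite F.1.
    move=> s1 F1 H1 _; eapply run_seq; apply: run_weaken (leqnn _) _.
    eapply (run_fill (b := N) (lo := 0) (f := fun=> 1)) => //.
      by move=> s' F /=; rewrite F.1 // F1.1.
    move=> s2 F2 H2 _; eapply run_seq; apply: run_weaken (leqnn _) _.
    eapply (run_fill (b := d) (lo := 0) (f := fun=> 0)) => //.
      by move=> s' F /=; rewrite F.1 // F2.1 // F1.1.
    move=> s3 F3 H3 _; eapply run_seq.
    pose f j : rat := ((j %/ d)%N == (j %% d)%N)%:R.
    apply: run_weaken (leqnn _) _.
    eapply (run_for (b := d) (I := fun i s' => forall j,
      qmem s' 4 j = filled f (qmem s 4) 0 (i * d) j)) => //.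
    + by move=> s' F /=; rewrite F.1 // F3.1 // F2.1 // F1.1.
    + by move=> j /=; rewrite mul0n filled0 F3.2 // F2.2 // F1.2.
    move=> i s' id F si Is; apply: run_weaken (leqnn _) _.
      eapply (run_fill (b := d) (lo := (i * d)%N) (f := f)).
      + by move=> s4 F4 /=; rewrite F4.1 // F.1 // F3.1 // F2.1 // F1.1.
      move=> c s4 cd F4 s2c Is2.
      rewrite qeval_ind /=.
      rewrite s2c (F4.1 2%N 10) // si (F4.1 2%N 1%N) // F.1 // F3.1 // F2.1 // F1.1 // sd.
      by split=> //; rewrite /f index_div // index_mod.
    move=> s4 F4 H4 j /=; rewrite H4 /filled Is /filled /= mulSn [(d + _)%N]addnC.
    by case: (ltnP j (i * d)) => // ji; rewrite ltn_addr.
    move=> s4 F4 H4 _; eapply run_seq; apply: run_nset => _; apply: run_nset.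
    split=> //; split=> //.
    - split=> /=; last by rewrite /= F4.2 // F3.2 // F2.2 // F1.2.
      by split; rewrite /= /upd /= F4.1 // F3.1 // F2.1 // F1.1.
    - move=> r c rN cd; rewrite /= F4.2 // F3.2 // F2.2 // F1.2 // sM //.
      by rewrite /scaled mul1r.
    - by move=> r rN; rewrite /= F4.2 // F3.2 // H2 /filled /= rN.
    - have K0 : 0 < K by apply: lt_le_trans K1.
      apply: eq_solver_inv (solver_init K rows_le1) => /=.
      + by move=> c c' cd c'd; rewrite H4 /filled /= index_lt // /f index_div // index_mod.
      + by move=> c cd; rewrite F4.2 // H3 /filled /= cd.
      + by move=> r rN; rewrite /upd /= F4.1 // F3.1 // F2.1 // H1 /filled /= rN.
  move=> s1 F1 [S1 [d1 r1]] _.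
  apply: run_weaken (leqnn _) _.
    (* The fuel [k] and the progress together exceed the bound [B] of [progress_le], so the fuel
       lasts until the flag is raised. *)
    eapply (@run_while _ _ _ _ B.+1 (fun k s' => (nmem s' 2 13 = 1%N /\ solver_answer s') \/
      [/\ nmem s' 2 13 = 0%N, nmem s' 2 14 = 0%N & exists2 e, solver_state s' e &
       (B < k + progress e (nmem s' 4))%N])).
    + right; split=> //; exists (fun=> 0%N) => //.
      by rewrite leq_addr.
    + move=> k s' _ [[d2 _] /=|[d2 r2 [e Se kB]] _]; first by rewrite d2.
      apply: run_weaken (run_solver_body Se d2 r2) (leqnn _) _ => s2 F2.
      have k0 : (0 < k)%N.
        by have := progress_le Se; rewrite -/B; lia.
      case=> [H|[d3 r3 [e' Se' lt]]]; first by exists 0%N => //; left.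
      exists k.-1; first by lia.
      right; split=> //; exists e' => //; lia.
  move=> s2 F2 [/= + [k [[d2 //]|[d2 _ _]]]]; by rewrite d2.
rewrite /solver_time -/B /sum_time /for_time /=; clearbody B.
have X1 : (0 < N.+1 * d.+1 * d.+1)%N by [].
apply: (@leq_trans (300 * (N.+1 * d.+1 * d.+1) + (B.+1 * (400 * (N.+1 * d.+1 * d.+1) + 5) + 5))).
  apply: leq_add; first by nia.
  by rewrite leq_add2r leq_mul2l /=; nia.
rewrite -!(mulnA 1000); move: (N.+1 * _ * _)%N X1 => X; nia.
Qed.


End SolverCorrect.

(** * Writing the linear program into memory *)

Definition nE : nexp := NGet 0 (NConst 0).
Definition mE : nexp := NGet 0 (NConst 1).
Definition entE (k i j : nexp) : nexp := NAdd (NMul (NAdd (NMul k mE) i) mE) j.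
Definition modE (k i j : nexp) : qexp := QDiv (QGet 0 (entE k i j)) (QGet 1 (entE k i j)).
Definition kindE (k i j : nexp) : nexp := NGet 1 (entE k i j).

Definition notE (e : nexp) : nexp := NSub (NConst 1) e.
(** The difference is positive exactly if [e1 < e2]; negating it twice normalizes it to 0 or 1. *)
Definition ltE (e1 e2 : nexp) : nexp := notE (notE (NSub e2 e1)).
Definition polE (e : nexp) : nexp := NGet 3 e.

Definition negE : nexp := ind (kindE (sc 15) (sc 16) (sc 17)) (NConst 2).
Definition posE : nexp :=
  NMul (ind (kindE (sc 18) (sc 16) (sc 16)) (NConst 1))
       (ind (kindE (sc 19) (sc 17) (sc 17)) (NConst 1)).
Definition mode0E : nexp := ind (sc 2) (NConst 0).
Definition selE : nexp :=
  NAdd (NMul mode0E (NMul (ind (polE (sc 16)) (sc 18)) (ind (polE (sc 17)) (sc 19))))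
       (NMul (notE mode0E)
          (NMul (ind (polE (NMul (NConst 2) (sc 15))) (sc 16))
                (ind (polE (NAdd (NMul (NConst 2) (sc 15)) (NConst 1))) (sc 17)))).
Definition realE : nexp := NMul (ltE (sc 15) nE) (NMul selE (NMul negE posE)).
Definition zeroE : nexp :=
  NMul (ltE (sc 15) nE) (NMul selE
    (NAdd (NMul mode0E (NMul negE (notE posE))) (NMul (notE mode0E) (notE negE)))).

Definition payE : qexp :=
  QSub (QDiv (QAdd (modE (sc 18) (sc 16) (sc 16)) (modE (sc 19) (sc 17) (sc 17))) (QConst 2))
       (modE (sc 15) (sc 16) (sc 17)).
Definition codelE : qexp := QSub (QConst 1) (qsc 6).
Definition ccE : qexp := QAdd (QMul codelE payE) (qsc 5).
Definition indQ (e : nexp) : qexp := QOfNat (ind (sc 24) e).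
Definition rowE : qexp :=
  QMul (QDiv (qsc 7) (QAdd (QConst 16) (QMul ccE ccE)))
    (QAdd (QSub (QAdd (QMul (QDiv codelE (QConst 2)) (QAdd (indQ (sc 18)) (indQ (sc 19))))
                      (QMul (qsc 6) (indQ (sc 8))))
                (indQ (sc 15)))
          (QMul ccE (indQ nE))).
(** The case distinction of [lp_coef] is made by multiplying with 0-1 indicators, since expressions
    have no conditional. *)
Definition coefE : qexp :=
  QAdd (QMul (QOfNat realE) rowE)
       (QMul (QOfNat (NMul (notE realE) (notE zeroE))) (indQ nE)).

Definition encodeE : nexp :=
  NAdd (NMul (NAdd (NMul (NAdd (NMul (NAdd (NMul (sc 15) mE) (sc 16)) mE) (sc 17)) nE)
    (sc 18)) nE) (sc 19).

Definition nS : nexp := NAdd nE (NConst 1).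

Definition fill_row : cmd :=
  For 24 nS (QSet 3 (NAdd (NMul encodeE nS) (sc 24)) coefE).

Definition build : cmd :=
  For 15 nS (For 16 mE (For 17 mE (For 18 nE (For 19 nE fill_row)))).

(** Suited to nested loops that write an array from left to right: each level extends the correct
    prefix by its own block width [step]. *)
Lemma run_upto v e body s b T a (g : nat -> rat) base step :
  ~~ nwrites body 2 v ->
  (forall s', frame (For v e body) s s' -> neval s' e = b) ->
  (forall j, (j < base)%N -> qmem s a j = g j) ->
  (forall i s', (i < b)%N -> frame (For v e body) s s' -> nmem s' 2 v = i ->
     (forall j, (j < base + i * step)%N -> qmem s' a j = g j) ->
     run body s' T (fun s2 => forall j, (j < base + i * step + step)%N -> qmem s2 a j = g j)) ->
  run (For v e body) s (for_time b T (ncost e))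
    (fun s' => forall j, (j < base + b * step)%N -> qmem s' a j = g j).
Proof.
move=> wv eb H0 step'.
apply: (run_for (I := fun i s' => forall j, (j < base + i * step)%N -> qmem s' a j = g j)) => //.
  by move=> j; rewrite mul0n addn0; apply: H0.
move=> i s' ib F vi Is; apply: run_weaken (step' i s' ib F vi Is) (leqnn _) _.
by move=> s2 _ H j; rewrite mulSn [(step + _)%N]addnC addnA; apply: H.
Qed.

Lemma natb_not (b : bool) : (1 - b = ~~ b)%N. Proof. by case: b. Qed.

Section Build.
Variables (m n : nat) (Q : 'I_n -> 'M[strop rat]_m).

Definition env (s : state) : Prop :=
  [/\ nmem s 0 0 = n, nmem s 0 1 = m, forall p, nmem s 1 p = kind (entry_at Q p),
      forall p, qmem s 0 p = (numq (modulus (entry_at Q p)))%:~R &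
      forall p, qmem s 1 p = (denq (modulus (entry_at Q p)))%:~R].

Lemma frame_env c s s' :
  ~~ nwrites c 0 0 -> ~~ nwrites c 0 1 -> (forall p, ~~ nwrites c 1 p) ->
  (forall p, ~~ qwrites c 0 p) -> (forall p, ~~ qwrites c 1 p) ->
  frame c s s' -> env s -> env s'.
Proof.
move=> w0 w1 w2 w3 w4 F [e0 e1 e2 e3 e4].
by split; [rewrite F.1|rewrite F.1|move=> p; rewrite F.1|move=> p; rewrite F.2
          |move=> p; rewrite F.2].
Qed.

Lemma neval_lt s e1 e2 : neval s (ltE e1 e2) = (neval s e1 < neval s e2)%N.
Proof. by rewrite /=; case: ltnP => /=; lia. Qed.

Lemma neval_ent s k i j : env s ->
  neval s (entE k i j) = ((neval s k * m + neval s i) * m + neval s j)%N.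
Proof. by move=> [_ sm _ _ _]; rewrite /= sm. Qed.

Lemma neval_kind s k i j : env s ->
  neval s (kindE k i j) = kind (ent Q (neval s k) (neval s i) (neval s j)).
Proof.
move=> sE; have -> : neval s (kindE k i j) = nmem s 1 (neval s (entE k i j)) by [].
by rewrite (neval_ent k i j sE); case: sE => _ _ -> _ _.
Qed.

Lemma qeval_mod s k i j : env s ->
  qeval s (modE k i j) = modulus (ent Q (neval s k) (neval s i) (neval s j)).
Proof.
move=> sE; have -> : qeval s (modE k i j) =
  qmem s 0 (neval s (entE k i j)) / qmem s 1 (neval s (entE k i j)) by [].
by rewrite (neval_ent k i j sE); case: sE => _ _ _ -> ->; rewrite divq_num_den.
Qed.

Section Coef.
Variables (s : state) (k i j l l' c : nat).
Hypothesis sE : env s.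
Hypotheses (sk : nmem s 2 15 = k) (si : nmem s 2 16 = i) (sj : nmem s 2 17 = j)
  (sl : nmem s 2 18 = l) (sl' : nmem s 2 19 = l') (s_c : nmem s 2 24 = c).
Let pol := nmem s 3.
Let mode := nmem s 2 2.

Lemma neval_sc v : neval s (sc v) = nmem s 2 v. Proof. by []. Qed.

Lemma neval_neg : neval s negE = neg_at Q k i j.
Proof. by rewrite /negE neval_ind neval_kind // !neval_sc sk si sj. Qed.

Lemma neval_pos : neval s posE = pos_at Q l i && pos_at Q l' j.
Proof.
rewrite -mulnb /pos_at -sl -sl' -si -sj.
have -> : neval s posE = (neval s (ind (kindE (sc 18) (sc 16) (sc 16)) (NConst 1)) *
  neval s (ind (kindE (sc 19) (sc 17) (sc 17)) (NConst 1)))%N by [].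
by rewrite !neval_ind !neval_kind.
Qed.

Lemma neval_mode0 : neval s mode0E = (mode == 0%N).
Proof. by rewrite /mode0E neval_ind. Qed.

Lemma neval_sel : neval s selE = selected mode pol k i j l l'.
Proof.
have -> : neval s selE = (neval s mode0E *
   (neval s (ind (polE (sc 16)) (sc 18)) * neval s (ind (polE (sc 17)) (sc 19))) +
   (1 - neval s mode0E) *
   (neval s (ind (polE (NMul (NConst 2) (sc 15))) (sc 16)) *
    neval s (ind (polE (NAdd (NMul (NConst 2) (sc 15)) (NConst 1))) (sc 17))))%N by [].
rewrite neval_mode0 natb_not !neval_ind /= sk si sj sl sl' /selected -/pol.
by case: (mode == 0%N); rewrite ?mul1n ?mul0n ?addn0 ?add0n mulnb.
Qed.

Lemma neval_real : neval s realE = real_at Q mode pol k i j l l'.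
Proof.
have -> : neval s realE = (neval s (ltE (sc 15) nE) * (neval s selE *
  (neval s negE * neval s posE)))%N by [].
have [sn _ _ _ _] := sE.
rewrite neval_lt neval_sel neval_neg neval_pos !mulnb /real_at.
by rewrite neval_sc sk [neval s nE]/= sn.
Qed.

Lemma neval_zero : neval s zeroE = zero_at Q mode pol k i j l l'.
Proof.
have -> : neval s zeroE = (neval s (ltE (sc 15) nE) * (neval s selE *
  (neval s mode0E * (neval s negE * (1 - neval s posE)) +
   (1 - neval s mode0E) * (1 - neval s negE))))%N by [].
have [sn _ _ _ _] := sE.
rewrite neval_lt neval_sel neval_neg neval_pos neval_mode0 !natb_not /zero_at.
rewrite neval_sc sk [neval s nE]/= sn.
by case: (mode == 0%N); rewrite ?mul1n ?mul0n ?addn0 ?add0n !mulnb.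
Qed.

Lemma qeval_pay : qeval s payE = pay_at Q k i j l l'.
Proof.
have -> : qeval s payE = (qeval s (modE (sc 18) (sc 16) (sc 16)) +
  qeval s (modE (sc 19) (sc 17) (sc 17))) / 2 - qeval s (modE (sc 15) (sc 16) (sc 17)) by [].
by rewrite !qeval_mod // !neval_sc sk si sj sl sl'.
Qed.

Lemma qeval_coef : qeval s coefE =
  lp_coef Q mode pol (qmem s 2 7) (qmem s 2 6) (qmem s 2 5) (nmem s 2 8) k i j l l' c.
Proof.
have ccQ : qeval s ccE = (1 - qmem s 2 6) * qeval s payE + qmem s 2 5 by [].
have indE e : qeval s (indQ e) = (c == neval s e)%:R.
  by rewrite /indQ qeval_ind neval_sc s_c.
have [sn _ _ _ _] := sE; have nn : neval s nE = n by [].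
have rowQ : qeval s rowE = qmem s 2 7 / (16 + qeval s ccE * qeval s ccE) *
  ((1 - qmem s 2 6) / 2 * (qeval s (indQ (sc 18)) + qeval s (indQ (sc 19)))
   + qmem s 2 6 * qeval s (indQ (sc 8)) - qeval s (indQ (sc 15))
   + qeval s ccE * qeval s (indQ nE)) by [].
have -> : qeval s coefE = (neval s realE)%:R * qeval s rowE +
  ((1 - neval s realE) * (1 - neval s zeroE))%N%:R * qeval s (indQ nE) by [].
rewrite rowQ !indE !neval_sc sk sl sl' nn ccQ qeval_pay neval_real neval_zero !natb_not.
rewrite mulnb /lp_coef /row_vec.
case: (real_at _ _ _ _ _ _ _ _); first by rewrite mul1r mul0r addr0.
by case: (zero_at _ _ _ _ _ _ _ _); rewrite ?mul1r ?mul0r ?add0r.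
Qed.

End Coef.

Definition build_time : nat :=
  for_time n.+1 (for_time m (for_time m (for_time n (for_time n
    (for_time n.+1 (ncost (NAdd (NMul encodeE nS) (sc 24)) + qcost coefE).+1 (ncost nS))
    (ncost nE)) (ncost nE)) (ncost mE)) (ncost mE)) (ncost nS).

Lemma run_build s : env s ->
  run build s build_time (fun s' =>
    forall r c, (r < nrows m n)%N -> (c < n.+1)%N -> qmem s' 3 (r * n.+1 + c)%N =
      lp_row Q (nmem s 2 2) (nmem s 3) (qmem s 2 7) (qmem s 2 6) (qmem s 2 5) (nmem s 2 8) r c).
Proof.
move=> sE.
pose g j := lp_row Q (nmem s 2 2) (nmem s 3) (qmem s 2 7) (qmem s 2 6) (qmem s 2 5)
  (nmem s 2 8) (j %/ n.+1) (j %% n.+1).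
have benv s' : frame build s s' -> env s'.
  by move=> F; apply: (@frame_env build s s').
have bn s' : frame build s s' -> neval s' nE = n by move=> /benv[].
have bm s' : frame build s s' -> neval s' mE = m by move=> /benv[].
have bS s' : frame build s s' -> neval s' nS = n.+1.
  by move=> F; have := bn s' F; rewrite /= addn1 => ->.
have sub c s1 s2 : (forall a i, nwrites c a i -> nwrites build a i) ->
    (forall a i, qwrites c a i -> qwrites build a i) ->
    frame build s s1 -> frame c s1 s2 -> frame build s s2.
  by move=> h1 h2 F1 F2; apply: frame_trans F1 (frame_sub h1 h2 F2).
pose w4 := (n * n.+1)%N; pose w3 := (n * w4)%N; pose w2 := (m * w3)%N; pose w1 := (m * w2)%N.
apply: (@run_weaken _ _ build_time _ (fun s' => forall j, (j < 0 + n.+1 * w1)%N -> qmem s' 3 j = g j));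
  [|exact: leqnn|]; last first.
  move=> s' F H r c rN cn; rewrite H.
    by rewrite /g index_div // index_mod.
  rewrite add0n /w1 /w2 /w3 /w4 !mulnA; exact: index_lt.
apply: run_upto => // k s1 kn F1 s1k I1.
have G1 s' : frame (For 16 mE (For 17 mE (For 18 nE (For 19 nE fill_row)))) s1 s' ->
  frame build s s' by apply: sub => //= a i ->; rewrite /= ?orbT.
apply: run_upto => //; first by move=> s' /G1/bm.
move=> i s2 im F2 s2i I2.
have G2 s' : frame (For 17 mE (For 18 nE (For 19 nE fill_row))) s2 s' ->
  frame build s s' by apply: sub (G1 _ F2) => //= a i' ->; rewrite /= ?orbT.
apply: run_upto => //; first by move=> s' /G2/bm.
move=> j s3 jm F3 s3j I3.
have G3 s' : frame (For 18 nE (For 19 nE fill_row)) s3 s' ->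
  frame build s s' by apply: sub (G2 _ F3) => //= a i' ->; rewrite /= ?orbT.
apply: run_upto => //; first by move=> s' /G3/bn.
move=> l s4 ln F4 s4l I4.
have G4 s' : frame (For 19 nE fill_row) s4 s' ->
  frame build s s' by apply: sub (G3 _ F4) => //= a i' ->; rewrite /= ?orbT.
apply: run_upto => //; first by move=> s' /G4/bn.
move=> l' s5 l'n F5 s5l I5.
have G5 s' : frame fill_row s5 s' ->
  frame build s s' by apply: sub (G4 _ F5) => //= a i' ->; rewrite /= ?orbT.
have E : (0 + k * w1 + i * w2 + j * w3 + l * w4 + l' * n.+1 = encode m n k i j l l' * n.+1)%N.
  by rewrite /w1 /w2 /w3 /w4 /encode; ring.
apply: (@run_weaken _ _ _ _ (fun s' => forall j0, qmem s' 3 j0 =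
   filled g (qmem s5 3) (encode m n k i j l l' * n.+1) (encode m n k i j l l' * n.+1 + n.+1) j0));
  [|exact: leqnn|]; last first.
  move=> s' _ H j0; rewrite E H /filled => jlt.
  by case: (leqP (encode m n k i j l l' * n.+1) j0) => [|lt] /=; [rewrite jlt|rewrite I5 // E].
apply: run_fill; first by move=> s' /G5/bS.
move=> c s6 cn F6 s6c _.
have e6 := benv _ (G5 _ F6).
have k6 : nmem s6 2 15 = k by rewrite F6.1 // F5.1 // F4.1 // F3.1 // F2.1.
have i6 : nmem s6 2 16 = i by rewrite F6.1 // F5.1 // F4.1 // F3.1.
have j6 : nmem s6 2 17 = j by rewrite F6.1 // F5.1 // F4.1.
have l6 : nmem s6 2 18 = l by rewrite F6.1 // F5.1.
have l'6 : nmem s6 2 19 = l' by rewrite F6.1.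
have F := G5 _ F6.
split.
  have [n6 m6 _ _ _] := e6.
  by rewrite /= k6 i6 j6 l6 l'6 n6 m6 s6c addn1.
rewrite (@qeval_coef s6 k i j l l' c) // /g index_div // index_mod //.
rewrite lp_row_encode // !F.1 // !F.2 //.
rewrite /lp_coef /real_at /zero_at /selected; have pol6 p : nmem s6 3 p = nmem s 3 p by rewrite F.1.
by rewrite !pol6.
Qed.

End Build.

(** * Enumeration of the policies as numbers in a given base *)

Definition value (len base : nat) (f : nat -> nat) : nat := (\sum_(i < len) f i * base ^ i)%N.

Lemma value_lt len base f : (forall i, (i < len)%N -> (f i < base)%N) ->
  (value len base f < base ^ len)%N.
Proof.
elim: len => [|len IH] fb; first by rewrite /value big_ord0.
rewrite /value big_ord_recr /= -/(value len base f) expnS.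
have := IH (fun i il => fb i (ltnW il)); have := fb len (ltnSn len).
by move: (base ^ len)%N => B; nia.
Qed.

Lemma value_inj len base f g :
  (forall i, (i < len)%N -> (f i < base)%N) -> (forall i, (i < len)%N -> (g i < base)%N) ->
  value len base f = value len base g -> forall i, (i < len)%N -> f i = g i.
Proof.
elim: len => // len IH fb gb; rewrite /value !big_ord_recr /= -!/(value len base _).
have fl := value_lt (fun i il => fb i (ltnW il)).
have gl := value_lt (fun i il => gb i (ltnW il)) => E.
have fg : f len = g len by move: fl gl E; move: (base ^ len)%N => B; nia.
move=> i; rewrite ltnS leq_eqVlt => /orP[/eqP -> //|]; apply: IH => [||].
- by move=> j jl; apply: fb; apply: ltnW.
- by move=> j jl; apply: gb; apply: ltnW.
by move: E; rewrite fg => /addIn.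
Qed.

(** The digits below [i] drop from [base.-1] to 0, a loss of [base ^ i - 1], and digit [i] gains
    [base ^ i]. *)
Lemma value_carry len base i (f g : nat -> nat) : (0 < base)%N -> (i < len)%N ->
  (forall j, (j < i)%N -> f j = base.-1 /\ g j = 0%N) -> g i = (f i).+1 ->
  (forall j, (i < j)%N -> (j < len)%N -> g j = f j) -> value len base g = (value len base f).+1.
Proof.
move=> b0; elim: len => // len IH; rewrite ltnS leq_eqVlt => /orP[/eqP -> low gi high|il low gi high].
  have zero k : (k <= len)%N -> (value k base g = 0 /\ (value k base f).+1 = base ^ k)%N.
    elim: k => [|k IHk] kl; first by rewrite /value !big_ord0.
    have [g0 fB] := IHk (ltnW kl); have [fk gk] := low k kl.
    rewrite /value !big_ord_recr /= -!/(value k base _) g0 gk fk; split=> //.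
    by rewrite -addSn fB expnS; move: (base ^ k)%N => B; nia.
  have [g0 fB] := zero len (leqnn len).
  by rewrite /value !big_ord_recr /= -!/(value len base _) g0 gi add0n -addSn fB -mulSn.
rewrite /value !big_ord_recr /= -!/(value len base _) (IH il low gi) ?high //.
by move=> j ij jl; apply: high => //; apply: ltnW.
Qed.

Definition increment : cmd :=
  Seq (NSet 2 (NConst 23) (NConst 0))
  (Seq (While (BAnd (BNot (NLe (sc 3) (sc 23))) (NLe (sc 4) (NAdd (polE (sc 23)) (NConst 1))))
         (Seq (NSet 3 (sc 23) (NConst 0)) (NSet 2 (NConst 23) (NAdd (sc 23) (NConst 1)))))
       (NSet 3 (sc 23) (NAdd (polE (sc 23)) (NConst 1)))).

(** The conclusion is conditional because the search also increments after the last policy; the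
    carry then runs through all digits and ends in cell [len]. *)
Lemma run_increment s len base :
  nmem s 2 3 = len -> nmem s 2 4 = base ->
  run increment s (30 * len + 60)
    (fun s' => (forall i, (i < len)%N -> (nmem s 3 i < base)%N) ->
       ((value len base (nmem s 3)).+1 < base ^ len)%N ->
       (forall i, (i < len)%N -> (nmem s' 3 i < base)%N) /\
       value len base (nmem s' 3) = (value len base (nmem s 3)).+1).
Proof.
move=> slen sbase; eapply run_time; first eapply run_seq.
  apply: run_nset => F0; eapply run_seq; apply: run_weaken (leqnn _) _.
    eapply (@run_while _ _ _ _ len (fun k s' => [/\ (k + nmem s' 2 23 = len)%N,
      forall j, (j < nmem s' 2 23)%N -> (base <= nmem s 3 j + 1)%N /\ nmem s' 3 j = 0%N &
      forall j, (nmem s' 2 23 <= j)%N -> nmem s' 3 j = nmem s 3 j])).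
      by split=> //=; rewrite addn0.
    move=> k s' F [kl low high] /=; rewrite (F.1 2%N 3%N) // (F.1 2%N 4%N) //= /upd /= slen sbase -ltnNge => /andP[il ib].
    eapply run_time; first (eapply run_seq; apply: run_nset => _; apply: run_nset); last by [].
    exists k.-1; first by lia.
    rewrite /= /upd /=; split=> [|j|j].
    - lia.
    - rewrite addn1 ltnS leq_eqVlt; case: eqP => [-> _|_ /= /low] //.
      by rewrite high in ib.
    - by rewrite addn1 => ij; case: eqP => [E|_]; [lia|apply: high; lia].
  move=> s1 F1 [ex [k [kl low high]]] _; apply: run_nset => dig vlt.
  move: ex; rewrite /= (F1.1 2%N 3%N) // (F1.1 2%N 4%N) //= /upd /= slen sbase.
  set i := nmem s1 2 23 in kl low high *.
  have b0 : (0 < base)%N.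
    by case: (posnP base) vlt => // ->; case: (len) => [|l]; rewrite ?expn0 ?exp0n.
  have lowE j : (j < i)%N -> nmem s 3 j = base.-1 /\ nmem s1 3 j = 0%N.
    move=> ji; have [h1 ->] := low j ji; split=> //.
    by have := dig j (leq_trans ji (_ : i <= len)%N); lia.
  have [il|il] := ltnP i len; last first.
    exfalso; have iE : i = len by lia.
    move: vlt; rewrite -(_ : (value len base (nmem s 3)).+1 = base ^ len)%N ?ltnn //.
    rewrite /value -iE; elim: (i) lowE => [|a IH] lowE; first by rewrite big_ord0.
    rewrite big_ord_recr /= -addSn IH; last by move=> j ja; apply: lowE; apply: ltnW.
    by have [-> _] := lowE a (ltnSn a); rewrite expnS; move: (base ^ a)%N => B; nia.
  rewrite andTb -ltnNge addn1 => ib.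
  set g := fun j => _.
  have gE : value len base g = (value len base (nmem s 3)).+1.
    apply: (@value_carry _ _ i) => // [j ji||j ij jl].
    - have [h1 h2] := lowE j ji; split=> //; rewrite /g; case: eqP => //; lia.
    - by rewrite /g eqxx high // addn1.
    - by rewrite /g; case: eqP => [|_]; [lia|apply: high; lia].
  split=> // j jl; rewrite -/(g j) /g; case: eqP => [_|ji]; first by lia.
  case: (ltnP j i) => ij; first by have [_ ->] := lowE j ij.
  by rewrite high //; apply: dig.
rewrite /=; lia.
Qed.

Definition try_state : cmd :=
  Seq build (Seq solver (If (NLe (NConst 1) (sc 14)) (NSet 2 (NConst 6) (NConst 1)) Skip)).

Definition search : cmd := For 7 (sc 5) (Seq (For 8 nE try_state) increment).

Section Search.
Variables (m n : nat) (Q : 'I_n -> 'M[strop rat]_m).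
Variables (mode len base : nat) (sgn del eps K : rat) (kb : nat) (cert : Prop).
Hypotheses (sgn1 : sgn ^+ 2 = 1) (del1 : 0 <= del <= 1) (K1 : 1 <= K) (Kkb : K <= 2 ^+ kb).

Let row pol k0 := lp_row Q mode pol sgn del eps k0.

Hypothesis sound : forall pol k0, (k0 < n)%N -> (forall i, (i < len)%N -> (pol i < base)%N) ->
  (exists w, forall r, (r < nrows m n)%N -> 0 < dot n.+1 (row pol k0 r) w) -> cert.

(** Only the first [len] cells of the policy array are controlled, hence the quantification over all
    arrays that agree with [f] there. *)
Definition conclusive (f : nat -> nat) : Prop :=
  (forall i, (i < len)%N -> (f i < base)%N) /\
  exists2 k0, (k0 < n)%N & forall pol, (forall i, (i < len)%N -> pol i = f i) ->
    exists x, witness (nrows m n) n.+1 (row pol k0) K x.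

Record ready (s : state) : Prop := {
  ready_env : env Q s;
  ready_dims : dims (nrows m n) n.+1 s;
  ready_K : qmem s 2 2 = K;
  ready_mode : nmem s 2 2 = mode;
  ready_len : nmem s 2 3 = len;
  ready_base : nmem s 2 4 = base;
  ready_count : nmem s 2 5 = (base ^ len)%N;
  ready_eps : qmem s 2 5 = eps;
  ready_del : qmem s 2 6 = del;
  ready_sgn : qmem s 2 7 = sgn }.

Lemma frame_ready c s s' :
  (forall a i, (a \in [:: 0; 1])%N || (a == 2%N) && (i < 6)%N -> ~~ nwrites c a i) ->
  (forall a i, (a \in [:: 0; 1])%N || (a == 2%N) && (1 < i < 8)%N -> ~~ qwrites c a i) ->
  frame c s s' -> ready s -> ready s'.
Proof.
move=> wn wq F [[e0 e1 e2 e3 e4] [d0 d1] *]; split; try by [rewrite F.1 ?wn|rewrite F.2 ?wq].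
- by split; [rewrite F.1 ?wn|rewrite F.1 ?wn|move=> p; rewrite F.1 ?wn
    |move=> p; rewrite F.2 ?wq|move=> p; rewrite F.2 ?wq].
- by split; rewrite F.1 ?wn.
Qed.

Lemma search_writes a i : (a \in [:: 0; 1])%N || (a == 2%N) && (i < 6)%N -> ~~ nwrites search a i.
Proof. by case: a => [|[|[|a]]] //; case: i => [|[|[|[|[|[|i]]]]]]. Qed.

Lemma search_qwrites a i :
  (a \in [:: 0; 1])%N || (a == 2%N) && (1 < i < 8)%N -> ~~ qwrites search a i.
Proof. by case: a => [|[|[|a]]] //; case: i => [|[|[|[|[|[|[|[|i]]]]]]]]. Qed.

Definition try_time : nat := (build_time m n + (solver_time (nrows m n) n.+1 kb + 10))%N.

(** The alternatives may overlap: a feasible system without a witness of margin [K^-1] can be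
    reported either way, and both reports are true. *)
Lemma run_try s k0 : ready s -> (k0 < n)%N -> nmem s 2 8 = k0 ->
  (forall i, (i < len)%N -> (nmem s 3 i < base)%N) ->
  run try_state s try_time (fun s' =>
    (nmem s' 2 6 = nmem s 2 6 /\ forall x, ~ witness (nrows m n) n.+1 (row (nmem s 3) k0) K x) \/
    (nmem s' 2 6 = 1%N /\ cert)).
Proof.
move=> rs k0n sk dig.
eapply run_time; first eapply run_seq.
  apply: run_weaken (run_build (ready_env rs)) (leqnn _) _ => s1 F1 H1 _.
  have rs1 : ready s1.
    by apply: frame_ready F1 rs => a i; case: a => [|[|[|a]]] //;
      case: i => [|[|[|[|[|[|[|[|i]]]]]]]].
  eapply run_seq; apply: run_weaken (leqnn _) _.
    apply: (@run_solver (nrows m n) n.+1 (row (nmem s 3) k0) K kb K1 Kkb _ s1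
      (ready_dims rs1) (ready_K rs1)).
      by move=> r rN; apply: lp_row_norm.
    move=> r c rN cn; rewrite H1 // /row (ready_mode rs) (ready_sgn rs) (ready_del rs).
    by rewrite (ready_eps rs) sk.
  move=> s2 F2 ans _; eapply run_if => /= h14.
    case: ans => [[_ Hw]|[r0 _]]; last by rewrite r0 in h14.
    apply: run_nset; right; split=> //; exact: sound k0n dig Hw.
  case: ans => [[r1 _]|[r0 none]]; first by rewrite r1 in h14.
  by apply: run_skip; left; split=> //; rewrite F2.1 // F1.1.
by rewrite /try_time !leq_add2l.
Qed.

Definition search_time : nat :=
  for_time (base ^ len) (for_time n try_time 2 + (30 * len + 60)) 2.

Lemma run_search s : ready s -> nmem s 2 6 = 0%N -> (forall i, nmem s 3 i = 0%N) ->
  run search s search_time (fun s' =>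
    [/\ (nmem s' 2 6 <= 1)%N, nmem s' 2 6 = 1%N -> cert &
        forall f, conclusive f -> nmem s' 2 6 = 1%N]).
Proof.
move=> rs f0 pol0.
(* After [p] rounds every conclusive policy of number below [p] has raised the flag, and the array
   holds the digits of [p] unless all policies have been tried. *)
pose Inv p s' := [/\ (nmem s' 2 6 <= 1)%N, nmem s' 2 6 = 1%N -> cert,
  forall f, conclusive f -> (value len base f < p)%N -> nmem s' 2 6 = 1%N &
  (p < base ^ len)%N -> (forall i, (i < len)%N -> (nmem s' 3 i < base)%N) /\
     value len base (nmem s' 3) = p].
apply: (@run_weaken _ _ search_time _ (Inv (base ^ len)%N)); [|exact: leqnn|]; last first.
  move=> s' _ [h1 h2 h3 _]; split=> // f fc; exact: (h3 f fc (value_lt fc.1)).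
apply: run_for => //.
- by move=> s' F; rewrite /= F.1 // (ready_count rs).
- split=> //=; rewrite /upd /= ?f0 // => bl.
  split=> [i il|]; last by rewrite /value big1 // => i _; rewrite pol0.
  by rewrite pol0; case: (posnP base) bl => // ->; rewrite exp0n //; case: (len) il.
move=> p s1 pP F1 s1p [h1 h2 h3 h4]; have [dig val] := h4 pP.
have rs1 := frame_ready search_writes search_qwrites F1 rs.
eapply run_time; first eapply run_seq.
  apply: run_weaken (leqnn _) _.
    eapply (run_for (b := n) (I := fun k s' => [/\ (nmem s' 2 6 <= 1)%N, nmem s' 2 6 = 1%N -> cert,
      nmem s1 2 6 = 1%N -> nmem s' 2 6 = 1%N &
      forall k0, (k0 < k)%N -> (exists x, witness (nrows m n) n.+1 (row (nmem s1 3) k0) K x) ->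
        nmem s' 2 6 = 1%N])) => //.
    + by move=> s' F; rewrite /= F.1 //; case: (ready_env rs1).
    move=> k s2 kn F2 s2k [g1 g2 g3 g4].
    have rs2 : ready s2.
      by apply: frame_ready F2 rs1 => a i; case: a => [|[|[|a]]] //;
        case: i => [|[|[|[|[|[|[|[|i]]]]]]]].
    have pol2 i : nmem s2 3 i = nmem s1 3 i by rewrite F2.1.
    have dig2 i : (i < len)%N -> (nmem s2 3 i < base)%N by rewrite pol2; apply: dig.
    apply: run_weaken (run_try rs2 kn s2k dig2) (leqnn _) _ => s3 F3.
    have rowE : row (nmem s2 3) k = row (nmem s1 3) k.
      by rewrite /row; congr (lp_row _ _ _ _ _ _ _); apply: boolp.funext.
    case=> [[e6 none]|[e6 ce]]; rewrite /setn /= /upd /= e6; split=> // k0.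
    rewrite ltnS leq_eqVlt => /orP[/eqP ->|/g4 //].
    by rewrite -rowE => -[x /none].
  move=> s2 F2 [g1 g2 g3 g4] _.
  have len2 : nmem s2 2 3 = len by rewrite F2.1 // (ready_len rs1).
  have base2 : nmem s2 2 4 = base by rewrite F2.1 // (ready_base rs1).
  apply: run_weaken (run_increment len2 base2) (leqnn _) _ => s3 F3 Hinc.
  have pol2 : nmem s2 3 = nmem s1 3 by apply: boolp.funext => i; rewrite F2.1.
  rewrite pol2 val in Hinc.
  split=> /=; rewrite /upd /= ?F3.1 //.
  - move=> f fc; rewrite ltnS leq_eqVlt => /orP[/eqP vf|vf]; last by apply/g3/(h3 f).
    have [fd [k0 k0n Hk]] := fc; apply: (g4 k0 k0n); apply: Hk.
    by apply: (value_inj dig fd); rewrite val vf.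
  - by move=> p1; apply: Hinc.
by rewrite /search_time /=.
Qed.

End Search.

(** * Preparation of the bounds and choice of the player *)

Fixpoint qpow (e : qexp) (k : nat) : qexp :=
  if k is k'.+1 then QMul e (qpow e k') else QConst 1.

Lemma qeval_pow s e k : qeval s (qpow e k) = qeval s e ^+ k.
Proof. by elim: k => //= k ->; rewrite exprS. Qed.

(** [size_bound], [kap] and [kap ^ 13] arise by repeated multiplication, so at unit cost the time
    depends on [m] and [n] but not on the length of the numbers. *)
Definition bounds : cmd :=
  Seq (NSet 2 (NConst 0) (NMul (NMul (NMul (NMul nS mE) mE) nE) nE))
  (Seq (NSet 2 (NConst 1) nS)
  (Seq (QSet 2 (NConst 4) (QConst 1))
  (Seq (For 20 (NMul (NMul nE mE) mE)
          (QSet 2 (NConst 4) (QMul (qsc 4)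
             (QMul (QAdd (QConst 1) (QMul (QGet 0 (sc 20)) (QGet 0 (sc 20)))) (QGet 1 (sc 20))))))
  (Seq (QSet 2 (NConst 3) (QConst 1))
  (Seq (For 20 nS (QSet 2 (NConst 3)
          (QMul (qsc 3) (QMul (QOfNat (NMul (NConst 8) nS)) (qsc 4)))))
       (QSet 2 (NConst 2) (qpow (qsc 3) 13))))))).

Definition count (v : nat) (b e : nexp) : cmd :=
  Seq (NSet 2 (NConst v) (NConst 1)) (For 20 e (NSet 2 (NConst v) (NMul (sc v) b))).

Definition set_mode (mode : nat) (len base P : nexp) (eps del sgn : qexp) : cmd :=
  Seq (NSet 2 (NConst 2) (NConst mode))
  (Seq (NSet 2 (NConst 3) len)
  (Seq (NSet 2 (NConst 4) base)
  (Seq (NSet 2 (NConst 5) P)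
  (Seq (QSet 2 (NConst 5) eps)
  (Seq (QSet 2 (NConst 6) del)
       (QSet 2 (NConst 7) sgn)))))).

Definition twonE : nexp := NMul (NConst 2) nE.

Definition choose_mode : cmd :=
  If (NLe (sc 21) (sc 22))
     (set_mode 0 mE nE (sc 21) (qpow (QDiv (QConst 1) (qsc 3)) 3)
        (qpow (QDiv (QConst 1) (qsc 3)) 5) (QConst 1))
     (set_mode 1 twonE mE (sc 22) (QConst 0) (QConst 0) (QConst (-1))).

Definition prelude : cmd :=
  Seq bounds (Seq (count 21 nE mE) (Seq (count 22 mE twonE) choose_mode)).

(** A raised flag certifies a won game in mode 0 and a lost one in mode 1. Lost games are the
    trivial spectrahedra, so mode 0 negates the flag. *)
Definition finish : cmd :=
  NSet 0 (NConst 0)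
    (NAdd (NMul (sc 2) (sc 6)) (NMul (NSub (NConst 1) (sc 2)) (NSub (NConst 1) (sc 6)))).

Definition tmsdfp_program : cmd := Seq prelude (Seq search finish).

Lemma run_count v b e s T y : v != 20%N ->
  (forall s', frame (count v b e) s s' -> neval s' b = y /\ neval s' e = T) ->
  run (count v b e) s (3 + for_time T (ncost b + 5) (ncost e)) (fun s' => nmem s' 2 v = (y ^ T)%N).
Proof.
move=> v20 H; apply: run_seq; apply: run_nset => F0.
have sub s' : frame (For 20 e (NSet 2 (NConst v) (NMul (sc v) b)))
   (State (upd (nmem s) 2 (neval s (NConst v)) (neval s (NConst 1))) (qmem s)) s' ->
    frame (count v b e) s s'.
  move=> F; apply: frame_trans (frame_sub _ _ F0) (frame_sub _ _ F) => a i /= H1 //;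
    by rewrite H1 ?orbT.
apply: run_weaken (run_for (b := T) (T := (1 + ncost (NMul (sc v) b)).+1)
  (I := fun i s' => nmem s' 2 v = (y ^ i)%N) _ _ _ _) _ _ => //.
- by rewrite /= eq_sym (negbTE v20).
- by move=> s' /sub/H[].
- by rewrite /= /upd /= (negbTE v20) eqxx.
- move=> i s' iT /sub/H[by_ _] _ Is; apply: run_nset.
  by rewrite /= /upd /= eqxx (negbTE v20) by_ Is expnS mulnC.
by rewrite /for_time /=; nia.
Qed.

Section Prelude.
Variables (m n : nat) (Q : 'I_n -> 'M[strop rat]_m).

Lemma run_bounds s : env Q s ->
  run bounds s (100 * (n * m * m).+1 + 100 * n.+1 + 200)
    (fun s' => [/\ nmem s' 2 0 = nrows m n, nmem s' 2 1 = n.+1,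
       qmem s' 2 3 = (kap Q)%:R & qmem s' 2 2 = (kap Q)%:R ^+ 13]).
Proof.
move=> se; have [n0 m0 k0 num0 den0] := se.
eapply run_time; first eapply run_seq.
  apply: run_nset => _; eapply run_seq; apply: run_nset => _; eapply run_seq.
  apply: run_qset => _; eapply run_seq; apply: run_weaken (leqnn _) _.
    eapply (run_for (b := (n * m * m)%N)
      (I := fun i s' => qmem s' 2 4 = (\prod_(p < i) ent_factor Q p)%N%:R)) => //.
    + by move=> s' F /=; rewrite !F.1 //= /upd /= n0 m0.
    + by rewrite /= /upd /= big_ord0.
    move=> i s' ib F si Is; apply: run_qset.
    rewrite /= /upd /= Is si !F.2 //= /upd /= num0 den0 big_ord_recr /= natrM; congr (_ * _).
    rewrite /ent_factor natrM natrD natrX !natr_absz (gtr0_norm (denq_gt0 _)).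
    by congr ((1 + _) * _); rewrite -expr2 intr_norm real_normK ?num_real.
  move=> s1 F1 H1 _; eapply run_seq; apply: run_qset => _; eapply run_seq.
  apply: run_weaken (leqnn _) _.
    eapply (run_for (b := n.+1)
      (I := fun i s' => qmem s' 2 3 = ((8 * n.+1 * size_bound Q) ^ i)%N%:R)) => //.
    + by move=> s' F /=; rewrite F.1 //= F1.1 //= /upd /= n0 addn1.
    move=> i s' ib F si Is; apply: run_qset.
    rewrite /= /upd /= Is F.2 //= /upd /= H1 F.1 //= F1.1 //= /upd /= n0 addn1.
    by rewrite -!natrM expnS; congr (_%:R); rewrite mulnC.
  move=> s2 F2 H2 _; apply: run_qset; rewrite qeval_pow /= /upd /=; split.
  - by rewrite F2.1 //= F1.1 //= /upd /= n0 m0 addn1.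
  - by rewrite F2.1 //= F1.1 //= /upd /= n0 addn1.
  - by rewrite H2.
  - by rewrite H2.
by rewrite /for_time /=; nia.
Qed.


Definition prelude_time : nat :=
  (100 * (n * m * m).+1 + 100 * n.+1 + 200 + (30 * m.+1 + (30 * (2 * n).+1 + 200)))%N.

Lemma env_init : env Q (init_state Q).
Proof. by []. Qed.

Lemma run_prelude :
  run prelude (init_state Q) prelude_time (fun s =>
    [/\ nmem s 2 6 = 0%N, forall i, nmem s 3 i = 0%N &
       if (n ^ m <= m ^ (2 * n))%N then
         ready Q 0 m n 1 (del_of Q) (eps_of Q) ((kap Q)%:R ^+ 13) s
       else ready Q 1 (2 * n) m (-1) 0 0 ((kap Q)%:R ^+ 13) s]).
Proof.
have e0 := env_init.
eapply run_time; first eapply run_seq.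
  apply: run_weaken (run_bounds e0) (leqnn _) _ => s1 F1 [N1 d1 k1 K1] _; eapply run_seq.
  have e1 : env Q s1 by apply: frame_env F1 e0.
  apply: run_weaken (leqnn _) _.
    apply: (@run_count 21 nE mE s1 m n) => // s' F.
    have: env Q s' by apply: frame_env F e1.
    by case.
  move=> s2 F2 A2 _; eapply run_seq.
  have e2 : env Q s2 by apply: frame_env F2 e1.
  apply: run_weaken (leqnn _) _.
    apply: (@run_count 22 mE twonE s2 (2 * n) m) => // s' F.
    have: env Q s' by apply: frame_env F e2.
    by case=> h1 h2 _ _ _; rewrite /= h1 h2.
  move=> s3 F3 B3 _.
  have [n3 m3 k3 q3 p3] : env Q s3 by apply: frame_env F3 e2.
  have A3 : nmem s3 2 21 = (n ^ m)%N by rewrite F3.1.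
  have kap3 : qmem s3 2 3 = (kap Q)%:R by rewrite F3.2 // F2.2.
  have K3 : qmem s3 2 2 = (kap Q)%:R ^+ 13 by rewrite F3.2 // F2.2.
  have N3 : nmem s3 2 0 = nrows m n by rewrite F3.1 // F2.1.
  have d3 : nmem s3 2 1 = n.+1 by rewrite F3.1 // F2.1.
  have f3 : nmem s3 2 6 = 0%N by rewrite F3.1 // F2.1 // F1.1.
  have pol3 i : nmem s3 3 i = 0%N by rewrite F3.1 // F2.1 // F1.1.
  have cond : beval s3 (NLe (sc 21) (sc 22)) = (n ^ m <= m ^ (2 * n))%N by rewrite /= A3 B3.
  eapply run_if; rewrite cond => Hc; rewrite ?Hc ?(negbTE Hc).
    do 4 (eapply run_seq; apply: run_nset => _).
    do 2 (eapply run_seq; apply: run_qset => _); apply: run_qset.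
    rewrite !qeval_pow; split.
    - by rewrite /= /upd /= f3.
    - by move=> i; rewrite /= /upd /= pol3.
    split.
    - by split.
    - by split; rewrite /= /upd /=.
    - by rewrite /= /upd /= K3.
    - by rewrite /= /upd /=.
    - by rewrite /= /upd /= m3.
    - by rewrite /= /upd /= n3.
    - by rewrite /= /upd /= A3.
    - by rewrite /= /upd /= kap3 div1r.
    - by rewrite /= /upd /= kap3 div1r.
    - by rewrite /= /upd /=.
  do 4 (eapply run_seq; apply: run_nset => _).
  do 2 (eapply run_seq; apply: run_qset => _); apply: run_qset.
  split.
  - by rewrite /= /upd /= f3.
  - by move=> i; rewrite /= /upd /= pol3.
  split.
  - by split.
  - by split; rewrite /= /upd /=.
  - by rewrite /= /upd /= K3.
  - by rewrite /= /upd /=.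
  - by rewrite /= /upd /= n3.
  - by rewrite /= /upd /= m3.
  - by rewrite /= /upd /= B3.
  - by rewrite /= /upd /=.
  - by rewrite /= /upd /=.
  - by rewrite /= /upd /=.
by rewrite /prelude_time /for_time /=; nia.
Qed.

End Prelude.

(** * Correctness of the whole program *)

Section Correctness.
Variables (R : realType) (m n : nat) (Q : 'I_n -> 'M[strop rat]_m) (kb : nat).
Hypothesis inst : tmsdfp_instance Q.
Hypothesis kapkb : (kap Q ^ 13 <= 2 ^ kb)%N.

Definition policy_count : nat := minn (n ^ m) (m ^ (2 * n)).

Definition total_time : nat :=
  (prelude_time m n + ((for_time policy_count
     (for_time n (try_time m n kb) 2 + (30 * (m + 2 * n) + 60)) 2) + 30))%N.

Lemma leq_for_time b T T' ce : (T <= T')%N -> (for_time b T ce <= for_time b T' ce)%N.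
Proof. by move=> TT; rewrite /for_time leq_add2r leq_mul2l; apply/orP; right; lia. Qed.

Lemma kap13_ge1 : 1 <= (kap Q)%:R ^+ 13 :> rat.
Proof.
rewrite -natrX ler1n expn_gt0; have := kap_ge Q; have := size_bound_gt0 Q.
by case: (kap Q) => //; case: (size_bound Q).
Qed.

Lemma kap13_le : (kap Q)%:R ^+ 13 <= 2 ^+ kb :> rat.
Proof. by rewrite -!natrX ler_nat. Qed.

Lemma del_of_bounds : 0 <= del_of Q <= 1.
Proof.
by have [kap8 _ _ _] := kap_bounds Q; have [_] := perturbation_params kap8.
Qed.

(** If the game is won, the policy of [mode0_complete] raises the flag. If it is lost, a raised flag
    would prove it won as well, against [losing_trivial] and [winning_nontrivial]. *)
Lemma run_search0 s : ready Q 0 m n 1 (del_of Q) (eps_of Q) ((kap Q)%:R ^+ 13) s ->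
  nmem s 2 6 = 0%N -> (forall i, nmem s 3 i = 0%N) ->
  run search s (search_time m n m n kb)
    (fun s' => nmem s' 2 6 = ~~ `[< trivial_spectrahedron (to_real R Q) >]).
Proof.
move=> rs f0 pol0.
have sound pol k0 : (k0 < n)%N -> (forall i, (i < m)%N -> (pol i < n)%N) ->
    (exists w, forall r, (r < nrows m n)%N ->
      0 < dot n.+1 (lp_row Q 0 pol 1 (del_of Q) (eps_of Q) k0 r) w) -> winning (metzler_game Q).
  by move=> k0n dig [w Hw]; apply: (mode0_sound inst (k0 := Ordinal k0n) dig Hw).
apply: run_weaken (run_search _ del_of_bounds kap13_ge1 kap13_le sound rs f0 pol0) (leqnn _) _.
  by rewrite expr1n.
move=> s' _ [le1 cert conc]; have [win|lose] := metzler_dichotomy inst.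
  have -> : `[< trivial_spectrahedron (to_real R Q) >] = false.
    by apply/asboolPn; apply: winning_nontrivial.
  have [sigma [k0 Hs]] := mode0_complete inst win.
  apply: (conc (fun i => if insub i is Some i' then nat_of_ord (sigma i') else 0%N)).
  split=> [i im|]; first by rewrite insubT.
  exists k0 => // pol polE; apply: Hs => i; rewrite polE //.
  by rewrite valK.
have -> : `[< trivial_spectrahedron (to_real R Q) >].
  by apply/asboolP; apply: losing_trivial.
case E: (nmem s' 2 6) le1 cert => [|[|//]] // _ /(_ erefl) win.
by case: (winning_nontrivial (R := R) win); apply: losing_trivial.
Qed.

Lemma run_search1 s : (0 < n)%N -> ready Q 1 (2 * n) m (-1) 0 0 ((kap Q)%:R ^+ 13) s ->
  nmem s 2 6 = 0%N -> (forall i, nmem s 3 i = 0%N) ->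
  run search s (search_time m n (2 * n) m kb)
    (fun s' => nmem s' 2 6 = `[< trivial_spectrahedron (to_real R Q) >]).
Proof.
move=> n0 rs f0 pol0.
have sound pol k0 : (k0 < n)%N -> (forall i, (i < 2 * n)%N -> (pol i < m)%N) ->
    (exists w, forall r, (r < nrows m n)%N ->
      0 < dot n.+1 (lp_row Q 1 pol (-1) 0 0 k0 r) w) -> losing (metzler_game Q).
  by move=> k0n dig [w Hw]; apply: (mode1_sound inst (k0 := Ordinal k0n) dig Hw).
have z01 : 0 <= (0 : rat) <= 1 by rewrite lexx ler01.
apply: run_weaken (run_search _ z01 kap13_ge1 kap13_le sound rs f0 pol0) (leqnn _) _.
  by rewrite sqrrN expr1n.
move=> s' _ [le1 cert conc]; have [win|lose] := metzler_dichotomy inst.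
  have -> : `[< trivial_spectrahedron (to_real R Q) >] = false.
    by apply/asboolPn; apply: winning_nontrivial.
  case E: (nmem s' 2 6) le1 cert => [|[|//]] // _ /(_ erefl) lose.
  by case: (winning_nontrivial (R := R) win); apply: losing_trivial.
have -> : `[< trivial_spectrahedron (to_real R Q) >].
  by apply/asboolP; apply: losing_trivial.
have [tau Ht] := mode1_complete lose.
(* The [2 n] digits list the pairs [tau k]: first components at even places, second ones at odd
   places. *)
pose f p := if insub (p %/ 2)%N is Some k then
  if odd p then nat_of_ord (tau k).2 else nat_of_ord (tau k).1 else 0%N.
apply: (conc f); split=> [p pn|].
  have pn2 : (p %/ 2 < n)%N by rewrite ltn_divLR // mulnC.
  by rewrite /f insubT; case: odd.
exists 0%N => // pol polE; apply: (Ht pol _ (Ordinal n0)) => k; have kn := ltn_ord k.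
rewrite !polE; [|by lia|by lia]; rewrite /f.
have -> : ((2 * k) %/ 2 = k)%N by rewrite mulKn.
have -> : ((2 * k + 1) %/ 2 = k)%N by rewrite mulnC divnMDl // divn_small ?addn0.
by rewrite valK oddD oddM /=; split.
Qed.

Lemma run_program :
  run tmsdfp_program (init_state Q) total_time (fun s =>
    output s = `[< trivial_spectrahedron (to_real R Q) >] :> nat).
Proof.
eapply run_time; first eapply run_seq.
  apply: run_weaken (run_prelude Q) (leqnn _) _ => s1 F1 [f1 pol1 rs1] _.
  eapply run_seq; apply: (@run_weaken _ _ (for_time policy_count
     (for_time n (try_time m n kb) 2 + (30 * (m + 2 * n) + 60)) 2) _ (fun s2 =>
     nmem s2 2 6 = (if (n ^ m <= m ^ (2 * n))%N then ~~ `[< trivial_spectrahedron (to_real R Q) >]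
       else `[< trivial_spectrahedron (to_real R Q) >]) /\
     nmem s2 2 2 = ~~ (n ^ m <= m ^ (2 * n))%N)); [|exact: leqnn|].
    rewrite /policy_count; case: leqP rs1 => [le|lt] rs1.
      apply: run_weaken (run_search0 rs1 f1 pol1) _ _.
        by apply: leq_for_time; rewrite leq_add2l; lia.
      by move=> s2 F2 E; split=> //; rewrite F2.1 // (ready_mode rs1).
    (* For [n = 0] the comparison [n ^ m <= m ^ 0 = 1] holds, so mode 1 is chosen only when a
       restart state exists. *)
    have n0 : (0 < n)%N.
      case: (n) lt => // lt; move: lt; rewrite muln0 expn0.
      by case: (m) => [|k]; rewrite ?expn0 ?exp0n.
    apply: run_weaken (run_search1 n0 rs1 f1 pol1) _ _.
      by apply: leq_for_time; rewrite leq_add2l; lia.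
    by move=> s2 F2 E; split=> //; rewrite F2.1 // (ready_mode rs1).
  move=> s2 F2 [f2 mode2] _; apply: run_nset.
  rewrite /output /= /upd /= f2 mode2.
  by case: (_ <= _)%N; case: `[< _ >].
by rewrite /total_time /=; lia.
Qed.

End Correctness.

(** * The polynomial factor of the running time *)

Lemma int_bits_lt (z : int) : (`|z| < 2 ^ int_bits z)%N.
Proof.
apply: (@leq_trans (2 ^ up_log 2 `|z|.+1)); first exact: up_logP.
by rewrite leq_exp2l.
Qed.

(** The summands come from [8 = 2 ^ 3], [n.+1 <= 2 ^ n.+1] and [3 L] bits for each of the [n m m]
    factors of [size_bound]; the multipliers are the exponents [n.+1] and 13. *)
Definition kap_bits (m n L : nat) : nat := (13 * (n.+1 * (3 + n.+1 + 3 * L * (n * m * m))))%N.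

Section Size.
Variables (m n : nat) (Q : 'I_n -> 'M[strop rat]_m).

(** As [1 + a^2 <= (a + 1)^2], the factor takes at most three times the bits of the entry. *)
Lemma ent_factor_bits p : (ent_factor Q p <= 2 ^ (3 * max_bits Q))%N.
Proof.
rewrite /ent_factor; suff [b [H1 H2 bL]] : exists b,
    [/\ (`|numq (modulus (entry_at Q p))|.+1 <= 2 ^ b)%N,
        (`|denq (modulus (entry_at Q p))| <= 2 ^ b)%N & (b <= max_bits Q)%N].
  apply: (@leq_trans ((2 ^ b) ^ 3)); last by rewrite -expnM leq_exp2l // mulnC leq_mul2l bL orbT.
  rewrite (_ : (2 ^ b) ^ 3 = 2 ^ b * 2 ^ b * 2 ^ b)%N; last by rewrite !expnS expn0 !muln1 mulnA.
  by apply: leq_mul => //; apply: leq_trans (leq_mul H1 H1); rewrite !expnS expn0; nia.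
have dflt : exists b, [/\ (`|numq (modulus TNinf)|.+1 <= 2 ^ b)%N,
    (`|denq (modulus TNinf)| <= 2 ^ b)%N & (b <= max_bits Q)%N] by exists 0%N.
rewrite /entry_at; case: insubP => [k _ _|//]; case: insubP => [i _ _|//].
case: insubP => [j _ _|//].
have bL : (strop_bits (Q k i j) <= max_bits Q)%N.
  apply: leq_trans (leq_bigmax k); apply: leq_trans (leq_bigmax i).
  exact: (leq_bigmax j).
exists (strop_bits (Q k i j)); move: bL => ->.
have bits (q : rat) : (`|numq q|.+1 <= 2 ^ (rat_bits q).+2)%N /\
    (`|denq q| <= 2 ^ (rat_bits q).+2)%N.
  have := int_bits_lt (numq q); have := int_bits_lt (denq q); rewrite /rat_bits.
  have le a b : (a <= b)%N -> (2 ^ a <= 2 ^ b)%N by rewrite leq_exp2l.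
  have := le (int_bits (numq q)) (int_bits (numq q) + int_bits (denq q)).+2.
  have := le (int_bits (denq q)) (int_bits (numq q) + int_bits (denq q)).+2.
  by move=> /(_ _)h1 /(_ _)h2 d1 d2; split; [apply: leq_trans d2 (h2 _)|apply: leq_trans (ltnW d1) (h1 _)]; lia.
case: (Q k i j) => [q|q|]; [have [h1 h2] := bits q; by split..|by split].
Qed.

Lemma kap_le_bits : (kap Q ^ 13 <= 2 ^ kap_bits m n (max_bits Q))%N.
Proof.
rewrite /kap_bits mulnC expnM leq_exp2r // /kap [(n.+1 * (_ + _))%N]mulnC expnM leq_exp2r //.
rewrite !expnD; apply: leq_mul; first by apply: leq_mul => //; apply: ltnW; apply: ltn_expl.
rewrite [(3 * _ * _)%N]mulnC mulnC expnM; set B := (2 ^ (3 * max_bits Q))%N.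
rewrite /size_bound -[X in (_ <= _ ^ X)%N](card_ord (n * m * m)) -prod_nat_const.
by apply: leq_prod => p _; apply: ent_factor_bits.
Qed.

End Size.

(** Bounds of this shape are closed under sums and products; the summand 1 keeps the base positive,
    so that exponents may be raised. *)
Definition polynomially_bounded (f : nat -> nat -> nat -> nat) : Prop :=
  exists C D, forall m n L, (f m n L <= C * (m + n + L + 1) ^ D)%N.

Lemma pb_const c : polynomially_bounded (fun _ _ _ => c).
Proof. by exists c, 0%N => m n L; rewrite expn0 muln1. Qed.

Lemma pb_m : polynomially_bounded (fun m _ _ => m).
Proof. by exists 1%N, 1%N => m n L; rewrite expn1; lia. Qed.

Lemma pb_n : polynomially_bounded (fun _ n _ => n).
Proof. by exists 1%N, 1%N => m n L; rewrite expn1; lia. Qed.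

Lemma pb_L : polynomially_bounded (fun _ _ L => L).
Proof. by exists 1%N, 1%N => m n L; rewrite expn1; lia. Qed.

Lemma pb_add f g : polynomially_bounded f -> polynomially_bounded g ->
  polynomially_bounded (fun m n L => f m n L + g m n L)%N.
Proof.
move=> [C [D H]] [C' [D' H']]; exists (C + C')%N, (D + D')%N => m n L.
have B1 : (0 < m + n + L + 1)%N by lia.
rewrite mulnDl expnD; apply: leq_add.
  apply: leq_trans (H m n L) _; rewrite leq_mul2l; apply/orP; right.
  by rewrite leq_pmulr // expn_gt0 B1.
apply: leq_trans (H' m n L) _; rewrite leq_mul2l; apply/orP; right.
by rewrite leq_pmull // expn_gt0 B1.
Qed.

Lemma pb_mul f g : polynomially_bounded f -> polynomially_bounded g ->
  polynomially_bounded (fun m n L => f m n L * g m n L)%N.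
Proof.
move=> [C [D H]] [C' [D' H']]; exists (C * C')%N, (D + D')%N => m n L.
by apply: leq_trans (leq_mul (H m n L) (H' m n L)) _; rewrite expnD mulnACA.
Qed.

Lemma pb_succ f : polynomially_bounded f -> polynomially_bounded (fun m n L => (f m n L).+1).
Proof.
move=> /pb_add/(_ (pb_const 1))[C [D H]]; exists C, D => m n L.
by rewrite -addn1.
Qed.

Definition time_factor (m n L : nat) : nat :=
  (prelude_time m n + (for_time n (try_time m n (kap_bits m n L)) 2 + 30 * (m + 2 * n) + 200))%N.

Lemma pb_for_time b T c : polynomially_bounded b -> polynomially_bounded T ->
  polynomially_bounded (fun m n L => for_time (b m n L) (T m n L) c).
Proof.
move=> Hb HT; apply: pb_add; last exact: pb_const.
by apply: pb_mul => //; apply: pb_add (pb_const _); apply: pb_add (pb_const c) HT.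
Qed.

Ltac pb := repeat first [exact: pb_const | exact: pb_m | exact: pb_n | exact: pb_L
  | apply: pb_for_time | apply: pb_add | apply: pb_mul | apply: pb_succ].

Lemma time_factor_polynomial : polynomially_bounded time_factor.
Proof.
rewrite /time_factor /try_time /prelude_time /build_time /solver_time /tau /nrows /kap_bits.
pb.
Qed.

Section Majorant.
Import mpoly.

Lemma polynomial_majorant f : polynomially_bounded f ->
  exists P : mpoly 3 int, forall m n L, (f m n L)%:Z <= eval3 P m n L.
Proof.
move=> [C [D H]].
exists (C%:R * ('X_(inord 0) + 'X_(inord 1) + 'X_(inord 2) + 1) ^+ D) => m n L.
rewrite /eval3 rmorphM rmorphXn !rmorphD rmorph1 /= rmorph_nat !mevalXU.
rewrite !(tnth_nth 0) !inordK //=.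
suff -> : C%:R * (m%:Z + n%:Z + L%:Z + 1) ^+ D = (C * (m + n + L + 1) ^ D)%N by rewrite lez_nat.
by rewrite -[RHS]natz natrM natrX !natrD !natz.
Qed.

End Majorant.

Theorem theorem39 (R : realType) :
  exists (c : cmd) (P : mpoly.mpoly 3 int),
    solves_tmsdfp R c
      (fun m n L => (minn (n ^ m) (m ^ (2 * n)))%:Z * eval3 P m n L).
Proof.
have [P HP] := polynomial_majorant time_factor_polynomial.
exists tmsdfp_program, P => m n Q inst.
have [t [s [E tT out]]] := run_program R inst (kap_le_bits Q).
exists t, s; split=> //.
(* A positive number of policies lets the time spent outside the enumeration be absorbed into the
   product. It is positive because an instance with a row has a matrix, and conversely. *)
have P0 : (0 < minn (n ^ m) (m ^ (2 * n)))%N.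
  rewrite leq_min !expn_gt0; apply/andP; split.
    case: (posnP m) => [_|m0]; first by rewrite orbT.
    by have [k _] := inst_diag inst (Ordinal m0); rewrite (leq_ltn_trans _ (ltn_ord k)).
  case: (posnP n) => [n0|n0]; first by rewrite n0 orbT.
  by have [i _] := inst_neg inst (Ordinal n0); rewrite (leq_ltn_trans _ (ltn_ord i)).
apply: (@le_trans _ _ (minn (n ^ m) (m ^ (2 * n)) * time_factor m n (max_bits Q))%N%:Z).
  rewrite lez_nat; apply: leq_trans tT _; rewrite /total_time /policy_count /time_factor.
  rewrite [for_time (minn _ _) _ _]/for_time; move: (minn _ _) P0 => p p0.
  by move: (prelude_time m n) (for_time n _ 2) => a b; nia.
rewrite PoszM ler_wpM2l //; exact: HP.
Qed.
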